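(* Let $\rho:B\twoheadrightarrow\Gamma$ be a Fell bundle over an étale groupoid $\Gamma$. For every $a\in\mathcal{C}^\rho_{\mathsf r}$, there are a $\sigma$-bicompact $K\subseteq\Gamma$ and a subgroupoid $G\subseteq K$ with $G\subseteq\mathcal{C}(a)\cap\mathcal{C}(a_\infty)$ such that $\mathrm{supp}(a)\setminus G$ is meagre and $\|a\|_{\mathsf e}=\|a_G\|_{\mathsf b}$.
   Context: Groupoids. For a groupoid $\Gamma$, $\mathsf{s}(\gamma)=\gamma^{-1}\gamma$, $\mathsf{r}(\gamma)=\gamma\gamma^{-1}$, $\Gamma^0\subseteq\Gamma$ is the set of units, and $\Gamma^2$ is the set of composable pairs ($(\alpha,\beta)\in\Gamma^2$ iff $\mathsf{s}(\alpha)=\mathsf{r}(\beta)$). For $x\in\Gamma^0$, $\Gamma x=\{\gamma:\mathsf{s}(\gamma)=x\}$. A subgroupoid is a subset closed under inverses and defined products. An étale groupoid is a groupoid with a topology making product and inverse continuous and such that $\mathsf{s}$ is an open map. No Hausdorff, local compactness or countability assumption is made, even on $\Gamma^0$. A slice is a subset on which $\mathsf{s}$ and $\mathsf{r}$ are injective. A subset $K\subseteq\Gamma$ is biclosed if $\mathsf{s}[K]$ and $\mathsf{r}[K]$ are closed in $\Gamma^0$; bicompact if it is a biclosed compact subset of an open slice; $\sigma$-bicompact if it is a countable union of bicompact subsets. Nowhere dense means the closure has empty interior; meagre means a countable union of nowhere dense sets (in $\Gamma$). Fell bundles. A semigroupoid is a set with a partial binary operation such that $(ab)c$ is defined iff $a(bc)$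 is, in which case they are equal; a *-semigroupoid also has an involution with $a^{**}=a$ and $(ab)^*=b^*a^*$ whenever $ab$ is defined. A Banach bundle is an open continuous surjection $\rho:B\twoheadrightarrow X$ of topological spaces such that each fibre $B_x=\rho^{-1}\{x\}$ is a complex Banach space (zero $0_x$); for each $\lambda\in\mathbb{C}$, $b\mapsto\lambda b$ is continuous on $B$; addition is continuous on $\{(a,b):\rho(a)=\rho(b)\}$; the norm is upper semicontinuous on $B$; and $\rho(b_\lambda)\to x$, $\|b_\lambda\|\to0$ imply $b_\lambda\to0_x$ for nets. A Fell bundle is a Banach bundle $\rho:B\twoheadrightarrow\Gamma$ such that: (1) $B$ is a *-semigroupoid with continuous product and involution, products are bilinear and $*$ is antilinear; (2) the norm is submultiplicative, $\Gamma$ is an étale groupoid, $ab$ is defined iff $(\rho(a),\rho(b))\in\Gamma^2$, in which case $\rho(ab)=\rho(a)\rho(b)$, and $\rho(a^* )=\rho(a)^{-1}$; (3) for all $b\in B$, $\|b^*b\|=\|b\|^2$ and there is $a\in B_{\rho(b^*b)}$ with $a^*a=b^*b$. Sections. $\mathcal{S}^\rho$ is the vector space (pointwise operations) of all, possibly discontinuous, sections $a:\Gamma\to B$, $\rho\circ a=\mathrm{id}_\Gamma$. Put $\mathrm{supp}(a)=\{\gamma:a(\gamma)\ne0_\gamma\}$ and $a^*(\gamma)=a(\gamma^{-1})^*$. For $\Delta\subseteq\Gamma$, the $0$-restriction $a_\Delta$ equals $a$ on $\Delta$ and $0_\gamma$ at $\gamma\notin\Delta$. $a_\infty:\Gamma\to[0,\infty)$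 is $a_\infty(\gamma)=\|a(\gamma)\|$, and $\mathcal{C}(g)$ denotes the set of points of $\Gamma$ at which a function $g$ on $\Gamma$ is continuous. The convolution $ab(\gamma)=\sum_{\gamma=\alpha\beta}a(\alpha)b(\beta)$ is ''defined'' if for every $\gamma\in\Gamma$ the net of finite partial sums converges in norm in $B_\gamma$. $\mathcal{F}^\rho$ denotes the finitely supported sections. Define $[0,\infty]$-valued norms by $$\|a\|_2=\sup_{x\in\Gamma^0}\ \sup_{F\subseteq\Gamma x\text{ finite}}\Big\|\sum_{\gamma\in F}a(\gamma)^*a(\gamma)\Big\|^{1/2},\qquad \|a\|_{\mathsf b}=\sup_{f\in\mathcal{F}^\rho}\frac{\|af\|_2}{\|f\|_2}\quad(0/0=0).$$ Let $\mathcal{S}^\rho_{\mathsf b}=\{a:\|a\|_{\mathsf b}<\infty\}$. The big C*-algebra is $\mathcal{B}^\rho=\{a\in\mathcal{S}^\rho_{\mathsf b}:a^*a\text{ and }aa^*\text{ are defined}\}$, with convolution, $*$ and norm $\|\cdot\|_{\mathsf b}$. For $Y\subseteq\Gamma$, $\mathcal{C}^\rho(Y)$ is the set of $a\in\mathcal{S}^\rho$ with $\mathrm{supp}(a)\subseteq Y\subseteq\mathcal{C}(a)$. $\mathcal{C}^\rho_{\mathsf c}=\mathrm{span}\{a\in\mathcal{C}^\rho(K):K\subseteq\Gamma\text{ bicompact}\}$, and $\mathcal{C}^\rho_{\mathsf r}=\mathrm{cl}_{\mathsf b}(\mathcal{C}^\rho_{\mathsf c})$ is its $\|\cdot\|_{\mathsf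 b}$-closure, a C*-subalgebra of $\mathcal{B}^\rho$. Essential seminorm. $\mathcal{B}^\rho_\sigma$ is the C*-subalgebra of those $a\in\mathcal{B}^\rho$ with $\mathrm{supp}(a)$ contained in some $\sigma$-bicompact subset of $\Gamma$; it contains $\mathcal{C}^\rho_{\mathsf r}$. $\mathcal{B}^\rho_{\mathsf m}$ is the closed ideal of those $a\in\mathcal{B}^\rho_\sigma$ with $\mathrm{supp}(a)$ meagre. For $a\in\mathcal{B}^\rho_\sigma$, $\|a\|_{\mathsf e}=\inf_{b\in\mathcal{B}^\rho_{\mathsf m}}\|a-b\|_{\mathsf b}$ (the seminorm from the quotient $\mathcal{B}^\rho_\sigma/\mathcal{B}^\rho_{\mathsf m}$). The essential C*-algebra of $\rho$ is $\mathcal{C}^\rho_{\mathsf r}/(\mathcal{B}^\rho_{\mathsf m}\cap\mathcal{C}^\rho_{\mathsf r})$. *)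

(* Defs.v *)
From HB Require Import structures.
From mathcomp Require Import all_boot all_order all_algebra finmap.
From mathcomp Require Import complex.
From mathcomp Require Import all_classical all_reals all_analysis.
From mathcomp Require Import summability.

Set Implicit Arguments.
Unset Strict Implicit.
Unset Printing Implicit Defensive.
Import Order.TTheory GRing.Theory Num.Theory.
Import numFieldNormedType.Exports.

Local Open Scope classical_set_scope.
Local Open Scope ring_scope.

Definition nowhere_dense (T : topologicalType) (A : set T) : Prop :=
  (closure A)° = set0.

Definition meagre (T : topologicalType) (A : set T) : Prop :=
  exists2 N : nat -> set T,
    (forall n, nowhere_dense (N n)) & A = \bigcup_n N n.

(* The partial product is a total function whose values are only constrained
   (and only ever used) on the set [composable] of composable pairs. *)
Record groupoidData : Type := GroupoidData {
  arrow :> topologicalType;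
  gmul : arrow -> arrow -> arrow;
  ginv : arrow -> arrow
}.

Arguments gmul {g}.
Arguments ginv {g}.

Section GroupoidData.
Variable G : groupoidData.
Implicit Types (x y z : G) (D : set G).

Definition gsrc x : G := gmul (ginv x) x.
Definition grng x : G := gmul x (ginv x).
Definition units : set G := range gsrc.
Definition composable : set (G * G) := [set p | gsrc p.1 = grng p.2].
Definition source_fibre x : set G := [set y | gsrc y = x].

End GroupoidData.

Arguments units : clear implicits.
Arguments composable : clear implicits.

(* [gsrc] is open as a map into the whole space of arrows, not merely onto the
   subspace of units; in particular the unit space is open. *)
Record etaleGroupoid : Type := EtaleGroupoid {
  groupoid_data :> groupoidData;
  ginvK : forall x : groupoid_data, ginv (ginv x) = x;
  composableM : forall x y z : groupoid_data,
    composable _ (x, y) -> composable _ (y, z) ->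
    composable _ (gmul x y, z) /\ composable _ (x, gmul y z);
  gmulA : forall x y z : groupoid_data,
    composable _ (x, y) -> composable _ (y, z) ->
    gmul (gmul x y) z = gmul x (gmul y z);
  gmulKl : forall x y : groupoid_data,
    composable _ (x, y) -> gmul (ginv x) (gmul x y) = y;
  gmulKr : forall x y : groupoid_data,
    composable _ (x, y) -> gmul (gmul x y) (ginv y) = x;
  ginv_continuous : continuous (@ginv groupoid_data);
  gmul_continuous : {within composable groupoid_data,
    continuous (fun p : groupoid_data * groupoid_data => gmul p.1 p.2)};
  gsrc_open : forall U : set groupoid_data, open U -> open (@gsrc _ @` U)
}.

Section Subsets.
Variable G : etaleGroupoid.
Implicit Types D K : set G.

Definition subgroupoid D : Prop :=
  (forall x, D x -> D (ginv x)) /\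
  (forall x y, D x -> D y -> composable G (x, y) -> D (gmul x y)).

Definition slice D : Prop :=
  {in D &, injective (@gsrc G)} /\ {in D &, injective (@grng G)}.

Definition closed_in_units D : Prop :=
  exists2 C : set G, closed C & D = C `&` units G.

Definition biclosed K : Prop :=
  closed_in_units (@gsrc G @` K) /\ closed_in_units (@grng G @` K).

Definition bicompact K : Prop :=
  [/\ biclosed K, compact K &
      exists O : set G, [/\ open O, slice O & K `<=` O]].

(* The empty set is bicompact, so unions indexed by nat cover the finite
   (and empty) countable unions. *)
Definition sigma_bicompact K : Prop :=
  exists2 k : nat -> set G, (forall n, bicompact (k n)) & K = \bigcup_n k n.

End Subsets.

(* [proj] is the bundle map from the total space [tot]; [fib x] is the complex
   Banach space whose carrier is identified, via the bijection [inj x], with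
   the fibre of [proj] over [x]. *)
Record bundleData (R : realType) (X : topologicalType) : Type := BundleData {
  tot : topologicalType;
  proj : tot -> X;
  fib : X -> completeNormedModType R[i];
  inj : forall x, fib x -> tot;
  inj_bij : forall x, set_bij [set: fib x] (proj @^-1` [set x]) (@inj x)
}.

Section BundleData.
Variables (R : realType) (X : topologicalType) (E : bundleData R X).
Implicit Types (x : X) (b c : tot E) (k : R[i]).

(* The norms of the library over R[i] take (real) values in R[i]. *)
Definition fnorm x (e : fib E x) : R := complex.Re `|e|.

(* Inverse of [inj x]; equal to 0 outside the fibre over [x]. *)
Definition coord x b : fib E x := xget 0 [set e | inj e = b].

(* Fibrewise operations on the total space; [badd b c] is meaningful when
   [proj b = proj c]. *)
Definition badd b c : tot E := inj (coord (proj b) b + coord (proj b) c).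
Definition bscale k b : tot E := inj (k *: coord (proj b) b).
Definition bnorm b : R := fnorm (coord (proj b) b).

End BundleData.

(* The condition on nets is stated with filters on the total space. *)
Record banachBundle (R : realType) (X : topologicalType) : Type := BanachBundle {
  bundle_data :> bundleData R X;
  proj_continuous : continuous (@proj _ _ bundle_data);
  proj_open : forall U : set (tot bundle_data),
    open U -> open (@proj _ _ bundle_data @` U);
  proj_surj : range (@proj _ _ bundle_data) = [set: X];
  bscale_continuous : forall k : R[i], continuous (@bscale _ _ bundle_data k);
  badd_continuous :
    {within [set p : tot bundle_data * tot bundle_data | proj p.1 = proj p.2],
      continuous (fun p : tot bundle_data * tot bundle_data => badd p.1 p.2)};
  bnorm_usc : forall t : R, open [set b : tot bundle_data | bnorm b < t];
  bnorm_cvg0 : forall (F : set_system (tot bundle_data)) (x : X),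
    ProperFilter F ->
    @proj _ _ bundle_data @ F --> x ->
    @bnorm _ _ bundle_data @ F --> (0 : R) ->
    F --> inj (0 : fib bundle_data x)
}.

Definition bcomposable (R : realType) (G : etaleGroupoid)
    (E : bundleData R G) : set (tot E * tot E) :=
  [set p | composable G (proj p.1, proj p.2)].

Arguments bcomposable {R G}.

(* As for groupoids, the partial product [bmul] is a total function that is
   only used on its domain [bcomposable]. As that domain is determined by
   composability in the groupoid, "(ab)c is defined iff a(bc) is" holds
   automatically, and both mean that (a, b) and (b, c) are composable. *)
Record fellBundle (R : realType) (G : etaleGroupoid) : Type := FellBundle {
  banach_bundle :> banachBundle R G;
  bmul : tot banach_bundle -> tot banach_bundle -> tot banach_bundle;
  bstar : tot banach_bundle -> tot banach_bundle;
  proj_bmul : forall a b, bcomposable banach_bundle (a, b) ->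
    proj (bmul a b) = gmul (proj a) (proj b);
  proj_bstar : forall a, proj (bstar a) = ginv (proj a);
  bmulA : forall a b c,
    bcomposable banach_bundle (a, b) -> bcomposable banach_bundle (b, c) ->
    bmul (bmul a b) c = bmul a (bmul b c);
  bstarK : forall a, bstar (bstar a) = a;
  bstarM : forall a b, bcomposable banach_bundle (a, b) ->
    bstar (bmul a b) = bmul (bstar b) (bstar a);
  bmul_continuous : {within bcomposable banach_bundle,
    continuous (fun p : tot banach_bundle * tot banach_bundle => bmul p.1 p.2)};
  bstar_continuous : continuous bstar;
  bmulDl : forall a b c : tot banach_bundle, proj a = proj b ->
    bcomposable banach_bundle (a, c) ->
    bmul (badd a b) c = badd (bmul a c) (bmul b c);
  bmulDr : forall a b c : tot banach_bundle, proj b = proj c ->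
    bcomposable banach_bundle (a, b) ->
    bmul a (badd b c) = badd (bmul a b) (bmul a c);
  bmulZl : forall (k : R[i]) a b, bcomposable banach_bundle (a, b) ->
    bmul (bscale k a) b = bscale k (bmul a b);
  bmulZr : forall (k : R[i]) a b, bcomposable banach_bundle (a, b) ->
    bmul a (bscale k b) = bscale k (bmul a b);
  bstarD : forall a b : tot banach_bundle, proj a = proj b ->
    bstar (badd a b) = badd (bstar a) (bstar b);
  bstarZ : forall (k : R[i]) a, bstar (bscale k a) = bscale k^* (bstar a);
  bnormM : forall a b, bcomposable banach_bundle (a, b) ->
    bnorm (bmul a b) <= bnorm a * bnorm b;
  bnorm_bstar : forall b, bnorm (bmul (bstar b) b) = bnorm b ^+ 2;
  bstar_pos : forall b, exists2 a : tot banach_bundle,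
    proj a = proj (bmul (bstar b) b) & bmul (bstar a) a = bmul (bstar b) b
}.

(* A section as a dependent function into the fibres; [smap] is the
   corresponding map into the total space. *)
Definition section (R : realType) (G : etaleGroupoid) (rho : fellBundle R G)
  : Type := forall x : G, fib rho x.

Section Sections.
Variables (R : realType) (G : etaleGroupoid) (rho : fellBundle R G).
Implicit Types (a b f : section rho) (x y : G) (D K Y : set G).

Definition smap a : G -> tot rho := fun x => inj (a x).

Definition ssub a b : section rho := fun x => a x - b x.

Definition supp a : set G := [set x | a x != 0].

Definition sstar a : section rho := fun x => coord x (bstar (inj (a (ginv x)))).

Definition restr0 D a : section rho :=
  fun x => if `[< D x >] then a x else 0.

Definition normfun a : G -> R := fun x => fnorm (a x).

Definition cont_points (T : topologicalType) (g : G -> T) : set G :=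
  [set x | {for x, continuous g}].

Definition factors x : set (G * G) :=
  [set p | composable G p /\ gmul p.1 p.2 = x].

Definition conv_partial a b x (F : {fset G * G}) : fib rho x :=
  \sum_(p <- enum_fset F | `[< factors x p >])
    coord x (bmul (inj (a p.1)) (inj (b p.2))).

(* [totally] is the filter of the directed set of finite sets under inclusion *)
Definition conv_defined a b : Prop :=
  forall x, cvg (conv_partial a b x @ totally).

(* meaningful when [conv_defined a b] *)
Definition conv a b : section rho :=
  fun x => lim (conv_partial a b x @ totally).

Definition fin_supp a : Prop := finite_set (supp a).

(* The maximum with 0 only matters for the empty groupoid, where the supremum
   in [0, +oo] of the empty set is 0. *)
Definition norm2 a : \bar R :=
  maxe 0%E (ereal_sup [set t | exists x (F : {fset G}),
    [/\ units G x,
        [set` F] `<=` source_fibre x &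
        t = (Num.sqrt (fnorm (\sum_(y <- enum_fset F)
              coord x (bmul (bstar (inj (a y))) (inj (a y))))))%:E]]).

(* In \bar R, 0 / 0 = 0 and t / 0 = +oo for t > 0. *)
Definition normb a : \bar R :=
  ereal_sup [set (norm2 (conv a f) / norm2 f)%E | f in fin_supp].

Definition Sb : set (section rho) := [set a | (normb a < +oo)%E].

Definition bigB : set (section rho) :=
  [set a | [/\ Sb a, conv_defined (sstar a) a & conv_defined a (sstar a)]].

Definition contsec Y : set (section rho) :=
  [set a | supp a `<=` Y /\ Y `<=` cont_points (smap a)].

Definition span (A : set (section rho)) : set (section rho) :=
  [set a | exists (n : nat) (k : 'I_n -> R[i]) (s : 'I_n -> section rho),
    (forall i, A (s i)) /\ (forall x, a x = \sum_(i < n) k i *: s i x)].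

Definition Cc : set (section rho) :=
  span [set a | exists2 K, bicompact K & contsec K a].

Definition closure_b (A : set (section rho)) : set (section rho) :=
  [set a | forall e : R, 0 < e -> exists2 b, A b & (normb (ssub a b) < e%:E)%E].

Definition Cr : set (section rho) := closure_b Cc.

Definition Bsigma : set (section rho) :=
  [set a | bigB a /\ exists2 K, sigma_bicompact K & supp a `<=` K].

Definition Bm : set (section rho) := [set a | Bsigma a /\ meagre (supp a)].

Definition norme a : \bar R := ereal_inf [set normb (ssub a b) | b in Bm].

End Sections.

(* Main.v *)
(** The bundle norm is only upper semicontinuous and no Baire property is
    assumed, so the good arrows are selected by hand. Approximate [a] by [c_j]
    in C_c and let [K] be the sigma-bicompact subgroupoid generated by their
    supports. Put [q_0 = c_j], [q_(n+1) = q_n^* q_n], and call an arrow bad if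
    some [c_j] or the norm function of some [q_n] is discontinuous there, or if
    it lies in the union of all meagre open sets. This union is meagre by the
    Banach category theorem, so the bad arrows form a meagre set, and so do
    their sources and the units linked to these by [K], because bicompact sets
    lie in open slices. [G] is the reduction of [K] to the remaining units.

    Since [G] is the reduction to a [K]-invariant set of units, [a - a_G] lies
    in the ideal of sections of meagre support, whence [|a|_e <= |a_G|_b].
    Conversely, let [b] have meagre support and let [f] be a finitely supported
    vector. By Cauchy-Schwarz [|q_n f|^2 <= |f| |q_(n+1) f|], while [|q_n f|] is at most
    [sum_y |f(y)| |q_(n+1)(r(y))|^(1/2)]. Hence a bound [L^(2^n)] for [q_n] at the
    units of [G], for all [n >= 1], gives [|c_j f| <= L |f|] for the part of [f]
    that [G] sees. Every neighbourhood of a unit of [G] contains a unit whose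
    [K]-orbit avoids the sources of the support of [b]; there [c_j] acts as
    [c_j - b], so [L = |c_j - b|_b] works, and continuity of the norm of [q_n]
    carries the bound back to [G].

    The inequalities in the Hilbert modules over the unit fibres rest on
    positivity in C*-algebras, for which square roots obtained by iteration
    suffice. *)

(* The obstacle is that the operator norm at a unit is a supremum over all vectors and need not vary
   continuously with the unit, while only countably many numerical functions can be made continuous
   off one meagre set. The norms of the [q_n] at single arrows are such functions, and their
   $2^n$-th roots recover the operator norm. The [q_n] must therefore stay in C_c, which is why
   bicompact sets are shown to be stable under products and inverses. A nonempty open set may be
   meagre, so a generic unit near a given one exists only because meagre open sets were discarded.
   As no Hausdorff property is available, closedness of a bicompact set is tested on its sources,
   through an open slice on which the source map is injective and open.

   Operator estimates are made for finite matrices, with rows and columns cut to finite lists of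
   arrows; [normb_le] translates them into $\|\cdot\|_{\mathsf b}$. Convergence of infinite
   convolutions then matters only for placing the part of [a] outside [G] in the big C*-algebra. *)
From HB Require Import structures.
From mathcomp Require Import all_boot all_order all_algebra finmap.
From mathcomp Require Import complex.
From mathcomp Require Import all_classical all_reals all_analysis.
From mathcomp Require Import summability ring lra.
Require Import Defs.
Set Implicit Arguments.
Unset Strict Implicit.
Unset Printing Implicit Defensive.
Import Order.TTheory GRing.Theory Num.Theory.
Import numFieldNormedType.Exports.
Local Open Scope classical_set_scope.
Local Open Scope complex_scope.
Local Open Scope ring_scope.

(** * Positivity in C*-algebras *)

Section RealPartOfNorm.
Variable R : realType.

Lemma conj_complexE (k : R[i]) : Num.conj k = conjc k.
Proof. by []. Qed.

Definition cabs (k : R[i]) : R := complex.Re `|k|.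

Lemma cabsE (k : R[i]) : (cabs k)%:C = `|k|.
Proof. by rewrite /cabs normc_def. Qed.

Lemma cabsR (t : R) : cabs t%:C = `|t|.
Proof. by rewrite /cabs normc_def /= expr0n addr0 sqrtr_sqr. Qed.

Lemma cabs_ge0 (k : R[i]) : 0 <= cabs k.
Proof. by rewrite -ler0c cabsE. Qed.

Lemma cabsM (k l : R[i]) : cabs (k * l) = cabs k * cabs l.
Proof. by apply: complexI; rewrite rmorphM /= !cabsE normrM. Qed.

Lemma cabs_conj (k : R[i]) : cabs k^* = cabs k.
Proof. by apply: complexI; rewrite !cabsE normcJ. Qed.

Lemma ler_cabsD (k l : R[i]) : cabs (k + l) <= cabs k + cabs l.
Proof. by rewrite -lecR rmorphD /= !cabsE ler_normD. Qed.

Lemma cabs_eq0 (k : R[i]) : cabs k = 0 -> k = 0.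
Proof. by move=> h; apply/eqP; rewrite -normr_eq0 -cabsE h. Qed.

Lemma cabs_sqr (k : R[i]) : cabs (k^* * k) = cabs k ^+ 2.
Proof. by rewrite cabsM cabs_conj expr2. Qed.

Lemma mulii : 'i%C * 'i%C = -1 :> R[i].
Proof. by rewrite -expr2 sqr_i. Qed.

Lemma cabsi : cabs 'i%C = 1.
Proof. by rewrite /cabs normc_def /= expr0n expr1n add0r sqrtr1. Qed.

End RealPartOfNorm.

(** The norm is a plain real function and completeness is sequential, so that the unitization below
    needs only an algebra structure and the function [uabs]. *)
Record cstar_norm (R : realType) (U : algType R[i]) (st : U -> U) (n : U -> R)
  : Prop := CstarNorm {
  cn_stK : involutive st;
  cn_stD : forall x y, st (x + y) = st x + st y;
  cn_stM : forall x y, st (x * y) = st y * st x;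
  cn_stZ : forall k x, st (k *: x) = k^* *: st x;
  cn_eq0 : forall x, n x = 0 -> x = 0;
  cn_D : forall x y, n (x + y) <= n x + n y;
  cn_Z : forall k x, n (k *: x) = cabs k * n x;
  cn_M : forall x y, n (x * y) <= n x * n y;
  cn_st : forall x, n (st x * x) = n x ^+ 2;
  cn_complete : forall u : nat -> U,
    (forall e : R, 0 < e ->
      exists N, forall i j, (N <= i)%N -> (N <= j)%N -> n (u i - u j) < e) ->
    exists l, forall e : R, 0 < e ->
      exists N, forall i, (N <= i)%N -> n (u i - l) < e
}.

Section CstarPositivity.
Variables (R : realType) (U : algType R[i]) (st : U -> U) (n : U -> R).
Hypothesis H : cstar_norm st n.
Implicit Types (x y z v w h p q : U) (s t : R).

Local Notation rs t := (t%:C *: (1 : U)).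

Lemma cn0 : n 0 = 0.
Proof. by rewrite -(scale0r 0) (cn_Z H) /cabs normr0 mul0r. Qed.

Lemma cnN x : n (- x) = n x.
Proof. by rewrite -scaleN1r (cn_Z H) /cabs normrN1 mul1r. Qed.

Lemma cn_ge0 x : 0 <= n x.
Proof. by have := cn_D H x (- x); rewrite subrr cn0 cnN; lra. Qed.

Lemma cnB x y : n (x - y) <= n x + n y.
Proof. by rewrite -(cnN y) (cn_D H). Qed.

Lemma cn_dist x y : n (x - y) = n (y - x).
Proof. by rewrite -cnN opprB. Qed.

Lemma cnZR t x : 0 <= t -> n (t%:C *: x) = t * n x.
Proof. by move=> t0; rewrite (cn_Z H) cabsR ger0_norm. Qed.

Lemma cnZRp t x : 0 < t -> n (t%:C *: x) = t * n x.
Proof. by move=> /ltW; exact: cnZR. Qed.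

Lemma cnZVp t x : 0 < t -> n (t^-1%:C *: x) = t^-1 * n x.
Proof. by move=> t0; rewrite cnZRp// invr_gt0. Qed.

Lemma cn_star x : n (st x) = n x.
Proof.
have sub y : n y <= n (st y).
  have := cn_M H (st y) y; rewrite (cn_st H) expr2.
  have := cn_ge0 y; rewrite le_eqVlt => /orP[/eqP <- _|y0]; first exact: cn_ge0.
  by rewrite ler_pM2r.
by apply: le_anti; rewrite sub andbT -{2}(cn_stK H x) sub.
Qed.

Lemma cn_st0 : st 0 = 0.
Proof. by rewrite -(scale0r 0) (cn_stZ H) rmorph0 !scale0r. Qed.

Lemma cn_stN x : st (- x) = - st x.
Proof. by apply/eqP; rewrite -addr_eq0 -(cn_stD H) addNr cn_st0. Qed.

Lemma cn_stB x y : st (x - y) = st x - st y.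
Proof. by rewrite (cn_stD H) cn_stN. Qed.

Lemma cn_st1 : st 1 = 1.
Proof. by have := cn_stM H (st 1) 1; rewrite mulr1 (cn_stK H) mulr1. Qed.

Lemma cn_stZR t x : st (t%:C *: x) = t%:C *: st x.
Proof. by rewrite (cn_stZ H) conj_complexE conjc_real. Qed.

Lemma cn_sqr v : st v = v -> n (v * v) = n v ^+ 2.
Proof. by move=> sv; rewrite -{1}sv (cn_st H). Qed.

Lemma cn1 : n 1 = 1.
Proof.
have := cn_sqr cn_st1; rewrite mulr1 => h.
have : n 1 != 0 by apply/eqP => /(cn_eq0 H)/eqP; rewrite oner_eq0.
by move=> n0; apply: (mulIf n0); rewrite mul1r -expr2 -h.
Qed.

Lemma cn_small x : (forall e : R, 0 < e -> n x <= e) -> x = 0.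
Proof.
move=> small; apply: (cn_eq0 H); apply: le_anti; rewrite cn_ge0 andbT.
by apply/ler_addgt0Pr => e e0; rewrite add0r small.
Qed.

Definition cn_tends (u : nat -> U) (l : U) := forall e : R, 0 < e ->
  exists N, forall i, (N <= i)%N -> n (u i - l) < e.

Lemma cn_tends_unique (u : nat -> U) l l' : cn_tends u l -> cn_tends u l' -> l = l'.
Proof.
move=> ul ul'; apply/eqP; rewrite -subr_eq0; apply/eqP; apply: cn_small => e e0.
have e2 : 0 < e / 2 by lra.
have [N1 h1] := ul _ e2; have [N2 h2] := ul' _ e2.
pose i := maxn N1 N2.
have := h1 i (leq_maxl _ _); have := h2 i (leq_maxr _ _).
have -> : l - l' = (u i - l') - (u i - l) by rewrite opprB [RHS]addrC subrKA.
by have := cnB (u i - l') (u i - l); lra.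
Qed.

(* Visser's iteration: [w] solves [2 w = z + w^2], so that
   [(1 - w)^2 = 1 - z]; it is dominated by the scalar iteration for [z = 1]. *)
Fixpoint sqrt_iter z k : U :=
  if k is k'.+1 then (2^-1 : R)%:C *: (z + sqrt_iter z k' * sqrt_iter z k')
  else 0.

Fixpoint sqrt_bound k : R :=
  if k is k'.+1 then 2^-1 * (1 + sqrt_bound k' ^+ 2) else 0.

Lemma sqrt_iterE z k : sqrt_iter z k.+1 =
  (2^-1 : R)%:C *: (z + sqrt_iter z k * sqrt_iter z k).
Proof. by []. Qed.

Lemma sqrt_bound_itv k : 0 <= sqrt_bound k <= 1.
Proof. by elim: k => [|k /andP[h0 h1]] /=; nra. Qed.

Lemma sqrt_iter_le z k : n z <= 1 -> n (sqrt_iter z k) <= sqrt_bound k.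
Proof.
move=> z1; elim: k => [|k IH] /=; first by rewrite cn0.
rewrite cnZR; last by lra.
have := cn_D H z (sqrt_iter z k * sqrt_iter z k).
have := cn_M H (sqrt_iter z k) (sqrt_iter z k).
have := cn_ge0 (sqrt_iter z k).
have /andP[] := sqrt_bound_itv k.
by nra.
Qed.

Lemma mulrBB x y : x * x - y * y = x * (x - y) + (x - y) * y.
Proof. by rewrite mulrBr mulrBl addrA subrK. Qed.

Lemma cn_sqrB x y : n (x * x - y * y) <= (n x + n y) * n (x - y).
Proof.
rewrite mulrBB; have := cn_D H (x * (x - y)) ((x - y) * y).
by have := cn_M H x (x - y); have := cn_M H (x - y) y; nra.
Qed.

(** An increment is half the difference of the two preceding squares. For scalars that difference
    factors exactly as $(s+t)(s-t)$; in the algebra [cn_sqrB] gives the same product as an upper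
    bound. *)
Lemma sqrt_iterS z k : n z <= 1 ->
  n (sqrt_iter z k.+1 - sqrt_iter z k) <= sqrt_bound k.+1 - sqrt_bound k.
Proof.
move=> z1; elim: k => [|k IH].
  by rewrite /= mulr0 addr0 subr0 cnZR; lra.
have -> : sqrt_iter z k.+2 - sqrt_iter z k.+1 = (2^-1 : R)%:C *:
    (sqrt_iter z k.+1 * sqrt_iter z k.+1 - sqrt_iter z k * sqrt_iter z k).
  by rewrite {1}sqrt_iterE {2}sqrt_iterE -scalerBr opprD addrACA subrr add0r.
rewrite cnZR; last by lra.
have := cn_sqrB (sqrt_iter z k.+1) (sqrt_iter z k).
have := sqrt_iter_le k z1; have := sqrt_iter_le k.+1 z1.
have := cn_ge0 (sqrt_iter z k.+1 - sqrt_iter z k).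
have -> : sqrt_bound k.+2 - sqrt_bound k.+1 =
    2^-1 * ((sqrt_bound k.+1 + sqrt_bound k) * (sqrt_bound k.+1 - sqrt_bound k)).
  have -> : sqrt_bound k.+2 = 2^-1 * (1 + sqrt_bound k.+1 ^+ 2) by [].
  have {2}-> : sqrt_bound k.+1 = 2^-1 * (1 + sqrt_bound k ^+ 2) by [].
  by ring.
have g1 := cn_ge0 (sqrt_iter z k.+1); have g0 := cn_ge0 (sqrt_iter z k).
move: IH g1 g0.
move: (n (sqrt_iter z k.+1 * _ - _)) (n (sqrt_iter z k.+1 - _))
  (n (sqrt_iter z k.+1)) (n (sqrt_iter z k)) (sqrt_bound k.+1) (sqrt_bound k).
move=> c d b a s1 s0 IH b0 a0 d0 hb ha hc.
rewrite ler_pM2l; last by lra.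
apply: le_trans hc _; apply: le_trans (_ : (s1 + s0) * d <= _).
  by rewrite ler_wpM2r//; lra.
by rewrite ler_wpM2l//; lra.
Qed.

Lemma sqrt_iter_dist z i j : n z <= 1 -> (i <= j)%N ->
  n (sqrt_iter z j - sqrt_iter z i) <= sqrt_bound j - sqrt_bound i.
Proof.
move=> z1; elim: j => [|j IH]; first by rewrite leqn0 => /eqP ->; rewrite !subrr cn0.
rewrite leq_eqVlt => /orP[/eqP ->|]; first by rewrite !subrr cn0.
rewrite ltnS => /IH {}IH; rewrite -(subrKA (sqrt_iter z j)).
have := cn_D H (sqrt_iter z j.+1 - sqrt_iter z j) (sqrt_iter z j - sqrt_iter z i).
by have := sqrt_iterS j z1; lra.
Qed.

(** Otherwise jumps of size at least [e] could be chained until they exceed the bound 1 of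
    [sqrt_bound_itv]. *)
Lemma sqrt_bound_cauchy e : 0 < e ->
  exists N, forall j, (N <= j)%N -> sqrt_bound j - sqrt_bound N < e.
Proof.
move=> e0; apply/not_existsP => nex.
have {nex} step N : exists j, (N <= j)%N /\ e <= sqrt_bound j - sqrt_bound N.
  have /existsNP[j /not_implyP[Nj /negP]] := nex N.
  by rewrite -leNgt => h; exists j.
have big m : exists N, m%:R * e <= sqrt_bound N.
  elim: m => [|m [N IH]]; first by exists 0%N; rewrite mul0r.
  by have [j [_ hj]] := step N; exists j; rewrite -natr1 mulrDl mul1r; lra.
have [N hN] := big (Num.bound e^-1).
have := archi_boundP (ltW (_ : 0 < e^-1)); rewrite invr_gt0 => /(_ e0).
rewrite -(ltr_pM2r e0) mulVf ?gt_eqF// => h.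
by have /andP[_] := sqrt_bound_itv N; lra.
Qed.

(** The iterates are real polynomials in [z] of norm at most 1, so self-adjointness, the norm bound
    and commutation pass to their limit [w], and [v = 1 - w]. The bound on [1 - v] is what later
    makes the root positive. *)
Lemma cn_sqrt z : st z = z -> n z <= 1 ->
  exists v, [/\ st v = v, n (1 - v) <= 1, v * v = 1 - z &
    forall y, GRing.comm y z -> GRing.comm y v].
Proof.
move=> sz z1.
have [w hw] : exists w, cn_tends (sqrt_iter z) w.
  apply: (cn_complete H) => e e0.
  have e2 : 0 < e / 2 by lra.
  have [N hN] := sqrt_bound_cauchy e2; exists N => i j Ni Nj.
  rewrite -(subrKA (sqrt_iter z N)).
  have := cn_D H (sqrt_iter z i - sqrt_iter z N) (sqrt_iter z N - sqrt_iter z j).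
  rewrite (cn_dist (sqrt_iter z N)).
  have := sqrt_iter_dist z1 Ni; have := sqrt_iter_dist z1 Nj.
  by have := hN _ Ni; have := hN _ Nj; lra.
have lew k : n (sqrt_iter z k) <= 1.
  by apply: le_trans (sqrt_iter_le k z1) _; have /andP[] := sqrt_bound_itv k.
have sw : st w = w.
  apply: (cn_tends_unique _ hw) => e e0.
  have [N hN] := hw _ e0; exists N => i Ni.
  have -> : sqrt_iter z i = st (sqrt_iter z i).
    elim: (i) => [|k IH] /=; first by rewrite cn_st0.
    by rewrite cn_stZR (cn_stD H) (cn_stM H) sz -IH.
  by rewrite -cn_stB cn_star hN.
have cw y : GRing.comm y z -> GRing.comm y w.
  move=> yz; have cy k : GRing.comm y (sqrt_iter z k).
    elim: k => [|k IH] /=; first exact: commr0.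
    have /(commrM IH) yy := IH.
    by rewrite /GRing.comm -scalerAr -scalerAl (commrD yz yy).
  apply/eqP; rewrite -subr_eq0; apply/eqP/cn_small => e e0.
  have e1 : 0 < e / (2 * (n y + 1)) by have := cn_ge0 y => ?; rewrite divr_gt0//; lra.
  have [N /(_ N (leqnn _)) hN] := hw _ e1.
  have -> : y * w - w * y =
      (sqrt_iter z N - w) * y - y * (sqrt_iter z N - w).
    by rewrite mulrBl mulrBr (cy N) opprB [RHS]addrC subrKA.
  have := cnB ((sqrt_iter z N - w) * y) (y * (sqrt_iter z N - w)).
  have := cn_M H (sqrt_iter z N - w) y; have := cn_M H y (sqrt_iter z N - w).
  have y0 := cn_ge0 y; move: hN; rewrite ltr_pdivlMr; last by lra.
  by have := cn_ge0 (sqrt_iter z N - w); nra.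
(* The limit is a fixed point because squaring is Lipschitz with constant [1 + n w] between [w] and
   elements of norm at most 1. *)
have eqw : w = (2^-1 : R)%:C *: (z + w * w).
  have hw1 : cn_tends (fun k => sqrt_iter z k.+1) w.
    by move=> e /hw[N hN]; exists N => i Ni; apply: hN; rewrite leqW.
  apply: (cn_tends_unique hw1) => e e0.
  have e1 : 0 < e / (1 + n w) by have := cn_ge0 w => ?; rewrite divr_gt0//; lra.
  have [N hN] := hw _ e1; exists N => i Ni /=.
  rewrite -scalerBr opprD addrACA subrr add0r cnZR; last by lra.
  have := cn_sqrB (sqrt_iter z i) w; have := hN _ Ni.
  rewrite ltr_pdivlMr; last by have := cn_ge0 w; lra.
  have := lew i; have := cn_ge0 w; have := cn_ge0 (sqrt_iter z i - w).
  move: (n (sqrt_iter z i * _ - _)) (n (sqrt_iter z i - w)) (n (sqrt_iter z i)) (n w).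
  move=> f d g c d0 c0 g1 hd hf.
  have : (g + c) * d <= (1 + c) * d by rewrite ler_wpM2r//; lra.
  by lra.
exists (1 - w); split.
- by rewrite cn_stB cn_st1 sw.
- rewrite opprB addrC subrK; apply/ler_addgt0Pr => e /hw[N /(_ N (leqnn _)) hN].
  rewrite -(subrK (sqrt_iter z N) w).
  have := cn_D H (w - sqrt_iter z N) (sqrt_iter z N); rewrite cn_dist.
  by have := lew N; lra.
- have eq2 : w + w = z + w * w.
    rewrite {1 2}eqw -scalerDl -rmorphD /= -[RHS]scale1r; congr (_ *: _).
    by rewrite -(rmorph1 (real_complex R)) /=; congr (_%:C); lra.
  have -> : z = w + w - w * w by rewrite eq2 addrK.
  by rewrite -[w + w - _]addrA opprD addrA mulrBl mul1r mulrBr mulr1.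
- by move=> y /cw yw; apply: commrB => //; exact: commr1.
Qed.

Lemma comm_real_imM v w : GRing.comm v w ->
  (v - 'i%C *: w) * (v + 'i%C *: w) = v * v + w * w.
Proof.
move=> vw; rewrite mulrDr !mulrBl -!scalerAl -!scalerAr scalerA mulii.
by rewrite vw scaleN1r opprK addrA subrK.
Qed.

Lemma cn_real_im v w : st v = v -> st w = w -> GRing.comm v w ->
  n (v + 'i%C *: w) ^+ 2 = n (v * v + w * w).
Proof.
move=> sv sw vw; rewrite -(cn_st H) (cn_stD H) (cn_stZ H) sv sw conj_complexE.
by rewrite (_ : 'i%C^*%C = - 'i%C) ?scaleNr ?comm_real_imM//; apply/eqP; rewrite eq_complex /= !oppr0 !eqxx.
Qed.

(** By [cn_real_im] the elements $v\pm iw$ have the same norm, the square root of the right-hand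
    side, and [v] is their mean. *)
Lemma cn_comm_le v w : st v = v -> st w = w -> GRing.comm v w ->
  n (v * v) <= n (v * v + w * w).
Proof.
move=> sv sw vw; have h1 := cn_real_im sv sw vw.
have := cn_real_im sv (_ : st (- w) = - w); rewrite cn_stN sw => /(_ erefl).
rewrite mulrNN scalerN => /(_ (commrN vw)) h2.
rewrite cn_sqr//.
have eq2 : (2%:R : R)%:C *: v = (v + 'i%C *: w) + (v - 'i%C *: w).
  by rewrite addrACA subrr addr0 -{2 3}[v]scale1r -scalerDl rmorph_nat.
have := cn_D H (v + 'i%C *: w) (v - 'i%C *: w).
rewrite -eq2 cnZR//.
have eq1 : n (v + 'i%C *: w) = n (v - 'i%C *: w).
  by apply/eqP; rewrite -(@eqrXn2 _ 2)// ?cn_ge0// h1 h2.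
rewrite -eq1 -h1 => h; rewrite ler_sqr ?nnegrE ?cn_ge0//; lra.
Qed.

Lemma scale_real_comp (a b : R) x : a%:C *: (b%:C *: x) = (a * b)%:C *: x.
Proof. by rewrite scalerA rmorphM. Qed.

Lemma comm_sqr v : GRing.comm v (v * v).
Proof. by apply: commrM. Qed.

(** After scaling to [t = 1], let [u] be the root of [1 - v' * v']. It commutes with [v'], and the
    two squares add up to 1, so [cn_comm_le] bounds [u * u]. *)
Lemma cn_sqr_dist v t : st v = v -> n v ^+ 2 <= t -> n (rs t - v * v) <= t.
Proof.
move=> sv; have [->|t0] := eqVneq t 0.
  move=> h; have : n v = 0 by have := cn_ge0 v; nra.
  by move/(cn_eq0 H) ->; rewrite mulr0 scale0r subrr cn0.
move=> h; have {t0} t0 : 0 < t by have := sqr_ge0 (n v); lra.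
pose r := Num.sqrt t; have r0 : 0 < r by rewrite sqrtr_gt0.
have rr : r * r = t by rewrite -expr2 sqr_sqrtr ?ltW.
pose v' := r^-1%:C *: v.
have sv' : st v' = v' by rewrite cn_stZR sv.
have vv' : v * v = t%:C *: (v' * v').
  rewrite -scalerAl -scalerAr !scale_real_comp -rr -{1}[v * v]scale1r.
  by congr (_ *: _); rewrite -(rmorph1 (real_complex R)) /=; congr (_%:C); field; rewrite gt_eqF.
have nv' : n (v' * v') <= 1.
  rewrite cn_sqr// cnZVp// exprMn exprVn [r ^+ 2]expr2 rr.
  by rewrite [leLHS]mulrC ler_pdivrMr// mul1r.
have sz : st (v' * v') = v' * v' by rewrite (cn_stM H) sv'.
have [u [su _ uu cu]] := cn_sqrt sz nv'.
have uv : GRing.comm u v' by apply/commr_sym/cu/comm_sqr.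
have := cn_comm_le su sv' uv; rewrite uu subrK cn1 => n1.
by rewrite vv' -scalerBr cnZRp//; nra.
Qed.

Lemma scaler_real2 x : (2%:R : R)%:C *: x = x + x.
Proof. by rewrite rmorph_nat scaler_nat mulr2n. Qed.

Lemma mulrDD x y : (x + y) * (x + y) = (x * x + y * y) + (x * y + y * x).
Proof. by rewrite mulrDl !mulrDr (addrC (y * x)) addrACA. Qed.

Lemma polarization_sub x y :
  (x + y) * (x + y) - (y - x) * (y - x) = (x * y + y * x) + (x * y + y * x).
Proof.
rewrite !mulrDD mulrNN mulrN mulNr -opprD (addrC (y * y)) (addrC (y * x)).
by rewrite opprD opprK addrACA subrr add0r.
Qed.

(* For self-adjoint [h] in a unital C*-algebra, [h >= 0] iff [|t - h| <= t] for
   some, or for any, [t >= |h|]; this form makes sums of positive elements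
   positive without any spectral theory. *)
Definition cpos h := st h = h /\ exists2 t, 0 < t & n (rs t - h) <= t.

Lemma cpos_sqr v : st v = v -> cpos (v * v).
Proof.
move=> sv; split; first by rewrite (cn_stM H) sv.
exists (n v ^+ 2 + 1); first by have := sqr_ge0 (n v); lra.
by apply: cn_sqr_dist => //; lra.
Qed.

(** Positivity says that [z = 1 - h / t] lies in the unit ball, so [cn_sqrt] yields a root of
    [h / t]. That root is within distance 1 of the unit, which is again positivity. *)
Lemma cpos_sqrt h : cpos h ->
  exists v, [/\ st v = v, cpos v, v * v = h &
    forall y, GRing.comm y h -> GRing.comm y v].
Proof.
move=> [sh [t t0 ht]].
pose z := t^-1%:C *: (rs t - h).
have sz : st z = z by rewrite cn_stZR cn_stB cn_stZR cn_st1 sh.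
have nz : n z <= 1.
  by rewrite cnZVp// [leLHS]mulrC ler_pdivrMr// mul1r.
have [u [su u1 uu cu]] := cn_sqrt sz nz.
pose r := Num.sqrt t; have r0 : 0 < r by rewrite sqrtr_gt0.
have rr : r * r = t by rewrite -expr2 sqr_sqrtr ?ltW.
exists (r%:C *: u); split.
- by rewrite cn_stZR su.
- split; first by rewrite cn_stZR su.
  exists r => //; rewrite -scalerBr cnZRp//.
  by rewrite -[leRHS]mulr1 ler_wpM2l// ltW.
- rewrite -scalerAl -scalerAr scale_real_comp rr uu /z scalerBr scale_real_comp.
  by rewrite divff ?gt_eqF// scale1r opprB addrC subrK.
- move=> y yh; rewrite /GRing.comm -scalerAl -scalerAr; congr (_ *: _).
  apply: cu; rewrite /z /GRing.comm -scalerAl -scalerAr; congr (_ *: _).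
  by rewrite mulrBl mulrBr yh -scalerAl -scalerAr mul1r mulr1.
Qed.

Lemma cpos_dist h t : cpos h -> n h <= t -> n (rs t - h) <= t.
Proof.
move=> /cpos_sqrt[v [sv _ <- _]]; rewrite cn_sqr//; exact: cn_sqr_dist.
Qed.

Lemma cposP h t : st h = h -> n (rs t - h) <= t -> cpos h.
Proof.
move=> sh ht; split=> //; have := cn_ge0 (rs t - h) => t0.
exists (t + 1); first by lra.
rewrite rmorphD /= scalerDl -addrA (addrC _ (- h)) addrA.
by have := cn_D H (rs t - h) (rs 1); rewrite (cnZR _ ler01) cn1; lra.
Qed.

Lemma cposD p q : cpos p -> cpos q -> cpos (p + q).
Proof.
move=> hp hq; have [sp _] := hp; have [sq _] := hq.
apply: (@cposP _ (n p + n q)); first by rewrite (cn_stD H) sp sq.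
have := cpos_dist hp (lexx _); have := cpos_dist hq (lexx _).
rewrite rmorphD /= scalerDl opprD addrACA => h1 h2.
by apply: le_trans (cn_D H _ _) _; exact: lerD.
Qed.

Lemma cposZ t p : 0 <= t -> cpos p -> cpos (t%:C *: p).
Proof.
move=> t0 hp; have [sp _] := hp.
apply: (@cposP _ (t * n p)); first by rewrite cn_stZR sp.
rewrite -scale_real_comp -scalerBr cnZR//.
by rewrite ler_wpM2l//; exact: cpos_dist.
Qed.

Lemma cpos0 : cpos 0.
Proof. by rewrite -(mulr0 0); apply: cpos_sqr; exact: cn_st0. Qed.

Lemma cpos_subr p t : cpos p -> n p <= t -> cpos (rs t - p).
Proof.
move=> hp pt; have [sp _] := hp.
apply: (@cposP _ t); first by rewrite cn_stB cn_stZR cn_st1 sp.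
by rewrite opprB addrC subrK.
Qed.

(** For [t = n (p + q)], both [p] and [t - p] are positive. Their roots commute and have squares
    adding up to [t], so [cn_comm_le] applies. *)
Lemma cpos_le p q : cpos p -> cpos q -> n p <= n (p + q).
Proof.
move=> hp hq; set t := n (p + q).
have t0 : 0 <= t := cn_ge0 _.
have [w [sw _ ww cw]] : exists w, [/\ st w = w, cpos w, w * w = rs t - p &
    forall y, GRing.comm y (rs t - p) -> GRing.comm y w].
  apply: cpos_sqrt.
  have -> : rs t - p = (rs t - (p + q)) + q by rewrite opprD addrA subrK.
  by apply: cposD => //; apply: cpos_subr (cposD hp hq) (lexx _).
have [v [sv _ vv cv]] := cpos_sqrt hp.
have vw : GRing.comm v w.
  apply: cw; rewrite -vv; apply: commrB; last exact: comm_sqr.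
  by rewrite /GRing.comm -scalerAl -scalerAr mul1r mulr1.
have := cn_comm_le sv sw vw.
by rewrite vv ww addrC subrK cnZR// cn1 mulr1.
Qed.

Lemma cn_sqr_eq0 v : st v = v -> v * v = 0 -> v = 0.
Proof.
move=> sv vv; apply: (cn_eq0 H).
by have := cn_sqr sv; rewrite vv cn0 => /esym/eqP; rewrite sqrf_eq0 => /eqP.
Qed.

(* If [d* d] is negative, then [d d*] is positive; comparing the norms of
   [d (1 - d* d)] and [(1 - d d* ) d] forces [d = 0]. *)
Lemma cpos_opp_star d g : st g = g -> st d * d = - (g * g) -> d = 0.
Proof.
move=> sg dg; apply/eqP/negPn/negP => d0.
wlog nd : d g sg dg d0 / n d = 1.
  move=> W; have nd : 0 < n d.
    by rewrite lt_def cn_ge0 andbT; apply: contra d0 => /eqP/(cn_eq0 H) ->.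
  apply: (W ((n d)^-1%:C *: d) ((n d)^-1%:C *: g)).
  - by rewrite cn_stZR sg.
  - by rewrite cn_stZR -!scalerAl -!scalerAr dg !scalerN.
  - by rewrite scaler_eq0 (negPf d0) orbF -(rmorph0 (real_complex R)) (inj_eq (@complexI _)) invr_eq0 gt_eqF.
  - by rewrite cnZVp// mulVf ?gt_eqF.
pose m := g * g; pose k := d * st d.
have nm : n m = 1 by rewrite -cnN -dg (cn_st H) nd expr1n.
have posk : cpos k.
  (* With [x] and [y] the real and imaginary parts of [d], the sum of [st d * d] and [d * st d] is
     twice [x * x + y * y]. Moving [st d * d = - m] across writes [k] as a sum of positive
     elements. *)
  pose x := (2^-1 : R)%:C *: (d + st d).
  pose y := (2^-1 : R)%:C *: ('i%C *: (st d - d)).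
  have sx : st x = x by rewrite cn_stZR (cn_stD H) (cn_stK H) addrC.
  have sy : st y = y.
    rewrite cn_stZR (cn_stZ H) cn_stB (cn_stK H) conj_complexE.
    by rewrite (_ : 'i%C^*%C = - 'i%C) ?scaleNr -?scalerN ?opprB//; apply/eqP; rewrite eq_complex /= !oppr0 !eqxx.
  have -> : k = (2%:R : R)%:C *: (x * x + y * y) + m.
    have xx : x * x = (4^-1 : R)%:C *: ((d + st d) * (d + st d)).
      rewrite -scalerAl -scalerAr scale_real_comp; congr (_%:C *: _).
      by rewrite -invfM -natrM.
    have yy : y * y = - ((4^-1 : R)%:C *: ((st d - d) * (st d - d))).
      rewrite -!scalerAl -!scalerAr !scalerA -scaleNr; congr (_ *: _).
      rewrite mulrACA mulii mulrN1; congr (- _).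
      by rewrite -rmorphM -invfM -natrM.
    rewrite xx yy -scalerBr polarization_sub scale_real_comp -scaler_real2 scale_real_comp.
    rewrite (_ : _ * _ = 1); last by field.
    by rewrite scale1r dg /m /k subrK.
  apply: cposD; last exact: cpos_sqr.
  by apply: cposZ => //; apply: cposD; apply: cpos_sqr.
have nk : n k = 1.
  by rewrite /k -{1}(cn_stK H d) (cn_st H) cn_star nd expr1n.
have n1k : n (1 - k) <= 1.
  have := @cpos_dist _ 1 posk; rewrite nk => /(_ (lexx _)).
  by rewrite rmorph1 scale1r.
have eqX : d * (1 + m) = (1 - k) * d.
  by rewrite mulrDr mulr1 mulrBl mul1r /m /k -mulrA dg mulrN opprK.
have sm : st m = m by rewrite (cn_stM H) sg.
have : n (d * (1 + m)) ^+ 2 <= 1.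
  rewrite eqX; have := cn_M H (1 - k) d; rewrite nd mulr1 => h.
  by apply: exprn_ile1 => //; [exact: cn_ge0|lra].
rewrite -(cn_st H) (cn_stM H) (cn_stD H) cn_st1 sm.
rewrite -mulrA (mulrA (st d)) dg -/m.
(* Here $m(1+m)^2=2m^2+m+m^3$ with $m^3=(gm)^2$. By [cpos_le] its norm is at least that of $2m^2$,
   which is 2, against the bound 1 just obtained. *)
have -> : (1 + m) * (- m * (1 + m)) = - ((2%:R : R)%:C *: (m * m) + (m + (g * m) * (g * m))).
  rewrite mulNr mulrN; congr (- _).
  have -> : (g * m) * (g * m) = m * (m * m).
    have gm : g * m = m * g := comm_sqr g.
    transitivity ((m * g) * (g * m)); first by rewrite {1}gm.
    by rewrite -(mulrA m g (g * m)) (mulrA g g m).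
  rewrite [m * (1 + m)]mulrDr mulr1 mulrDl mul1r mulrDr scaler_real2.
  by rewrite [RHS]addrACA (addrC m (m * m)).
rewrite cnN => h.
have : n ((2%:R : R)%:C *: (m * m)) <= 1.
  apply: le_trans h; apply: cpos_le.
    by apply: cposZ => //; exact: cpos_sqr.
  apply: cposD; apply: cpos_sqr => //.
  by rewrite (cn_stM H) sm sg; apply/esym/comm_sqr.
by rewrite cnZR// cn_sqr// nm; lra.
Qed.

(** With [p] the positive root of [h * h], the element [e = p - h] is twice the negative part of
    [h], and [h * e = - (p * e)]. Hence [x * e] falls under [cpos_opp_star] and vanishes, which
    gives [e * e = 0] and [h = p]. *)
Theorem cpos_star_mul x : cpos (st x * x).
Proof.
pose h := st x * x.
have sh : st h = h by rewrite (cn_stM H) (cn_stK H).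
have [p [sp posp pp cp]] := cpos_sqrt (cpos_sqr sh).
have hp : GRing.comm h p by apply: cp; exact: comm_sqr.
have [v [sv _ vv cv]] := cpos_sqrt posp.
pose e := p - h.
have se : st e = e by rewrite cn_stB sp sh.
have ve : GRing.comm e v by apply/cv; rewrite /GRing.comm mulrBl mulrBr hp.
have he : h * e = - (p * e).
  by rewrite !mulrBr hp pp opprB.
have xe : x * e = 0.
  apply: (@cpos_opp_star _ (v * e)); first by rewrite (cn_stM H) sv se.
  rewrite (cn_stM H) se -[e * st x * _]mulrA (mulrA (st x)) -/h he mulrN -vv.
  by congr (- _); rewrite !mulrA ve.
have he0 : h * e = 0 by rewrite /h -mulrA xe mulr0.
have pe0 : p * e = 0 by apply/eqP; rewrite -oppr_eq0 -he he0.
have e0 : e = 0 by apply: cn_sqr_eq0 => //; rewrite {1}/e mulrBl pe0 he0 subrr.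
have /eqP := e0; rewrite /e subr_eq0 => /eqP ph.
by rewrite -/h -ph.
Qed.
End CstarPositivity.

Lemma cauchy_seq_cvg (K : numFieldType) (V : completeNormedModType K) (u : nat -> V) :
  (forall e : K, 0 < e ->
    exists N, forall i j, (N <= i)%N -> (N <= j)%N -> `|u i - u j| < e) ->
  exists l, forall e : K, 0 < e ->
    exists N, forall i, (N <= i)%N -> `|u i - l| < e.
Proof.
move=> hu.
have /cauchy_cvg/cvg_ex[l hl] : cauchy (u @ \oo).
  apply/cauchyP => e e0; have [N hN] := hu e e0.
  by exists (u N); exists N => //= i Ni; rewrite -ball_normE /=; exact: hN.
exists l => e e0.
have /cvgrPdist_lt/(_ e e0)[N _ hN] := hl.
by exists N => i /hN; rewrite distrC.
Qed.

Section ComplexNormed.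
Variables (R : realType) (V : completeNormedModType R[i]).

Definition vabs (x : V) : R := complex.Re `|x|.

Lemma vabsE x : (vabs x)%:C = `|x|.
Proof. by rewrite /vabs RRe_real// normr_real. Qed.

Lemma vabs_ge0 x : 0 <= vabs x.
Proof. by rewrite -ler0c vabsE. Qed.

Lemma ler_vabsD x y : vabs (x + y) <= vabs x + vabs y.
Proof. by rewrite -lecR rmorphD /= !vabsE ler_normD. Qed.

Lemma vabsN x : vabs (- x) = vabs x.
Proof. by rewrite /vabs normrN. Qed.

Lemma vabsB x y : vabs (x - y) = vabs (y - x).
Proof. by rewrite -vabsN opprB. Qed.

Lemma vabsZ k x : vabs (k *: x) = cabs k * vabs x.
Proof. by apply: complexI; rewrite rmorphM /= !vabsE cabsE normrZ. Qed.

Lemma vabs0 : vabs 0 = 0.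
Proof. by rewrite /vabs normr0. Qed.

Lemma vabs_eq0 x : vabs x = 0 -> x = 0.
Proof. by move=> h; apply/eqP; rewrite -normr_eq0 -vabsE h. Qed.

Lemma vabs_complete (u : nat -> V) :
  (forall e : R, 0 < e ->
    exists N, forall i j, (N <= i)%N -> (N <= j)%N -> vabs (u i - u j) < e) ->
  exists l, forall e : R, 0 < e ->
    exists N, forall i, (N <= i)%N -> vabs (u i - l) < e.
Proof.
move=> hu; have [|l hl] := @cauchy_seq_cvg _ V u.
  move=> e e0; have re : (complex.Re e)%:C = e by rewrite RRe_real// gtr0_real.
  have /hu[N hN] : 0 < complex.Re e by rewrite -ltcR re.
  by exists N => i j Ni Nj; rewrite -vabsE -re ltcR hN.
exists l => e e0.
have [|N hN] := hl e%:C; first by rewrite ltcR.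
by exists N => i /hN; rewrite -vabsE ltcR.
Qed.

End ComplexNormed.

Lemma cabs_complete (R : realType) (u : nat -> R[i]) :
  (forall e : R, 0 < e ->
    exists N, forall i j, (N <= i)%N -> (N <= j)%N -> cabs (u i - u j) < e) ->
  exists l, forall e : R, 0 < e ->
    exists N, forall i, (N <= i)%N -> cabs (u i - l) < e.
Proof.
move=> hu.
have leRe (z : R[i]) : `|complex.Re z| <= cabs z.
  by rewrite -lecR cabsE normc_ge_Re.
have leIm (z : R[i]) : `|complex.Im z| <= cabs z.
  by have := leRe (z * 'i%C); rewrite ReiNIm normrN cabsM cabsi mulr1.
have leD (z : R[i]) : cabs z <= `|complex.Re z| + `|complex.Im z|.
  by rewrite {1}(complexE z) (le_trans (ler_cabsD _ _))// cabsM cabsi mul1r !cabsR.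
have [e e0|a ha] := @cauchy_seq_cvg R R (fun i => complex.Re (u i)).
  have [N hN] := hu e e0; exists N => i j Ni Nj.
  by rewrite -raddfB /=; apply: le_lt_trans (leRe _) (hN _ _ Ni Nj).
have [e e0|b hb] := @cauchy_seq_cvg R R (fun i => complex.Im (u i)).
  have [N hN] := hu e e0; exists N => i j Ni Nj.
  by rewrite -raddfB /=; apply: le_lt_trans (leIm _) (hN _ _ Ni Nj).
exists (a +i* b) => e e0; have e2 : 0 < e / 2 by lra.
have [N1 h1] := ha _ e2; have [N2 h2] := hb _ e2.
exists (maxn N1 N2) => i; rewrite geq_max => /andP[/h1 {}h1 /h2 {}h2].
apply: le_lt_trans (leD _) _; rewrite !raddfB /=; lra.
Qed.

Record cstar_alg (R : realType) (A : completeNormedModType R[i])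
    (m : A -> A -> A) (s : A -> A) : Prop := CstarAlg {
  ca_A : forall a b c, m (m a b) c = m a (m b c);
  ca_Dl : forall a b c, m (a + b) c = m a c + m b c;
  ca_Dr : forall a b c, m a (b + c) = m a b + m a c;
  ca_Zl : forall k a b, m (k *: a) b = k *: m a b;
  ca_Zr : forall k a b, m a (k *: b) = k *: m a b;
  ca_sK : involutive s;
  ca_sD : forall a b, s (a + b) = s a + s b;
  ca_sM : forall a b, s (m a b) = m (s b) (s a);
  ca_sZ : forall k a, s (k *: a) = k^* *: s a;
  ca_M : forall a b, vabs (m a b) <= vabs a * vabs b;
  ca_s : forall a, vabs (m (s a) a) = vabs a ^+ 2
}.

(** * Unitization of a C*-algebra *)

Section Unitization.
Variables (R : realType) (A : completeNormedModType R[i]).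
Variables (m : A -> A -> A) (s : A -> A).
Hypothesis H : cstar_alg m s.

(** The proof of [cstar_alg] is an argument of the type, so that the ring structure, whose laws rest
    on it, can be inferred. *)
Definition unitization (_ : cstar_alg m s) : Type := (R[i]^o * A)%type.
Local Notation U := (unitization H).

HB.instance Definition _ := GRing.Lmodule.copy U (R[i]^o * A)%type.

Implicit Types (u v w : U) (a b c : A).

Definition umul u v : U := (u.1 * v.1, u.1 *: v.2 + v.1 *: u.2 + m u.2 v.2).
Definition uone : U := (1, 0).
Definition ustar u : U := (u.1^*, s u.2).

Lemma uext u v : u.1 = v.1 -> u.2 = v.2 -> u = v.
Proof. by case: u => ? ?; case: v => ? ? /= -> ->. Qed.

Lemma ca_0l a : m 0 a = 0.
Proof. by rewrite -(scale0r 0) (ca_Zl H) !scale0r. Qed.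

Lemma ca_0r a : m a 0 = 0.
Proof. by rewrite -(scale0r 0) (ca_Zr H) !scale0r. Qed.

Fact umulA : associative umul.
Proof.
move=> u v w; apply: uext => /=; [exact: mulrA|].
rewrite !(ca_Dl H) !(ca_Dr H) !(ca_Zl H) !(ca_Zr H) (ca_A H) !scalerDr !scalerA.
rewrite (mulrC w.1) (mulrC w.1 v.1) !addrA.
congr (_ + _); rewrite -!addrA; congr (_ + (_ + _)).
by rewrite addrCA; congr (_ + _); rewrite addrA addrC.
Qed.

Fact umul1l : left_id uone umul.
Proof.
by move=> u; apply: uext; rewrite /= ?mul1r// scale1r scaler0 ca_0l !addr0.
Qed.

Fact umul1r : right_id uone umul.
Proof.
by move=> u; apply: uext; rewrite /= ?mulr1// scale1r scaler0 ca_0r addr0 add0r.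
Qed.

Fact umulDl : left_distributive umul +%R.
Proof.
move=> u v w; apply: uext => /=; first by rewrite mulrDl.
rewrite (ca_Dl H) scalerDr scalerDl [RHS]addrACA; congr (_ + _); exact: addrACA.
Qed.

Fact umulDr : right_distributive umul +%R.
Proof.
move=> u v w; apply: uext => /=; first by rewrite mulrDr.
rewrite (ca_Dr H) scalerDr scalerDl [RHS]addrACA; congr (_ + _); exact: addrACA.
Qed.

Fact uone_neq0 : uone != 0.
Proof. by apply/eqP => -[/eqP]; rewrite oner_eq0. Qed.

HB.instance Definition _ := GRing.Zmodule_isNzRing.Build U
  umulA umul1l umul1r umulDl umulDr uone_neq0.

Fact uscaleAl (k : R[i]) u v : k *: (u * v) = (k *: u) * v.
Proof.
apply: uext => /=; [exact: mulrA|]; rewrite !scalerDr (ca_Zl H) !scalerA.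
by rewrite (mulrC v.1).
Qed.

HB.instance Definition _ := GRing.Lmodule_isLalgebra.Build R[i] U uscaleAl.

Fact uscaleAr (k : R[i]) u v : k *: (u * v) = u * (k *: v).
Proof.
apply: uext => /=; [exact: mulrCA|]; rewrite !scalerDr (ca_Zr H) !scalerA.
by rewrite (mulrC u.1).
Qed.

HB.instance Definition _ := GRing.Lalgebra_isAlgebra.Build R[i] U uscaleAr.

Definition uact u c : A := u.1 *: c + m u.2 c.

Lemma uactM u v c : uact (u * v) c = uact u (uact v c).
Proof.
rewrite /uact /= (ca_Dr H) !(ca_Dl H) (ca_A H) !(ca_Zl H) (ca_Zr H) scalerDr scalerA.
by rewrite -!addrA.
Qed.

Lemma uactD u v c : uact (u + v) c = uact u c + uact v c.
Proof. by rewrite /uact /= scalerDl (ca_Dl H) addrACA. Qed.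

Lemma uactZ (k : R[i]) u c : uact (k *: u) c = k *: uact u c.
Proof. by rewrite /uact /= scalerDr (ca_Zl H) scalerA. Qed.

Lemma uactZr u (k : R[i]) c : uact u (k *: c) = k *: uact u c.
Proof. by rewrite /uact (ca_Zr H) scalerDr !scalerA mulrC. Qed.

Lemma uact_adj u v c d : m (s (uact u c)) (uact v d) = m (s c) (uact (ustar u * v) d).
Proof.
rewrite uactM; move: (uact v d) => x.
by rewrite /uact /= (ca_sD H) (ca_sZ H) (ca_sM H) (ca_Dl H) (ca_Dr H) (ca_Zl H) (ca_Zr H) (ca_A H).
Qed.

Definition opn u : R := sup [set vabs (uact u c) | c in [set c | vabs c <= 1]].

Lemma opn_has_sup u : has_sup [set vabs (uact u c) | c in [set c | vabs c <= 1]].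
Proof.
split; first by exists (vabs (uact u 0)), 0 => //=; rewrite vabs0.
exists (cabs u.1 + vabs u.2) => _ [c /= c1 <-].
apply: le_trans (ler_vabsD _ _) _; rewrite vabsZ.
apply: lerD; first by rewrite ler_piMr ?cabs_ge0.
by apply: le_trans (ca_M H _ _) _; rewrite ler_piMr ?vabs_ge0.
Qed.

Lemma opn_ge0 u : 0 <= opn u.
Proof.
apply: le_trans (vabs_ge0 (uact u 0)) _; apply: ub_le_sup.
  by have [] := opn_has_sup u.
by exists 0 => //=; rewrite vabs0.
Qed.

Lemma vabs_uact u c : vabs (uact u c) <= opn u * vabs c.
Proof.
have [c0|c0] := eqVneq (vabs c) 0.
  by rewrite (vabs_eq0 c0) /uact scaler0 ca_0r addr0 vabs0 mulr0.
have {}c0 : 0 < vabs c by rewrite lt_def c0 vabs_ge0.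
rewrite -ler_pdivrMr// mulrC.
have -> : (vabs c)^-1 * vabs (uact u c) = vabs (uact u ((vabs c)^-1%:C *: c)).
  rewrite uactZr vabsZ cabsR ger0_norm//.
  by rewrite invr_ge0 ltW.
apply: ub_le_sup; first by have [] := opn_has_sup u.
exists ((vabs c)^-1%:C *: c) => //=.
by rewrite vabsZ cabsR ger0_norm ?invr_ge0 ?vabs_ge0// mulVf ?gt_eqF.
Qed.

Lemma opn_le u t : 0 <= t -> (forall c, vabs (uact u c) <= t * vabs c) -> opn u <= t.
Proof.
move=> t0 h; apply: sup_le_ub; first by have [] := opn_has_sup u.
move=> _ [c /= c1 <-]; apply: le_trans (h c) _.
by rewrite -[leRHS]mulr1 ler_wpM2l.
Qed.

Lemma opnD u v : opn (u + v) <= opn u + opn v.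
Proof.
apply: opn_le => [|c]; first by rewrite addr_ge0 ?opn_ge0.
rewrite uactD mulrDl; apply: le_trans (ler_vabsD _ _) _.
by rewrite lerD ?vabs_uact.
Qed.

Lemma opnM u v : opn (u * v) <= opn u * opn v.
Proof.
apply: opn_le => [|c]; first by rewrite mulr_ge0 ?opn_ge0.
rewrite uactM; apply: le_trans (vabs_uact _ _) _.
by rewrite -mulrA ler_wpM2l ?opn_ge0 ?vabs_uact.
Qed.

Lemma opnZ_le (k : R[i]) u : opn (k *: u) <= cabs k * opn u.
Proof.
apply: opn_le => [|c]; first by rewrite mulr_ge0 ?opn_ge0 ?cabs_ge0.
by rewrite uactZ vabsZ -mulrA ler_wpM2l ?cabs_ge0 ?vabs_uact.
Qed.

Lemma opnZ (k : R[i]) u : opn (k *: u) = cabs k * opn u.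
Proof.
apply: le_anti; rewrite opnZ_le /=.
have [->|k0] := eqVneq k 0; first by rewrite cabsR normr0 mul0r opn_ge0.
have := opnZ_le k^-1 (k *: u); rewrite scalerA mulVf// scale1r.
have k1 : cabs k * cabs k^-1 = 1 by rewrite -cabsM mulfV// cabsR normr1.
have := cabs_ge0 k => k2 h; have := ler_wpM2l k2 h.
by rewrite mulrA k1 mul1r.
Qed.

Lemma vabs_star a : vabs (s a) = vabs a.
Proof.
have sub b : vabs b <= vabs (s b).
  have := ca_M H (s b) b; rewrite (ca_s H) expr2.
  have := vabs_ge0 b; rewrite le_eqVlt => /orP[/eqP <- _|y0]; first exact: vabs_ge0.
  by rewrite ler_pM2r.
by apply: le_anti; rewrite sub andbT -{2}(ca_sK H a) sub.
Qed.

(** The C*-identity of [A] passes to its multipliers: $\|uc\|^2=\|c^*u^*uc\|\le\|c\|\,\|u^*uc\|$ for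
    [c] in [A]. *)
Lemma opn_sqr_le u : opn u ^+ 2 <= opn (ustar u * u).
Proof.
have h0 : 0 <= Num.sqrt (opn (ustar u * u)) by rewrite sqrtr_ge0.
suff h : opn u <= Num.sqrt (opn (ustar u * u)).
  by rewrite -[leRHS]sqr_sqrtr ?opn_ge0// ler_sqr ?nnegrE ?opn_ge0.
apply: opn_le => // c.
rewrite -ler_sqr ?nnegrE ?mulr_ge0 ?vabs_ge0// exprMn sqr_sqrtr ?opn_ge0//.
rewrite -(ca_s H) uact_adj; apply: le_trans (ca_M H _ _) _.
rewrite vabs_star expr2 mulrCA ler_wpM2l ?vabs_ge0//; exact: vabs_uact.
Qed.

Lemma ustarK : involutive ustar.
Proof. by move=> u; apply: uext; rewrite /= ?conjCK// (ca_sK H). Qed.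

Lemma opn_star u : opn (ustar u) = opn u.
Proof.
have sub v : opn v <= opn (ustar v).
  have := le_trans (opn_sqr_le v) (opnM (ustar v) v); rewrite expr2.
  have := opn_ge0 v; rewrite le_eqVlt => /orP[/eqP <- _|y0]; first exact: opn_ge0.
  by rewrite ler_pM2r.
by apply: le_anti; rewrite sub andbT -{2}(ustarK u) sub.
Qed.

(* The maximum makes this a norm, and a complete one, even if [A] has a unit:
   then [opn] vanishes at [(1, - 1_A)]. *)
Definition uabs u : R := Num.max (cabs u.1) (opn u).

(** The lower bound comes from the test vector [s a], since $\|aa^*\|=\|a\|^2$. *)
Lemma vabs_opn a : vabs a = opn (0, a).
Proof.
apply: le_anti; apply/andP; split; last first.
  apply: opn_le => [|c]; first exact: vabs_ge0.
  by rewrite /uact scale0r add0r (ca_M H).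
have := vabs_uact (0, a) (s a); rewrite /uact scale0r add0r.
rewrite -{1}(ca_sK H a) (ca_s H) expr2.
have /predU1P[y0|y0] : (0 == vabs (s a)) || (0 < vabs (s a)).
- by rewrite -le_eqVlt vabs_ge0.
- by move=> _; rewrite -vabs_star -y0 opn_ge0.
by rewrite ler_pM2r// vabs_star.
Qed.

Lemma uabs_inj a : uabs (0, a) = vabs a.
Proof. by rewrite /uabs -vabs_opn cabsR normr0 max_r// vabs_ge0. Qed.

(** The factor 2 counts the two terms of [u - u.1 *: uone], which isolates the [A]-component.
    Definiteness and completeness of [uabs] rest on this bound. *)
Lemma vabs_uabs u : vabs u.2 <= 2 * uabs u.
Proof.
rewrite vabs_opn.
have -> : (0, u.2) = u - (u.1 *: uone) :> U.
  apply: uext => /=; last by rewrite scaler0 subr0.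
  by rewrite [X in _ - X](_ : _ = u.1) ?subrr//; exact: mulr1.
apply: le_trans (opnD _ _) _; rewrite -scaleNr opnZ.
have h1 : opn uone <= 1.
  by apply: opn_le => // c; rewrite /uact scale1r ca_0l addr0 mul1r.
have -> : cabs (- u.1) = cabs u.1 by rewrite /cabs normrN.
have : cabs u.1 <= uabs u by rewrite /uabs le_max lexx.
have : opn u <= uabs u by rewrite /uabs le_max lexx orbT.
by have := cabs_ge0 u.1; have := opn_ge0 uone; nra.
Qed.

Lemma uabs_le u t : cabs u.1 <= t -> opn u <= t -> uabs u <= t.
Proof. by move=> h1 h2; rewrite /uabs ge_max h1 h2. Qed.

Theorem unitization_cstar_norm : @cstar_norm R U ustar uabs.
Proof.
have cu u : cabs u.1 <= uabs u by rewrite /uabs le_max lexx.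
have ou u : opn u <= uabs u by rewrite /uabs le_max lexx orbT.
split.
- exact: ustarK.
- by move=> u v; apply: uext; rewrite /= ?rmorphD// (ca_sD H).
- move=> u v; apply: uext; rewrite /= ?rmorphM 1?mulrC//.
  by rewrite !(ca_sD H) !(ca_sZ H) (ca_sM H) [X in X + _]addrC.
- by move=> k u; apply: uext; rewrite /= ?rmorphM// (ca_sZ H).
- move=> u u0; apply: uext.
    by apply: cabs_eq0; apply: le_anti; rewrite cabs_ge0 andbT -u0.
  apply: vabs_eq0; apply: le_anti; rewrite vabs_ge0 andbT.
  by have := vabs_uabs u; rewrite u0 mulr0.
- move=> u v; apply: uabs_le.
    by apply: le_trans (ler_cabsD _ _) _; rewrite lerD.
  by apply: le_trans (opnD _ _) _; rewrite lerD.
- by move=> k u; rewrite /uabs /= cabsM opnZ maxr_pMr ?cabs_ge0.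
- move=> u v; apply: uabs_le.
    by rewrite /= cabsM ler_pM ?cabs_ge0.
  by apply: le_trans (opnM _ _) _; rewrite ler_pM ?opn_ge0.
- move=> u.
  have o2 : opn (ustar u * u) = opn u ^+ 2.
    apply: le_anti; rewrite opn_sqr_le andbT.
    by apply: le_trans (opnM _ _) _; rewrite opn_star expr2.
  rewrite {1}/uabs o2 /= cabs_sqr /uabs.
  have [h|h] := leP (cabs u.1) (opn u).
    by rewrite max_r// ler_sqr ?nnegrE ?cabs_ge0 ?opn_ge0.
  by rewrite max_l// ler_sqr ?nnegrE ?cabs_ge0 ?opn_ge0// ltW.
- move=> u hu.
  have [e e0|a ha] := @cabs_complete R (fun i => (u i).1).
    have [N hN] := hu e e0; exists N => i j Ni Nj.
    exact: le_lt_trans (cu (u i - u j)) (hN _ _ Ni Nj).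
  have [e e0|b hb] := @vabs_complete R A (fun i => (u i).2).
    have [|N hN] := hu (e / 2); first by lra.
    exists N => i j Ni Nj.
    by have := vabs_uabs (u i - u j); have := hN _ _ Ni Nj; rewrite /=; lra.
  exists ((a, b) : U) => e e0; have e2 : 0 < e / 2 by lra.
  have [N1 h1] := ha _ e2; have [N2 h2] := hb _ e2.
  exists (maxn N1 N2) => i; rewrite geq_max => /andP[/h1 {}h1 /h2 {}h2].
  suff h : uabs (u i - (a, b)) <= cabs ((u i).1 - a) + vabs ((u i).2 - b) by lra.
  apply: uabs_le => /=; first by rewrite lerDl vabs_ge0.
  apply: opn_le => [|c]; first by rewrite addr_ge0 ?vabs_ge0 ?cabs_ge0.
  rewrite /uact /= mulrDl; apply: le_trans (ler_vabsD _ _) _.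
  by rewrite vabsZ lerD2l (ca_M H).
Qed.

Definition pos a := cpos ustar uabs (0, a).

End Unitization.

(** * Fibrewise calculus in a Fell bundle *)

Section Groupoid.
Variable G : etaleGroupoid.
Implicit Types x y z : G.

Definition fac x y z := gsrc x = grng y /\ gmul x y = z.

Lemma grngV x : grng (ginv x) = gsrc x.
Proof. by rewrite /grng (ginvK x). Qed.

Lemma gsrcV x : gsrc (ginv x) = grng x.
Proof. by rewrite /gsrc (ginvK x). Qed.

Lemma gmulr_src x : gmul x (gsrc x) = x.
Proof.
rewrite /gsrc -(@gmulA G x (ginv x) x); rewrite /composable /= ?grngV ?gsrcV//.
by have := @gmulKr G x (ginv x); rewrite (ginvK x); apply; rewrite /composable /= grngV.
Qed.

Lemma gmull_rng x : gmul (grng x) x = x.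
Proof.
rewrite /grng (@gmulA G x (ginv x) x); rewrite /composable /= ?grngV ?gsrcV//.
exact: gmulr_src.
Qed.

Lemma gsrcM x y : gsrc x = grng y -> gsrc (gmul x y) = gsrc y.
Proof.
move=> xy; rewrite -[RHS]grngV.
by have [] := @composableM G x y (ginv y) xy (esym (grngV y)).
Qed.

Lemma grngM x y : gsrc x = grng y -> grng (gmul x y) = grng x.
Proof.
move=> xy; rewrite -[RHS]gsrcV.
by have [_] := @composableM G (ginv x) x y (gsrcV x) xy.
Qed.

Lemma ginvM x y : gsrc x = grng y -> ginv (gmul x y) = gmul (ginv y) (ginv x).
Proof.
move=> xy; have h1 : gsrc (gmul x y) = grng (ginv y) by rewrite gsrcM// grngV.
have := @gmulKl G (gmul x y) (ginv y) h1.
rewrite (@gmulKr G x y xy) => <-; rewrite (@gmulKr G)//.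
by rewrite /composable /= gsrcV grngM.
Qed.

Lemma gsrc_src x : gsrc (gsrc x) = gsrc x.
Proof. by rewrite {2}/gsrc gsrcM// gsrcV. Qed.

Lemma grng_src x : grng (gsrc x) = gsrc x.
Proof. by rewrite {1}/gsrc grngM ?gsrcV// grngV. Qed.

Lemma gsrc_rng x : gsrc (grng x) = grng x.
Proof. by rewrite -gsrcV gsrc_src. Qed.

Lemma unitsP x : units G x <-> gsrc x = x.
Proof. by split=> [[y _ <-]|<-]; [exact: gsrc_src|exists x]. Qed.

Lemma units_src x : units G (gsrc x).
Proof. by exists x. Qed.

Lemma units_rng x : units G (grng x).
Proof. by apply/unitsP; exact: gsrc_rng. Qed.

Lemma grng_unit x : gsrc x = x -> grng x = x.
Proof. by move=> hx; rewrite -[in LHS]hx grng_src. Qed.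

Lemma ginv_unit x : gsrc x = x -> ginv x = x.
Proof. by move=> hx; have := gmulr_src (ginv x); rewrite gsrcV (grng_unit hx) => <-. Qed.

Definition gdiv x y : G := gmul x (ginv y).

Lemma gsrc_div x y : gsrc x = gsrc y -> gsrc (gdiv x y) = grng y.
Proof. by move=> xy; rewrite gsrcM ?gsrcV ?grngV. Qed.

Lemma grng_div x y : gsrc x = gsrc y -> grng (gdiv x y) = grng x.
Proof. by move=> xy; rewrite grngM ?grngV. Qed.

Lemma gdivK x y : gsrc x = gsrc y -> gmul (gdiv x y) y = x.
Proof.
move=> xy; have := @gmulKr G x (ginv y).
by rewrite (ginvK y); apply; rewrite /composable /= grngV.
Qed.

Lemma gmulK x y : gsrc x = grng y -> gdiv (gmul x y) y = x.
Proof. by move=> xy; exact: gmulKr. Qed.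

Lemma ginv_div x y : gsrc x = gsrc y -> ginv (gdiv x y) = gdiv y x.
Proof. by move=> xy; rewrite /gdiv ginvM ?grngV// (ginvK y). Qed.

Lemma gdiv_div x y z : gsrc x = gsrc y -> gsrc z = gsrc y ->
  gmul (gdiv x z) (gdiv z y) = gdiv x y.
Proof.
move=> xy zy; rewrite /gdiv -(@gmulA G (gmul x (ginv z)) z (ginv y)).
- by rewrite -/(gdiv x z) gdivK// xy.
- by rewrite /composable /= -/(gdiv x z) gsrc_div// xy.
- by rewrite /composable /= grngV.
Qed.

Lemma fac_div x y : gsrc x = gsrc y -> fac (gdiv x y) y x.
Proof. by move=> xy; split; [exact: gsrc_div|exact: gdivK]. Qed.

Lemma fac_Vl x y : gsrc y = x -> fac (ginv y) y x.
Proof. by move=> yx; split=> //; rewrite gsrcV. Qed.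

Lemma fac_unit x : gsrc x = x -> fac x x x.
Proof. by move=> hx; split; rewrite ?grng_unit// -{2}hx gmulr_src. Qed.

Lemma fac_src x y : gsrc y = x -> fac y x y.
Proof. by move=> <-; split; rewrite ?grng_src// gmulr_src. Qed.

Lemma fac_rng x y : grng y = x -> fac x y y.
Proof. by move=> <-; split; rewrite ?gsrc_rng// gmull_rng. Qed.

End Groupoid.

Section Fibres.
Variables (R : realType) (G : etaleGroupoid) (rho : fellBundle R G).
Implicit Types (x y z : G).

Lemma proj_inj x (u : fib rho x) : proj (inj u) = x.
Proof. by have [+ _ _] := @inj_bij _ _ rho x; move=> /(_ u I). Qed.

Lemma inj_injective x : injective (@inj _ _ rho x).
Proof. by move=> u v uv; have [_ + _] := @inj_bij _ _ rho x; apply; rewrite ?inE. Qed.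

Lemma coordK x (b : tot rho) : proj b = x -> inj (coord (E := rho) x b) = b.
Proof.
move=> bx; have [_ _ +] := @inj_bij _ _ rho x => /(_ b bx)[u _ ub].
by apply: (@xgetPex _ _ [set e | inj e = b]); exists u.
Qed.

Lemma injK x (u : fib rho x) : coord x (inj u) = u.
Proof. by apply: inj_injective; rewrite coordK// proj_inj. Qed.

Lemma inj_add x (u v : fib rho x) : inj (u + v) = badd (inj u) (inj v).
Proof.
rewrite /badd; have h : proj (inj u) = x := proj_inj u.
move: (h); case: _ / (esym h) => _; by rewrite !injK.
Qed.

Lemma inj_scale x k (u : fib rho x) : inj (k *: u) = bscale k (inj u).
Proof.
rewrite /bscale; have h : proj (inj u) = x := proj_inj u.
move: (h); case: _ / (esym h) => _; by rewrite !injK.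
Qed.

Lemma bnorm_inj x (u : fib rho x) : bnorm (inj u) = vabs u.
Proof.
rewrite /bnorm; have h : proj (inj u) = x := proj_inj u.
move: (h); case: _ / (esym h) => _; by rewrite !injK.
Qed.

(* The target arrow is an explicit index, constrained by [fac] in the lemmas,
   so that equalities of arrows never have to be transported along. *)
Definition mu x y z (u : fib rho x) (v : fib rho y) : fib rho z :=
  coord z (bmul (inj u) (inj v)).

Definition sg x y (u : fib rho x) : fib rho y := coord y (bstar (inj u)).

Lemma bcomposable_inj x y (u : fib rho x) (v : fib rho y) :
  gsrc x = grng y -> bcomposable rho (inj u, inj v).
Proof. by rewrite /bcomposable /composable /= !proj_inj. Qed.

Lemma inj_mu x y z (u : fib rho x) (v : fib rho y) :
  fac x y z -> inj (mu z u v) = bmul (inj u) (inj v).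
Proof.
move=> [xy xyz]; rewrite /mu coordK// proj_bmul ?proj_inj//.
exact: bcomposable_inj.
Qed.

Lemma inj_sg x y (u : fib rho x) : y = ginv x -> inj (sg y u) = bstar (inj u).
Proof. by move=> ->; rewrite /sg coordK// proj_bstar proj_inj. Qed.

Lemma muA x y z xy yz xyz (u : fib rho x) (v : fib rho y) (w : fib rho z) :
  fac x y xy -> fac y z yz -> fac xy z xyz -> fac x yz xyz ->
  mu xyz (mu xy u v) w = mu xyz u (mu yz v w).
Proof.
move=> h1 h2 h3 h4; apply: inj_injective; rewrite !inj_mu//.
by apply: bmulA; apply: bcomposable_inj; [case: h1|case: h2].
Qed.

Lemma muDl x y z (u v : fib rho x) (w : fib rho y) : fac x y z ->
  mu z (u + v) w = mu z u w + mu z v w.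
Proof.
move=> h; apply: inj_injective; rewrite inj_add !inj_mu// inj_add bmulDl ?proj_inj//.
by apply: bcomposable_inj; case: h.
Qed.

Lemma muDr x y z (u : fib rho x) (v w : fib rho y) : fac x y z ->
  mu z u (v + w) = mu z u v + mu z u w.
Proof.
move=> h; apply: inj_injective; rewrite inj_add !inj_mu// inj_add bmulDr ?proj_inj//.
by apply: bcomposable_inj; case: h.
Qed.

Lemma muZl x y z k (u : fib rho x) (w : fib rho y) : fac x y z ->
  mu z (k *: u) w = k *: mu z u w.
Proof.
move=> h; apply: inj_injective; rewrite inj_scale !inj_mu// inj_scale bmulZl//.
by apply: bcomposable_inj; case: h.
Qed.

Lemma muZr x y z k (u : fib rho x) (w : fib rho y) : fac x y z ->
  mu z u (k *: w) = k *: mu z u w.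
Proof.
move=> h; apply: inj_injective; rewrite inj_scale !inj_mu// inj_scale bmulZr//.
by apply: bcomposable_inj; case: h.
Qed.

Lemma mu0l x y z (w : fib rho y) : fac x y z -> mu z (0 : fib rho x) w = 0.
Proof. by move=> h; rewrite -(scale0r (0 : fib rho x)) muZl// scale0r. Qed.

Lemma mu0r x y z (u : fib rho x) : fac x y z -> mu z u (0 : fib rho y) = 0.
Proof. by move=> h; rewrite -(scale0r (0 : fib rho y)) muZr// scale0r. Qed.

Lemma muNl x y z (u : fib rho x) (w : fib rho y) : fac x y z -> mu z (- u) w = - mu z u w.
Proof. by move=> h; rewrite -scaleN1r muZl// scaleN1r. Qed.

Lemma muNr x y z (u : fib rho x) (w : fib rho y) : fac x y z -> mu z u (- w) = - mu z u w.
Proof. by move=> h; rewrite -scaleN1r muZr// scaleN1r. Qed.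

Lemma mu_suml (I : Type) (r : seq I) (P : pred I) x y z (u : I -> fib rho x) (w : fib rho y) :
  fac x y z -> mu z (\sum_(i <- r | P i) u i) w = \sum_(i <- r | P i) mu z (u i) w.
Proof.
move=> h; apply: (big_morph (fun u => mu z u w)) => [u1 u2|]; [exact: muDl|exact: mu0l].
Qed.

Lemma mu_sumr (I : Type) (r : seq I) (P : pred I) x y z (u : fib rho x) (w : I -> fib rho y) :
  fac x y z -> mu z u (\sum_(i <- r | P i) w i) = \sum_(i <- r | P i) mu z u (w i).
Proof.
move=> h; apply: (big_morph (fun w => mu z u w)) => [u1 u2|]; [exact: muDr|exact: mu0r].
Qed.

Lemma sgK x y (u : fib rho x) : y = ginv x -> sg x (sg y u) = u.
Proof.
move=> h; apply: inj_injective; rewrite (inj_sg _ _) ?h ?(ginvK x)// inj_sg ?h//.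
exact: bstarK.
Qed.

Lemma sgD x y (u v : fib rho x) : y = ginv x -> sg y (u + v) = sg y u + sg y v.
Proof.
move=> h; apply: inj_injective; rewrite inj_add !inj_sg// inj_add bstarD//.
by rewrite !proj_inj.
Qed.

Lemma sgZ x y k (u : fib rho x) : y = ginv x -> sg y (k *: u) = k^* *: sg y u.
Proof. by move=> h; apply: inj_injective; rewrite inj_scale !inj_sg// inj_scale bstarZ. Qed.

Lemma sg0 x y : y = ginv x -> sg y (0 : fib rho x) = 0.
Proof. by move=> h; rewrite -(scale0r (0 : fib rho x)) sgZ// rmorph0 scale0r. Qed.

Lemma sg_sum (I : Type) (r : seq I) (P : pred I) x y (u : I -> fib rho x) :
  y = ginv x -> sg y (\sum_(i <- r | P i) u i) = \sum_(i <- r | P i) sg y (u i).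
Proof.
move=> h; apply: (big_morph (@sg x y)) => [u1 u2|]; [exact: sgD|exact: sg0].
Qed.

Lemma sgM x y z x' y' z' (u : fib rho x) (v : fib rho y) :
  fac x y z -> x' = ginv x -> y' = ginv y -> z' = ginv z ->
  sg z' (mu z u v) = mu z' (sg y' v) (sg x' u).
Proof.
move=> h hx hy hz; have [xy xyz] := h.
have h' : fac y' x' z'.
  by split; rewrite hx hy; [rewrite gsrcV grngV|rewrite hz -xyz ginvM].
apply: inj_injective; rewrite inj_sg// !inj_mu// !inj_sg// bstarM//.
exact: bcomposable_inj.
Qed.

Lemma vabs_mu x y z (u : fib rho x) (v : fib rho y) : fac x y z ->
  vabs (mu z u v) <= vabs u * vabs v.
Proof.
move=> h; rewrite -!bnorm_inj inj_mu//; apply: bnormM.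
by apply: bcomposable_inj; case: h.
Qed.

Lemma vabs_sgmu x y z (u : fib rho x) : y = ginv x -> z = gsrc x ->
  vabs (mu z (sg y u) u) = vabs u ^+ 2.
Proof.
move=> hy hz; rewrite -!bnorm_inj inj_mu ?inj_sg ?bnorm_bstar//.
by rewrite hy hz; exact: fac_Vl.
Qed.

Lemma fibre_alg x : gsrc x = x -> cstar_alg (@mu x x x) (@sg x x).
Proof.
move=> hx; have f := fac_unit hx; have i := esym (ginv_unit hx).
split.
- by move=> a b c; exact: muA.
- by move=> a b c; exact: muDl.
- by move=> a b c; exact: muDr.
- by move=> k a b; exact: muZl.
- by move=> k a b; exact: muZr.
- by move=> a; exact: sgK.
- by move=> a b; exact: sgD.
- by move=> a b; exact: sgM.
- by move=> k a; exact: sgZ.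
- by move=> a b; exact: vabs_mu.
- by move=> a; exact: vabs_sgmu.
Qed.

Lemma vabs_sg x y (u : fib rho x) : y = ginv x -> vabs (sg y u) = vabs u.
Proof.
have sub x' y' (v : fib rho x') : y' = ginv x' -> vabs v <= vabs (sg y' v).
  move=> h.
  have := @vabs_mu y' x' (gsrc x') (sg y' v) v; rewrite vabs_sgmu// h => /(_ (fac_Vl erefl)).
  rewrite expr2; have /predU1P[y0|y0] : (0 == vabs v) || (0 < vabs v).
  - by rewrite -le_eqVlt vabs_ge0.
  - by rewrite -y0 vabs_ge0.
  - by rewrite ler_pM2r.
move=> h; apply: le_anti; rewrite sub// andbT -{2}(sgK u h) sub// h.
by rewrite (ginvK x).
Qed.

(** The algebra depends on a proof that [x] is a unit, so the proof is packed in; [Prop_irrelevance]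
    reconciles two such proofs. *)
Definition fpos x (p : fib rho x) := exists hx : gsrc x = x, pos (fibre_alg hx) p.

Lemma fposD x (p q : fib rho x) : fpos p -> fpos q -> fpos (p + q).
Proof.
move=> [hx hp] [hx' hq]; exists hx; rewrite (Prop_irrelevance hx' hx) in hq.
have := cposD (unitization_cstar_norm (fibre_alg hx)) hp hq.
by rewrite /pos; congr (cpos _ _ _); apply: uext; rewrite //= addr0.
Qed.

Lemma fpos0 x : gsrc x = x -> fpos (0 : fib rho x).
Proof. by move=> hx; exists hx; exact: (cpos0 (unitization_cstar_norm (fibre_alg hx))). Qed.

Lemma fposZ x (t : R) (p : fib rho x) : 0 <= t -> fpos p -> fpos (t%:C *: p).
Proof.
move=> t0 [hx hp]; exists hx.
have := cposZ (unitization_cstar_norm (fibre_alg hx)) t0 hp.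
by rewrite /pos; congr (cpos _ _ _); apply: uext; rewrite //=; exact: mulr0.
Qed.

Lemma fpos_sum x (I : Type) (r : seq I) (P : pred I) (p : I -> fib rho x) :
  gsrc x = x -> (forall i, P i -> fpos (p i)) -> fpos (\sum_(i <- r | P i) p i).
Proof. move=> hx h; apply: (big_ind (@fpos x)) => //; [exact: fpos0|exact: fposD]. Qed.

Lemma fpos_le x (p q : fib rho x) : fpos p -> fpos q -> vabs p <= vabs (p + q).
Proof.
move=> [hx hp] [hx' hq]; rewrite (Prop_irrelevance hx' hx) in hq.
have := cpos_le (unitization_cstar_norm (fibre_alg hx)) hp hq.
rewrite -!(uabs_inj (fibre_alg hx)); congr (_ <= uabs _).
by apply: uext; rewrite //= addr0.
Qed.

(** Here [u] lies over an arbitrary arrow, so [cpos_star_mul] does not apply to it. The axiom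
    [bstar_pos] supplies an [a] over the unit [z] with the same $a^*a=u^*u$. *)
Lemma fpos_sgmu x y z (u : fib rho x) : y = ginv x -> z = gsrc x ->
  fpos (mu z (sg y u) u).
Proof.
move=> hy hz; have hz' : gsrc z = z by rewrite hz gsrc_src.
have f : fac y x z by rewrite hy hz; exact: fac_Vl.
have [a pa aa] := bstar_pos (inj u).
have {}pa : proj a = z.
  rewrite pa -(inj_sg _ hy) -(inj_mu _ _ f) proj_inj//.
rewrite -(coordK pa) in aa; move: (coord _ _) aa => {pa} {}a aa.
exists hz'.
have := cpos_star_mul (unitization_cstar_norm (fibre_alg hz')) (0, a).
rewrite /pos; congr (cpos _ _ _); apply: uext; rewrite /= ?conjC0 ?mul0r//.
rewrite !scale0r !add0r; apply: inj_injective.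
rewrite (inj_mu _ _ f) inj_mu; last exact: fac_unit.
by rewrite inj_sg ?ginv_unit// inj_sg.
Qed.

(** * The unitized fibre over a unit acting on the fibres with that range *)

Section UnitAction.
Variables (b y x : G).
Hypotheses (hy : grng b = y) (hx : gsrc b = x) (uy : gsrc y = y).
Local Notation A := (unitization (fibre_alg uy)).

Definition uact_fib (v : A) (u : fib rho b) : fib rho b := v.1 *: u + mu b v.2 u.

Lemma uact_fib_adj (v : A) (u w : fib rho b) :
  mu x (sg (ginv b) (uact_fib v u)) w = mu x (sg (ginv b) u) (uact_fib (ustar v) w).
Proof.
have f1 : fac (ginv b) b x by exact: fac_Vl.
have f2 : fac y b b by exact: fac_rng.
have f3 : fac (ginv b) y (ginv b) by apply: fac_src; rewrite gsrcV.
have iy : y = ginv y by rewrite ginv_unit.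
rewrite /uact_fib /= sgD// sgZ// (sgM _ _ f2 iy erefl erefl).
by rewrite (muDl _ _ _ f1) (muDr _ _ _ f1) (muZl _ _ _ f1) (muZr _ _ _ f1) (muA _ _ _ f3 f2 f1 f1).
Qed.

Lemma uact_fibM (v w : A) (u : fib rho b) :
  uact_fib (v * w) u = uact_fib v (uact_fib w u).
Proof.
have f2 : fac y b b by exact: fac_rng.
have f4 : fac y y y := fac_unit uy.
rewrite /uact_fib /= (muDr _ _ _ f2) !(muDl _ _ _ f2) (muA _ _ _ f4 f2 f2 f2).
by rewrite !(muZl _ _ _ f2) (muZr _ _ _ f2) scalerDr scalerA -!addrA.
Qed.

(** By adjointness of the action, the expression is $w^*w$ for $w=vu$. *)
Lemma fpos_uact (v : A) (p : fib rho y) (t : R) (u : fib rho b) :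
  ustar v * v = ((t%:C : R[i]^o), p) ->
  fpos (t%:C *: mu x (sg (ginv b) u) u + mu x (sg (ginv b) u) (mu b p u)).
Proof.
move=> hv; have f1 : fac (ginv b) b x by exact: fac_Vl.
rewrite -(muZr _ _ _ f1) -(muDr _ _ _ f1).
have := uact_fib_adj v u (uact_fib v u); rewrite -uact_fibM hv {3}/uact_fib /= => <-.
exact: fpos_sgmu.
Qed.

(** This is $u^*pu\le t\,u^*u$: the positive element $t-p$ has a self-adjoint square root in the
    unitization, which acts on [u]. Both the Cauchy-Schwarz inequality and the bound for slice
    sections come from it. *)
Lemma fpos_conj_le (p : fib rho y) (u : fib rho b) (t : R) : fpos p -> vabs p <= t ->
  fpos (t%:C *: mu x (sg (ginv b) u) u - mu x (sg (ginv b) u) (mu b p u)).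
Proof.
move=> [uy' hp] pt; rewrite (Prop_irrelevance uy' uy) in hp.
have H := unitization_cstar_norm (fibre_alg uy).
rewrite -(uabs_inj (fibre_alg uy)) in pt.
have [v [sv _ vv _]] := cpos_sqrt H (cpos_subr H hp pt).
have f1 : fac (ginv b) b x by exact: fac_Vl.
have f2 : fac y b b by exact: fac_rng.
rewrite -(muNr _ _ f1) -(muNl _ _ f2).
apply: (@fpos_uact v (- p) t u); rewrite sv vv.
by apply: uext; rewrite /= ?subr0 ?scaler0 ?sub0r//; exact: mulr1.
Qed.

End UnitAction.

End Fibres.

(** * Hilbert modules and operator bounds *)

Section HilbertModule.
Variables (R : realType) (G : etaleGroupoid) (rho : fellBundle R G).
Implicit Types (x y z : G) (F : seq G) (f g h c d : section rho) (t : R).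

Definition sadd f g : section rho := fun b => f b + g b.
Definition sscale (k : R[i]) f : section rho := fun b => k *: f b.

(** The inner product of a right Hilbert module over the fibre algebra at the unit [x], on vectors
    indexed by the arrows of [F] with source [x]; the truncation to [F] keeps every sum finite. *)
Definition ip F x f g : fib rho x :=
  \sum_(b <- F | `[< gsrc b = x >]) mu x (sg (ginv b) (f b)) (g b).

Definition nrm F x f : R := Num.sqrt (vabs (ip F x f f)).

Definition smulr x f (z : fib rho x) : section rho := fun b => mu b (f b) z.

Lemma eq_ip F x f f' g g' :
  (forall b, b \in F -> gsrc b = x -> f b = f' b) ->
  (forall b, b \in F -> gsrc b = x -> g b = g' b) -> ip F x f g = ip F x f' g'.
Proof.
move=> hf hg; rewrite /ip [LHS]big_seq_cond [RHS]big_seq_cond; apply: eq_bigr => b /andP[bF /asboolP bx].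
by rewrite hf// hg.
Qed.

Lemma eq_nrm F x f f' :
  (forall b, b \in F -> gsrc b = x -> f b = f' b) -> nrm F x f = nrm F x f'.
Proof. by move=> h; rewrite /nrm (eq_ip h h). Qed.

Lemma ipDl F x f g h : ip F x (sadd f g) h = ip F x f h + ip F x g h.
Proof.
rewrite /ip -big_split; apply: eq_bigr => b /asboolP bx /=.
by rewrite sgD// (muDl _ _ _ (fac_Vl bx)).
Qed.

Lemma ipDr F x f g h : ip F x f (sadd g h) = ip F x f g + ip F x f h.
Proof.
rewrite /ip -big_split; apply: eq_bigr => b /asboolP bx /=.
by rewrite (muDr _ _ _ (fac_Vl bx)).
Qed.

Lemma ipZl F x (k : R[i]) f g : ip F x (sscale k f) g = k^* *: ip F x f g.
Proof.
rewrite /ip scaler_sumr; apply: eq_bigr => b /asboolP bx /=.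
by rewrite sgZ// (muZl _ _ _ (fac_Vl bx)).
Qed.

Lemma ipZr F x (k : R[i]) f g : ip F x f (sscale k g) = k *: ip F x f g.
Proof.
rewrite /ip scaler_sumr; apply: eq_bigr => b /asboolP bx /=.
by rewrite (muZr _ _ _ (fac_Vl bx)).
Qed.

Lemma ip_star F x f g : gsrc x = x -> sg x (ip F x f g) = ip F x g f.
Proof.
move=> hx; have ix : x = ginv x by rewrite ginv_unit.
rewrite /ip sg_sum//; apply: eq_bigr => b /asboolP bx /=.
by rewrite (sgM _ _ (fac_Vl bx) (esym (ginvK b)) (erefl _) ix) sgK.
Qed.

Lemma ip_mulr F x f g (z : fib rho x) : gsrc x = x ->
  ip F x f (smulr g z) = mu x (ip F x f g) z.
Proof.
move=> hx; rewrite /ip mu_suml; last exact: fac_unit.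
apply: eq_bigr => b /asboolP bx /=; rewrite /smulr.
by rewrite (muA _ _ _ (fac_Vl bx) (fac_src bx) (fac_unit hx) (fac_Vl bx)).
Qed.

Lemma ip_mull F x f g (z : fib rho x) : gsrc x = x ->
  ip F x (smulr f z) g = mu x (sg x z) (ip F x f g).
Proof.
move=> hx; have ix : x = ginv x by rewrite ginv_unit.
by rewrite -(ip_star _ _ _ hx) ip_mulr// (sgM _ _ (fac_unit hx) ix ix ix) ip_star.
Qed.

Lemma fpos_ip F x f : gsrc x = x -> fpos (ip F x f f).
Proof.
by move=> hx; apply: fpos_sum => // b /asboolP bx; exact: fpos_sgmu.
Qed.

Lemma nrm_ge0 F x f : 0 <= nrm F x f.
Proof. exact: sqrtr_ge0. Qed.

Lemma nrm_sqr F x f : nrm F x f ^+ 2 = vabs (ip F x f f).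
Proof. by rewrite sqr_sqrtr ?vabs_ge0. Qed.

(** Expand $\langle h,h\rangle\ge0$ for $h=tg-fz$ with $z=\langle f,g\rangle$ and $t\ge T=\|\langle
    f,f\rangle\|$. As $z^*\langle f,f\rangle z\le Tz^*z$, this gives $(2t-T)z^*z\le t^2\langle
    g,g\rangle$, where $2t-T\ge t$. *)
Lemma cauchy_schwarz F x f g : gsrc x = x ->
  vabs (ip F x f g) <= nrm F x f * nrm F x g.
Proof.
move=> hx; set z := ip F x f g.
have ix : x = ginv x by rewrite ginv_unit.
rewrite -ler_sqr ?nnegrE ?mulr_ge0 ?vabs_ge0 ?nrm_ge0// exprMn !nrm_sqr.
set T := vabs (ip F x f f); set S := vabs (ip F x g g).
have T0 : 0 <= T := vabs_ge0 _; have S0 : 0 <= S := vabs_ge0 _.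
have key t : T <= t -> 0 < t -> vabs z ^+ 2 <= t * S.
  move=> Tt t0; have tc : (t%:C)^* = t%:C by rewrite conj_complexE conjc_real.
  have pzz : fpos (mu x (sg x z) z) by apply: fpos_sgmu.
  have pconj := fpos_conj_le (grng_unit hx) hx hx z (fpos_ip F f hx) (lexx T).
  rewrite (ginv_unit hx) in pconj.
  pose h := sadd (sscale t%:C g) (sscale (-1) (smulr f z)).
  have := fpos_ip F h hx.
  rewrite /h ipDl !ipDr !ipZl !ipZr !ip_mull// !ip_mulr// tc rmorphN rmorph1.
  rewrite -(ip_star F f g hx) -/z !scaleN1r scalerN opprK => ph.
  have := fposD ph pconj.
  set w := mu x (sg x z) z in pzz *; set C := mu x _ (mu x _ z).
  have -> : t%:C *: (t%:C *: ip F x g g) - t%:C *: w + (- (t%:C *: w) + C) + (T%:C *: w - C) =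
      (t * t)%:C *: ip F x g g - (t + (t - T))%:C *: w.
    rewrite -!addrA (addrC (T%:C *: w)) addNKr rmorphM /= -scalerA; congr (_ + _).
    have -> : (t + (t - T))%:C = t%:C + (t%:C - T%:C) by rewrite rmorphD rmorphB.
    by rewrite !scalerDl scaleNr !opprD opprK.
  move=> pd; have tT : 0 <= t + (t - T) by lra.
  have := fpos_le (fposZ tT pzz) pd; rewrite [in leRHS]addrC subrK !vabsZ !cabsR.
  rewrite (ger0_norm tT) (ger0_norm (mulr_ge0 (ltW t0) (ltW t0))) -/S. rewrite /w vabs_sgmu// => h1.
  rewrite -(ler_pM2l t0) [leRHS]mulrA; apply: (le_trans _ h1).
  by rewrite ler_wpM2r ?sqr_ge0//; lra.
(* [key] needs [t > 0] while [T] may vanish; raising [T] by [e / S] costs only [e]. If [S = 0], any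
   positive [t] above [T] works. *)
apply/ler_addgt0Pr => e e0.
have [S00|S00] := eqVneq S 0.
  by have := key (T + 1) ltac:(lra) ltac:(lra); rewrite S00 !mulr0; lra.
have {}S0 : 0 < S by rewrite lt_def S00.
have := key (T + e / S) _ _; rewrite mulrDl divfK//; apply.
  by rewrite lerDl divr_ge0// ltW.
by rewrite ltr_wpDl// divr_gt0.
Qed.

Lemma nrm_triangle F x f g : gsrc x = x ->
  nrm F x (sadd f g) <= nrm F x f + nrm F x g.
Proof.
move=> hx; rewrite -ler_sqr ?nnegrE ?addr_ge0 ?nrm_ge0// nrm_sqr.
rewrite ipDl !ipDr.
have h1 := ler_vabsD (ip F x f f + ip F x f g) (ip F x g f + ip F x g g).
have h2 := ler_vabsD (ip F x f f) (ip F x f g).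
have h3 := ler_vabsD (ip F x g f) (ip F x g g).
have h4 := cauchy_schwarz F f g hx; have h5 := cauchy_schwarz F g f hx.
rewrite -!nrm_sqr in h2 h3; nra.
Qed.

Lemma nrmZ F x (k : R[i]) f : nrm F x (sscale k f) = cabs k * nrm F x f.
Proof.
rewrite /nrm ipZl ipZr scalerA vabsZ cabs_sqr sqrtrM ?sqr_ge0// sqrtr_sqr.
by rewrite ger0_norm ?cabs_ge0.
Qed.

(* Enlarging the index set adds a positive term to the inner product. *)
Lemma nrm_subset F F' x f : gsrc x = x -> uniq F -> uniq F' -> {subset F <= F'} ->
  nrm F x f <= nrm F' x f.
Proof.
move=> hx uF uF' FF'; rewrite /nrm ler_sqrt ?vabs_ge0//.
rewrite /ip [X in _ <= vabs X](bigID (mem F)) /=.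
have -> : \sum_(b <- F | `[< gsrc b = x >]) mu x (sg (ginv b) (f b)) (f b) =
    \sum_(b <- F' | `[< gsrc b = x >] && (b \in F)) mu x (sg (ginv b) (f b)) (f b).
  under [RHS]eq_bigl do rewrite andbC.
  rewrite -[RHS]big_filter_cond; apply: perm_big.
  by rewrite uniq_perm ?filter_uniq// => b; rewrite mem_filter andb_idr// => /FF'.
by apply: fpos_le; apply: fpos_sum => // b /andP[/asboolP bx _]; apply: fpos_sgmu.
Qed.

Lemma nrm_extend F F' x f : uniq F -> uniq F' ->
  (forall b, b \in F' -> gsrc b = x -> f b != 0 -> b \in F) ->
  (forall b, b \in F -> gsrc b = x -> f b != 0 -> b \in F') ->
  nrm F x f = nrm F' x f.
Proof.
move=> uF uF' h h'; rewrite /nrm /ip; congr (Num.sqrt (vabs _)).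
have E (F1 : seq G) : \sum_(b <- F1 | `[< gsrc b = x >]) mu x (sg (ginv b) (f b)) (f b) =
    \sum_(b <- [seq b <- F1 | `[< gsrc b = x >] && (f b != 0)])
      mu x (sg (ginv b) (f b)) (f b).
  rewrite [RHS]big_filter.
  rewrite [LHS](bigID (fun b => f b != 0)) /= [X in _ + X]big1 ?addr0// => b.
  move=> /andP[/asboolP bx /negPn/eqP ->]; rewrite mu0r//; exact: fac_Vl.
rewrite (E F) (E F'); apply: perm_big.
rewrite uniq_perm ?filter_uniq// => b; rewrite !mem_filter.
case: asboolP => //= bx; case: eqP => //= /eqP fb.
by apply/idP/idP => [/h'|/h]; exact.
Qed.

Lemma vabs_nrm F x f b : gsrc x = x -> uniq F -> b \in F -> gsrc b = x ->
  vabs (f b) <= nrm F x f.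
Proof.
move=> hx uF bF bx; have := @nrm_subset [:: b] F x f hx isT uF.
rewrite /nrm /ip big_mkcond big_seq1 asboolT// vabs_sgmu// sqrtr_sqr.
rewrite ger0_norm ?vabs_ge0//; apply.
by move=> c; rewrite inE => /eqP ->.
Qed.

(** The left regular representation: [c] acts as the matrix with entry $c(yb^{-1})$ in row [y] and
    column [b], with the columns cut to [F]. *)
Definition op F c f : section rho := fun y =>
  \sum_(b <- F | `[< gsrc b = gsrc y >]) mu y (c (gdiv y b)) (f b).

Lemma eq_op F c c' f f' y :
  (forall b, b \in F -> gsrc b = gsrc y -> c (gdiv y b) = c' (gdiv y b)) ->
  (forall b, b \in F -> gsrc b = gsrc y -> f b = f' b) -> op F c f y = op F c' f' y.
Proof.
move=> hf hg; rewrite /op [LHS]big_seq_cond [RHS]big_seq_cond.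
by apply: eq_bigr => b /andP[bF /asboolP bx]; rewrite hf// hg.
Qed.

Lemma opDl F c d f y : op F (sadd c d) f y = op F c f y + op F d f y.
Proof.
rewrite /op -big_split; apply: eq_bigr => b /asboolP bx /=.
by rewrite (muDl _ _ _ (fac_div (esym bx))).
Qed.

Lemma opZl F k c f y : op F (sscale k c) f y = k *: op F c f y.
Proof.
rewrite /op scaler_sumr; apply: eq_bigr => b /asboolP bx /=.
by rewrite (muZl _ _ _ (fac_div (esym bx))).
Qed.

Lemma opDr F c f g y : op F c (sadd f g) y = op F c f y + op F c g y.
Proof.
rewrite /op -big_split; apply: eq_bigr => b /asboolP bx /=.
by rewrite (muDr _ _ _ (fac_div (esym bx))).
Qed.

Lemma op_extend F F' c f y : uniq F -> uniq F' ->
  (forall b, b \in F' -> gsrc b = gsrc y -> c (gdiv y b) != 0 -> f b != 0 -> b \in F) ->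
  (forall b, b \in F -> gsrc b = gsrc y -> c (gdiv y b) != 0 -> f b != 0 -> b \in F') ->
  op F c f y = op F' c f y.
Proof.
move=> uF uF' h h'; rewrite /op.
have E (F1 : seq G) : \sum_(b <- F1 | `[< gsrc b = gsrc y >]) mu y (c (gdiv y b)) (f b) =
    \sum_(b <- [seq b <- F1 | [&& `[< gsrc b = gsrc y >], c (gdiv y b) != 0 & f b != 0]])
      mu y (c (gdiv y b)) (f b).
  rewrite [RHS]big_filter.
  rewrite [LHS](bigID (fun b => (c (gdiv y b) != 0) && (f b != 0))) /=.
  rewrite [X in _ + X]big1 ?addr0// => b.
  move=> /andP[/asboolP bx]; rewrite negb_and !negbK => /orP[]/eqP ->.
    by rewrite mu0l//; exact: fac_div.
  by rewrite mu0r//; exact: fac_div.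
rewrite (E F) (E F'); apply: perm_big.
rewrite uniq_perm ?filter_uniq// => b; rewrite !mem_filter.
case: asboolP => //= bx; case: eqP => //= /eqP cb; case: eqP => //= /eqP fb.
by apply/idP/idP => [/h'|/h]; exact.
Qed.

Lemma sstarE c y : sstar c (ginv y) = sg (ginv y) (c y).
Proof. by rewrite /sstar /sg (ginvK y). Qed.

Lemma sstarK c : sstar (sstar c) = c.
Proof.
apply: functional_extensionality_dep => y.
by rewrite {1}/sstar sstarE inj_sg// bstarK injK.
Qed.

(** After exchanging two finite sums, this says that the entry of the adjoint matrix at [(b, y)] is
    $c(yb^{-1})^*=c^*(by^{-1})$. *)
Lemma ip_adj F F' x c f g :
  ip F' x (op F c f) g = ip F x f (op F' (sstar c) g).
Proof.
rewrite /ip; under eq_bigr => y /asboolP yx.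
  rewrite /op sg_sum// mu_suml; last exact: fac_Vl.
  rewrite (eq_bigl (fun b => `[< gsrc b = x >])); last by move=> b; rewrite yx.
  over.
rewrite exchange_big /=; apply: eq_bigr => b /asboolP bx.
rewrite /op mu_sumr; last exact: fac_Vl.
rewrite [RHS](eq_bigl (fun y => `[< gsrc y = x >])); last by move=> y; rewrite bx.
apply: eq_bigr => y /asboolP yx.
have yb : gsrc y = gsrc b by rewrite yx.
have f1 := fac_div yb.
rewrite (sgM _ _ f1 (esym (ginv_div yb)) erefl erefl).
have f2 : fac (ginv b) (gdiv b y) (ginv y).
  by rewrite -(ginv_div yb); split; [rewrite gsrcV grngV gsrc_div|rewrite -ginvM ?gsrc_div// gdivK].
rewrite (muA _ _ _ f2 (fac_div (esym yb)) (fac_Vl yx) (fac_Vl bx)).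
congr (mu _ _ (mu _ _ _)).
by rewrite -(ginv_div yb) sstarE.
Qed.

End HilbertModule.

(** * Operator bounds uniform in the finite lists *)

Section OperatorBound.
Variables (R : realType) (G : etaleGroupoid) (rho : fellBundle R G).
Implicit Types (x y z : G) (F : seq G) (f g h c d e : section rho) (t L M : R).

(** For [0 <= L] this is $\|c\|_{\mathsf b}\le L$ by [normb_le], with rows and columns cut to finite
    lists so that no convergence enters. *)
Definition opbound c L := forall x F F' f, gsrc x = x -> uniq F -> uniq F' ->
  nrm F' x (op F c f) <= L * nrm F x f.

Lemma opboundW c L M : opbound c L -> L <= M -> opbound c M.
Proof.
move=> h LM x F F' f hx uF uF'; apply: le_trans (h _ _ _ _ hx uF uF') _.
by rewrite ler_wpM2r ?nrm_ge0.
Qed.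

Lemma opboundD c d L M : opbound c L -> opbound d M -> opbound (sadd c d) (L + M).
Proof.
move=> hc hd x F F' f hx uF uF'.
rewrite (@eq_nrm _ _ _ _ _ _ (sadd (op F c f) (op F d f))); last by move=> b _ _; rewrite opDl.
rewrite mulrDl; apply: le_trans (nrm_triangle _ _ _ hx) _.
by apply: lerD; [exact: hc|exact: hd].
Qed.

Lemma opboundZ c k L : opbound c L -> opbound (sscale k c) (cabs k * L).
Proof.
move=> hc x F F' f hx uF uF'.
rewrite (@eq_nrm _ _ _ _ _ _ (sscale k (op F c f))); last by move=> b _ _; rewrite opZl.
by rewrite nrmZ -mulrA ler_wpM2l ?cabs_ge0//; exact: hc.
Qed.

(* [coord b] vanishes outside the fibre over [b], so that this section is
   supported at [x]. *)
Definition single x (u : fib rho x) : section rho := fun b => coord b (inj u).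

Lemma single_at x (u : fib rho x) : single u x = u.
Proof. exact: injK. Qed.

Lemma single_out x (u : fib rho x) b : b != x -> single u b = 0.
Proof.
move=> bx; rewrite /single /coord; apply: xgetPN => v vu.
by move: bx; rewrite -(proj_inj v) -(proj_inj u) vu eqxx.
Qed.

Lemma nrm_single x b (u : fib rho b) : gsrc b = x -> nrm [:: b] x (single u) = vabs u.
Proof.
move=> bx; rewrite /nrm /ip big_mkcond big_seq1 asboolT// single_at vabs_sgmu//.
by rewrite sqrtr_sqr ger0_norm ?vabs_ge0.
Qed.

Lemma gdivx1 x y : gsrc x = x -> gsrc y = x -> gdiv y x = y.
Proof. by move=> hx <-; rewrite /gdiv ginv_unit ?gsrc_src// gmulr_src. Qed.

Lemma op_single_unit c x (u : fib rho x) y : gsrc x = x -> gsrc y = x ->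
  op [:: x] c (single u) y = mu y (c y) u.
Proof.
move=> hx yx; rewrite /op big_mkcond big_seq1 asboolT ?hx// single_at.
by rewrite gdivx1.
Qed.

(** The fibre over [x] may have no unit to test on, so the test vector is $q=\langle c,c\rangle$
    placed at [x]. It gives $\|q^3\|\le L^2\|q\|^2$, and $\|q\|^4=\|q^4\|\le\|q^3\|\|q\|$ then
    yields $\|q\|\le L^2$. *)
Lemma opbound_nrm c L F x : 0 <= L -> gsrc x = x -> uniq F -> opbound c L ->
  nrm F x c <= L.
Proof.
move=> L0 hx uF hc; pose q := ip F x c c.
have ix : x = ginv x by rewrite ginv_unit.
have H := fibre_alg rho hx.
have sq : sg x q = q by rewrite ip_star.
have := hc x [:: x] F (single q) hx isT uF; rewrite nrm_single//.
rewrite (@eq_nrm _ _ _ _ _ _ (smulr c q)); last first.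
  by move=> b _ bx; rewrite op_single_unit.
rewrite -ler_sqr ?nnegrE ?mulr_ge0 ?nrm_ge0 ?vabs_ge0// exprMn.
rewrite nrm_sqr ip_mull// ip_mulr// -/q sq => h1.
have h2 : vabs q ^+ 4 <= vabs (mu x q (mu x q q)) * vabs q.
  rewrite -[4%N]/(2 * 2)%N exprM -(vabs_sgmu q ix (esym hx)) sq.
  rewrite -(vabs_sgmu _ ix (esym hx)) (ca_sM H) sq.
  rewrite (ca_A H) mulrC; exact: (ca_M H).
have q0 : 0 <= vabs q := vabs_ge0 q.
rewrite /nrm -/q -(ger0_norm L0) -sqrtr_sqr ler_sqrt ?sqr_ge0//.
have /predU1P[y0|y0] : (0 == vabs q) || (0 < vabs q) by rewrite -le_eqVlt.
  by rewrite -y0 sqr_ge0.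
have h3 : vabs q ^+ 4 <= L ^+ 2 * vabs q ^+ 2 * vabs q.
  by apply: le_trans h2 _; rewrite ler_wpM2r.
rewrite -(ler_pM2r (exprn_gt0 3 y0)) -exprS; apply: le_trans h3 _.
by rewrite -mulrA -exprSr.
Qed.

Lemma opbound_vabs c L y : 0 <= L -> opbound c L -> vabs (c y) <= L.
Proof.
move=> L0 hc; apply: le_trans (opbound_nrm L0 (gsrc_src y) (_ : uniq [:: y]) hc) => //.
by apply: vabs_nrm; rewrite ?gsrc_src ?inE.
Qed.

(** Apply [c] to the vector [sstar c]: the value at [x] is $q=\langle c^*,c^*\rangle$, so $\|q\|\le
    L\|q\|^{1/2}$. *)
Lemma opbound_nrm_star c L F x : 0 <= L -> gsrc x = x -> uniq F -> opbound c L ->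
  nrm F x (sstar c) <= L.
Proof.
move=> L0 hx uF hc; pose q := ip F x (sstar c) (sstar c).
have : vabs q <= L * nrm F x (sstar c).
  apply: le_trans (hc x F [:: x] (sstar c) hx uF isT).
  apply: le_trans (vabs_nrm _ hx _ (mem_head _ _) hx) => //.
  rewrite (_ : op F c (sstar c) x = q)//.
  rewrite /op /q /ip hx; apply: eq_bigr => b /asboolP bx.
  have -> : gdiv x b = ginv b by rewrite /gdiv -bx -grngV gmull_rng.
  by rewrite -(sstarE (sstar c)) sstarK.
have := nrm_ge0 F x (sstar c); have := nrm_sqr F x (sstar c); rewrite -/q.
move: (nrm _ _ _) => r; nra.
Qed.

Lemma nrm_restr0 (D : set G) F x f : gsrc x = x -> nrm F x (restr0 D f) <= nrm F x f.
Proof.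
move=> hx; rewrite /nrm ler_sqrt ?vabs_ge0//.
have -> : ip F x f f = ip F x (restr0 D f) (restr0 D f) +
    ip F x (restr0 (~` D) f) (restr0 (~` D) f).
  rewrite /ip -big_split; apply: eq_bigr => b /asboolP bx /=; rewrite /restr0.
  case: (asboolP (D b)) => h.
    by rewrite (asboolF (_ : ~ (~` D) b)) ?(mu0r _ (fac_Vl bx)) ?addr0//; apply.
  by rewrite asboolT// (mu0r _ (fac_Vl bx)) add0r.
by apply: fpos_le; exact: fpos_ip.
Qed.

(* The restriction of a section to the arrows with source in [Y] acts as the
   section itself after compressing to the arrows with range in [Y]. *)
Lemma opbound_restr c d (Y : set G) L : 0 <= L -> opbound c L ->
  (forall y, Y (gsrc y) -> d y = c y) -> (forall y, ~ Y (gsrc y) -> d y = 0) ->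
  opbound d L.
Proof.
move=> L0 hc d1 d0 x F F' f hx uF uF'.
pose f1 : section rho := restr0 (@grng G @^-1` Y) f.
rewrite (@eq_nrm _ _ _ _ _ _ (op F c f1)); last first.
  move=> y _ yx; apply: eq_bigr => b /asboolP bx.
  rewrite /f1 /restr0; case: asboolP => h; first by rewrite d1// gsrc_div.
  by rewrite d0 ?gsrc_div// mu0l ?mu0r//; exact: fac_div.
apply: le_trans (hc _ _ _ _ hx uF uF') _; rewrite ler_wpM2l//.
exact: nrm_restr0.
Qed.

Lemma op_comp F F' c d e f y :
  (forall b, b \in F -> gsrc b = gsrc y -> e (gdiv y b) =
    \sum_(z <- F' | `[< gsrc z = gsrc y >]) mu (gdiv y b) (c (gdiv y z)) (d (gdiv z b))) ->
  op F' c (op F d f) y = op F e f y.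
Proof.
move=> h; rewrite /op; under eq_bigr => z /asboolP zy.
  rewrite mu_sumr; last exact: fac_div.
  rewrite (eq_bigl (fun b => `[< gsrc b = gsrc y >])); last by move=> b; rewrite zy.
  over.
rewrite exchange_big /= [LHS]big_seq_cond [RHS]big_seq_cond.
apply: eq_bigr => b /andP[bF /asboolP bx]; rewrite h// mu_suml; last exact: fac_div.
apply: eq_bigr => z /asboolP zy.
rewrite (muA _ _ _ _ (fac_div (_ : gsrc z = gsrc b)) (fac_div (esym bx)) (fac_div (esym zy))) ?zy ?bx//.
by split; [rewrite gsrc_div ?grng_div// zy bx|apply: gdiv_div; rewrite ?zy bx].
Qed.

End OperatorBound.

(** * Convolution, the norms of the statement and the big C*-algebra *)

Section Convolution.
Variables (R : realType) (G : etaleGroupoid) (rho : fellBundle R G).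
Implicit Types (x y z : G) (F : seq G) (f g h c d e : section rho) (t L M : R).

Lemma factorsP y (p : G * G) :
  factors y p <-> gsrc p.2 = gsrc y /\ p.1 = gdiv y p.2.
Proof.
case: p => p q /=; split=> [[/= pq <-]|[qy ->]].
  by rewrite gsrcM// gmulK.
by split; [rewrite /composable /= gsrc_div|rewrite /= gdivK].
Qed.

Lemma conv_partial_op c d y (A : {fset G * G}) : exists A' : seq G,
  [/\ uniq A', forall b, gsrc b = gsrc y -> (gdiv y b, b) \in A -> b \in A' &
    conv_partial c d y A = op A' c d y].
Proof.
exists [seq p.2 | p <- enum_fset A & `[< factors y p >]]; split.
- rewrite map_inj_in_uniq ?filter_uniq ?fset_uniq// => p q.
  rewrite !mem_filter => /andP[/asboolP/factorsP[_ p1] _] /andP[/asboolP/factorsP[_ q1] _].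
  by case: p q p1 q1 => [? ?] [? ?] /= -> -> ->.
- move=> b by_ bA; apply/mapP; exists (gdiv y b, b) => //=.
  by rewrite mem_filter bA andbT; apply/asboolP/factorsP.
- rewrite /conv_partial /op big_map big_filter_cond.
  apply: eq_big => [p|p /asboolP/factorsP[_ ->]//].
  apply/idP/andP => [/asboolP h|[]//]; split; apply/asboolP => //.
  by have /factorsP[] := h.
Qed.

Lemma conv_partial_fin c d y F (A : {fset G * G}) : uniq F ->
  (forall b, gsrc b = gsrc y -> c (gdiv y b) != 0 -> d b != 0 -> b \in F) ->
  (forall b, b \in F -> (gdiv y b, b) \in A) ->
  conv_partial c d y A = op F c d y.
Proof.
move=> uF hF FA; have [A' [uA' hA' ->]] := conv_partial_op c d y A.
apply: op_extend => // b bF by_ cb db; first by apply: hA' => //; exact: FA.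
exact: hF.
Qed.

(** The partial sums are constant once they include all pairs coming from [F], so the limit along
    [totally] is that constant. *)
Lemma conv_op c d y F : uniq F ->
  (forall b, gsrc b = gsrc y -> c (gdiv y b) != 0 -> d b != 0 -> b \in F) ->
  conv c d y = op F c d y.
Proof.
move=> uF hF; rewrite /conv; have H : \forall A \near totally, conv_partial c d y A = op F c d y.
  exists [fset (gdiv y b, b) | b in F]%fset => // A /= FA.
  apply: conv_partial_fin => // b bF; apply: (fsubsetP FA).
  by apply/imfsetP; exists b.
exact: (@lim_near_cst (fib rho y) (@norm_hausdorff _ (fib rho y)) _ totally (@totally_filter _) _ _ H).
Qed.

Lemma fin_supp_seq f : fin_supp f ->
  exists2 F, uniq F & forall b, f b != 0 -> b \in F.
Proof.
move=> /finite_seqP[s hs]; exists (undup s); first exact: undup_uniq.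
move=> b fb; rewrite mem_undup; have : supp f b by [].
by rewrite hs.
Qed.

Lemma norm2_ge0 f : (0 <= norm2 f)%E.
Proof. by rewrite /norm2 le_max lexx. Qed.

Lemma norm2_le f M : 0 <= M -> (norm2 f <= M%:E)%E <->
  (forall x F, gsrc x = x -> uniq F -> nrm F x f <= M).
Proof.
move=> M0; rewrite /norm2 ge_max lee_fin M0 /=; split.
  move=> /ereal_supP h x F hx uF.
  pose A := [fset b | b in F & `[< gsrc b = x >]]%fset.
  rewrite -lee_fin; apply: h; exists x, A; split; first exact/unitsP.
    by move=> b /=; rewrite !inE => /andP[_ /asboolP].
  congr (Num.sqrt (complex.Re `|_|))%:E; rewrite /ip.
  transitivity (\sum_(b <- enum_fset A) mu x (sg (ginv b) (f b)) (f b)); last first.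
    by apply: eq_bigr => b _; rewrite /mu inj_sg.
  rewrite -big_filter; apply: perm_big; apply: uniq_perm.
  - by rewrite filter_uniq.
  - exact: fset_uniq.
  - by move=> b; rewrite mem_filter !inE andbC.
move=> h; apply/ereal_supP => _ [x [A [/unitsP hx Ax ->]]].
rewrite lee_fin; apply: le_trans (h x (enum_fset A) hx (fset_uniq A)).
rewrite /nrm /ip le_eqVlt; apply/orP; left; apply/eqP.
congr (Num.sqrt (complex.Re `|_|)); rewrite big_seq [RHS]big_seq_cond.
apply: eq_big => [b|b _]; last by rewrite /mu inj_sg.
by case bA : (b \in _) => //=; rewrite asboolT//; apply: Ax.
Qed.

Lemma nrm_le_supp F F' x f : gsrc x = x -> uniq F -> uniq F' ->
  (forall b, gsrc b = x -> f b != 0 -> b \in F) -> nrm F' x f <= nrm F x f.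
Proof.
move=> hx uF uF' h.
rewrite (@nrm_extend _ _ _ F (undup (F' ++ F)))//; last 3 first.
- exact: undup_uniq.
- by move=> b _; exact: h.
- by move=> b bF _ _; rewrite mem_undup mem_cat bF orbT.
apply: nrm_subset => //; first exact: undup_uniq.
by move=> b bF; rewrite mem_undup mem_cat bF.
Qed.

Lemma nrm_nil x f : nrm [::] x f = 0.
Proof. by rewrite /nrm /ip big_nil vabs0 sqrtr0. Qed.

Lemma norm2_fin f : fin_supp f -> exists2 M, 0 <= M & norm2 f = M%:E.
Proof.
move=> /fin_supp_seq[F uF hF].
have [M M0 hM] : exists2 M : R, 0 <= M & (norm2 f <= M%:E)%E.
  pose M := \sum_(b <- F) nrm F (gsrc b) f.
  have M0 : 0 <= M by apply: sumr_ge0 => b _; exact: nrm_ge0.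
  exists M => //; apply/norm2_le => // x F' hx uF'.
  have [/hasP[b bF /eqP bx]|/hasPn noF] := boolP (has (fun b => gsrc b == x) F).
    apply: (@le_trans _ _ (nrm F x f)); first by apply: nrm_le_supp => // b' _ /hF.
    by rewrite /M (big_rem b bF) /= bx lerDl; apply: sumr_ge0 => ? _; exact: nrm_ge0.
  rewrite (le_trans _ M0)// -(nrm_nil x f); apply: nrm_le_supp => // b bx /hF /noF.
  by rewrite bx eqxx.
have := norm2_ge0 f; case: (norm2 f) hM => //= r; rewrite !lee_fin => _ r0.
by exists r.
Qed.

Lemma normb_le c L : 0 <= L -> (normb c <= L%:E)%E <-> opbound c L.
Proof.
move=> L0; split.
  move=> /ereal_supP hc x F F' f hx uF uF'.
  (* Cutting [f] to one source fibre makes [norm2 f'] at most [nrm F x f], so the supremum over all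
     units does no harm. *)
  pose f' := restr0 [set b | b \in F /\ gsrc b = x] f.
  have ff : fin_supp f'.
    apply: (@sub_finite_set _ _ [set` F]); last by apply/finite_seqP; exists F.
    by move=> b; rewrite /supp /f' /restr0 /=; case: asboolP => [[]|]; rewrite ?eqxx.
  have f'E b : b \in F -> gsrc b = x -> f b = f' b.
    by move=> bF bx; rewrite /f' /restr0 asboolT.
  have f'0 b : f' b != 0 -> b \in F /\ gsrc b = x.
    by rewrite /f' /restr0; case: asboolP => // _; rewrite eqxx.
  have [M M0 nM] := norm2_fin ff.
  have MF : M <= nrm F x f.
    rewrite -lee_fin -nM; apply/norm2_le; first exact: nrm_ge0.
    move=> z A hz uA; have [zx|zx] := eqVneq z x.
      rewrite zx (@eq_nrm _ _ _ F x _ f')//.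
      by apply: nrm_le_supp => // b _ /f'0[].
    rewrite (le_trans _ (nrm_ge0 _ _ _))// -(nrm_nil z f').
    apply: nrm_le_supp => // b bz /f'0[_ bx].
    by move: zx; rewrite -bz bx eqxx.
  have := hc _ (ex_intro2 _ _ f' ff erefl); rewrite nM => h.
  have : (norm2 (conv c f') <= (L * M)%:E)%E.
    move: h; have := norm2_ge0 (conv c f'); rewrite inver.
    (* For a zero denominator the quotient is 0 or [+oo], so a finite bound forces the numerator to
       vanish. *)
    case: eqP => [M00|/eqP M00].
      rewrite le_eqVlt => /predU1P[<- _|a0]; first by rewrite lee_fin mulr_ge0.
      by rewrite gt0_muley.
    have {}M0 : 0 < M by rewrite lt_def M00.
    by move=> _; rewrite lee_pdivrMr.
  move=> /norm2_le; rewrite mulr_ge0// => /(_ isT) /(_ x F' hx uF') h'.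
  apply: le_trans (_ : L * M <= _); last by rewrite ler_wpM2l.
  apply: le_trans h'; rewrite (@eq_nrm _ _ _ _ _ _ (conv c f'))// => y _ yx.
  rewrite (@conv_op _ _ _ F)//; last by move=> b _ _ /f'0[].
  by apply: eq_op => // b bF; rewrite yx; exact: f'E.
move=> hc; apply/ereal_supP => _ [f ff <-].
have [M M0 nM] := norm2_fin ff; rewrite nM.
have [F uF hF] := fin_supp_seq ff.
have h : (norm2 (conv c f) <= (L * M)%:E)%E.
  apply/norm2_le; first by rewrite mulr_ge0.
  move=> x F' hx uF'; rewrite (@eq_nrm _ _ _ _ _ _ (op F c f)); last first.
    by move=> b _ bx; apply: conv_op => // b' _ _ /hF.
  apply: le_trans (hc x F F' f hx uF uF') _; rewrite ler_wpM2l//.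
  by move: x F hx uF {hF}; apply/norm2_le => //; rewrite nM.
have := norm2_ge0 (conv c f).
case: (norm2 _) h => // r; rewrite !lee_fin => rLM r0.
rewrite inver; case: eqP => [M00|/eqP M00].
  have -> : r = 0 by move: rLM; rewrite M00 mulr0; lra.
  by rewrite mul0e lee_fin.
by rewrite -EFinM lee_fin ler_pdivrMr// lt_def M00.
Qed.

Lemma conv_partial_split c d y F (A : {fset G * G}) : uniq F ->
  (forall b, b \in F -> (gdiv y b, b) \in A) ->
  exists D, [/\ uniq D, {in D, forall b, b \notin F} &
    conv_partial c d y A = op F c d y + op D c d y].
Proof.
move=> uF FA; have [A' [uA' hA' ->]] := conv_partial_op c d y A.
exists [seq b <- A' | b \notin F]; split; first by rewrite filter_uniq.
  by move=> b; rewrite mem_filter => /andP[].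
rewrite /op (bigID (mem F)) /=; congr (_ + _); last first.
  by rewrite big_filter_cond; apply: eq_bigl => b; rewrite andbC.
under eq_bigl do rewrite andbC.
rewrite -big_filter_cond -[LHS]big_filter -[RHS]big_filter; apply: perm_big.
rewrite uniq_perm ?filter_uniq// => b; rewrite !mem_filter.
by case: asboolP => //= by_; apply: andb_idr => bF; apply: hA' => //; exact: FA.
Qed.

(** Once a partial sum contains the terms of [F], the remainder is [op D c d y] with [D] disjoint
    from [F], which is small by the two hypotheses; completeness of the fibre concludes. *)
Lemma conv_cvg c d y M : 0 <= M ->
  (forall D, uniq D -> vabs (op D c d y) <= M * nrm D (gsrc y) d) ->
  (forall t, 0 < t -> exists2 F, uniq F & forall D, uniq D ->
     {in D, forall b, b \notin F} -> nrm D (gsrc y) d <= t) ->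
  cvg (conv_partial c d y @ totally).
Proof.
move=> M0 hM htail; have PF := fmap_proper_filter (conv_partial c d y) (@totally_filter (G * G)%type).
apply: cauchy_cvg; apply: cauchy_exP => eps eps0.
have re : (complex.Re eps)%:C = eps by rewrite RRe_real// gtr0_real.
have e0 : 0 < complex.Re eps by rewrite -ltcR re.
have [|F uF hF] := htail (complex.Re eps / (M + 1)); first by rewrite divr_gt0//; lra.
exists (op F c d y); exists [fset (gdiv y b, b) | b in F]%fset => // A /= FA.
have [|D [uD DF ->]] := @conv_partial_split c d y F A uF.
  by move=> b bF; apply: (fsubsetP FA); apply/imfsetP; exists b.
rewrite -ball_normE /= opprD addNKr normrN -vabsE -re ltcR.
have := hM D uD; have := hF D uD DF; rewrite ler_pdivlMr; last by lra.
by have := nrm_ge0 D (gsrc y) d; nra.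
Qed.

Definition colfin d := forall x, exists2 F, uniq F &
  forall b, gsrc b = x -> d b != 0 -> b \in F.

Definition rowcolfin d := colfin d /\ colfin (sstar d).

(** Duality: pair the value [z] with itself, move [c] to the other side by [ip_adj], and apply
    Cauchy-Schwarz. *)
Lemma op_sstar_bound c d D y L : 0 <= L -> uniq D -> opbound c L ->
  vabs (op D (sstar c) d y) <= L * nrm D (gsrc y) d.
Proof.
move=> L0 uD hc; set z := op _ _ _ _; have hx := gsrc_src y.
have := ip_adj [:: y] D (gsrc y) c (single z) d.
have -> : ip [:: y] (gsrc y) (single z) (op D (sstar c) d) =
    mu (gsrc y) (sg (ginv y) z) z.
  by rewrite /ip big_mkcond big_seq1 asboolT// single_at.
move/(congr1 (@vabs _ _)); rewrite vabs_sgmu// => h.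
have := cauchy_schwarz D (op [:: y] c (single z)) d hx; rewrite h.
have := hc (gsrc y) [:: y] D (single z) hx isT uD; rewrite nrm_single//.
have := vabs_ge0 z; have := nrm_ge0 D (gsrc y) d.
move: (vabs z) (nrm D _ d) (nrm D _ (op _ _ _)) => r s p s0 r0 h1 h2.
have /predU1P[y0|y0] : (0 == r) || (0 < r) by rewrite -le_eqVlt.
  by rewrite -y0 mulr_ge0.
rewrite -(ler_pM2l y0) -expr2; apply: (le_trans h2).
by rewrite mulrA (mulrC r) ler_wpM2r.
Qed.

Lemma op_bound c d D y L : 0 <= L -> uniq D -> opbound c L ->
  vabs (op D c d y) <= L * nrm D (gsrc y) d.
Proof.
move=> L0 uD hc; have hx := gsrc_src y.
apply: le_trans (hc (gsrc y) D [:: y] d hx uD isT).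
by apply: vabs_nrm => //; rewrite ?inE.
Qed.

Lemma ssub_sstar c d y : sstar (ssub c d) y = sstar c y - sstar d y.
Proof.
rewrite -(ginvK y) !sstarE sgD//; congr (_ + _).
by rewrite -scaleN1r sgZ// rmorphN rmorph1 scaleN1r.
Qed.

(** Off the finitely many arrows where [d] lives in a given fibre, [c] equals [ssub c d], so the
    tail of its column has norm at most [t] by [opbound_nrm]. The tails of rows are treated by
    [opbound_nrm_star]. *)
Lemma bigB_approx c L : 0 <= L -> opbound c L ->
  (forall t, 0 < t -> exists2 d, rowcolfin d & opbound (ssub c d) t) -> bigB c.
Proof.
move=> L0 hc happ; split.
- by apply: (@le_lt_trans _ _ L%:E); [apply/normb_le|rewrite ltry].
- move=> y; apply: (conv_cvg L0) => [D uD|t t0]; first exact: op_sstar_bound.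
  have [d [/(_ (gsrc y))[F uF hF] _] hd] := happ t t0; exists F => // D uD DF.
  rewrite (@eq_nrm _ _ _ _ _ _ (ssub c d)).
    by apply: opbound_nrm => //; [exact: ltW|exact: gsrc_src].
  move=> b bD bx; rewrite /ssub; suff -> : d b = 0 by rewrite subr0.
  by apply/eqP; apply: contraTT bD => db; apply: contraL (hF b bx db); exact: DF.
- move=> y; apply: (conv_cvg L0) => [D uD|t t0]; first exact: op_bound.
  have [d [_ /(_ (gsrc y))[F uF hF]] hd] := happ t t0; exists F => // D uD DF.
  rewrite (@eq_nrm _ _ _ _ _ _ (sstar (ssub c d))).
    by apply: opbound_nrm_star => //; [exact: ltW|exact: gsrc_src].
  move=> b bD bx; rewrite ssub_sstar; suff -> : sstar d b = 0 by rewrite subr0.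
  by apply/eqP; apply: contraTT bD => db; apply: contraL (hF b bx db); exact: DF.
Qed.

End Convolution.

(** * Meagre sets and etale groupoids *)

Section Meagre.
Variable T : topologicalType.
Implicit Types A B U V W : set T.

Lemma nowhere_denseP A : nowhere_dense A <->
  (forall V, open V -> V !=set0 ->
    exists W, [/\ open W, W !=set0, W `<=` V & W `&` A = set0]).
Proof.
split=> [ndA V oV [x Vx]|h].
  have [VA|] := pselect (V `<=` closure A).
    have : (closure A)° x by move: VA; rewrite open_subsetE //; exact.
    by rewrite ndA.
  move=> /existsNP[y /not_implyP[Vy nAy]].
  exists (V `&` ~` closure A); split.
  - by apply: openI => //; apply: closed_openC; exact: closed_closure.
  - by exists y.
  - by move=> z [].
  - by rewrite -subset0 => z [[_ +] Az]; apply; exact: subset_closure.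
rewrite /nowhere_dense -subset0 => x Ax.
have [|W [oW [y Wy] WA W0]] := h (closure A)° (@open_interior _ _); first by exists x.
have /interior_subset Ay := WA y Wy.
have [z [Az Wz]] := Ay W (open_nbhs_nbhs (conj oW Wy)).
by have : (W `&` A) z by []; rewrite W0.
Qed.

Lemma nowhere_dense_sub A B : A `<=` B -> nowhere_dense B -> nowhere_dense A.
Proof.
move=> AB /nowhere_denseP h; apply/nowhere_denseP => V oV V0.
have [W [oW W0 WV WB]] := h V oV V0; exists W; split=> //.
by rewrite -subset0 -WB => x [Wx Ax]; split=> //; exact: AB.
Qed.

Lemma nowhere_denseU A B : nowhere_dense A -> nowhere_dense B -> nowhere_dense (A `|` B).
Proof.
move=> /nowhere_denseP hA /nowhere_denseP hB; apply/nowhere_denseP => V oV V0.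
have [W [oW W0 WV WA]] := hA V oV V0; have [W' [oW' W'0 W'W W'B]] := hB W oW W0.
exists W'; split => //; first by apply: subset_trans W'W WV.
rewrite setIUr W'B setU0 -subset0 -WA => x [W'x Ax]; split => //; exact: W'W.
Qed.

Lemma nowhere_dense0 : nowhere_dense (@set0 T).
Proof. by rewrite /nowhere_dense closure0 interior0. Qed.

Lemma nowhere_dense_frontier U : open U -> nowhere_dense (closure U `\` U).
Proof.
move=> oU; apply/nowhere_denseP => V oV [x Vx].
have [[y [Uy Vy]]|VU] := pselect ((U `&` V) !=set0).
  exists (U `&` V); split; [exact: openI|by exists y|by move=> ? []|].
  by rewrite -subset0 => z [[Uz _] [_ /(_ Uz)]].
exists V; split => //; first by exists x.
rewrite -subset0 => z [Vz [cUz _]]; apply: VU.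
exact: cUz (open_nbhs_nbhs (conj oV Vz)).
Qed.

Lemma meagre_sub A B : A `<=` B -> meagre B -> meagre A.
Proof.
move=> AB [N hN BN]; exists (fun n => N n `&` A).
  by move=> n; apply: nowhere_dense_sub (hN n) => x [].
rewrite -setI_bigcupl -BN; apply/seteqP; split=> [x Ax|x []//].
by split => //; exact: AB.
Qed.

Lemma meagre_nd A : nowhere_dense A -> meagre A.
Proof.
move=> h; exists (fun _ => A) => //; apply/seteqP; split=> [x Ax|x [_ _]//].
by exists 0%N.
Qed.

Lemma meagre0 : meagre (@set0 T).
Proof. exact: meagre_nd nowhere_dense0. Qed.

Lemma meagre_bigcup (A : nat -> set T) : (forall n, meagre (A n)) -> meagre (\bigcup_n A n).
Proof.
move=> h.
have /choice[N hN] : forall n, exists N : nat -> set T,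
    (forall m, nowhere_dense (N m)) /\ A n = \bigcup_m N m.
  by move=> n; have [N h1 h2] := h n; exists N.
exists (fun k => if (choice.unpickle k : option (nat * nat)) is Some nm then N nm.1 nm.2 else set0).
  move=> k; case: (choice.unpickle k) => [nm|]; last exact: nowhere_dense0.
  by have [] := hN nm.1.
apply/seteqP; split=> [x [n _]|x [k _]].
  have [_ ->] := hN n => -[m _ Nx].
  by exists (choice.pickle (n, m)) => //; rewrite choice.pickleK.
case: (choice.unpickle k) => [nm|//] Nx; exists nm.1 => //.
by have [_ ->] := hN nm.1; exists nm.2.
Qed.

Lemma meagre_countable_bigcup (I : countType) (A : I -> set T) :
  (forall i, meagre (A i)) -> meagre (\bigcup_i A i).
Proof.
move=> h; pose A' k := if (choice.unpickle k : option I) is Some i then A i else set0.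
apply: (@meagre_sub _ (\bigcup_k A' k)).
  by move=> x [i _ Ax]; exists (choice.pickle i) => //; rewrite /A' choice.pickleK.
apply: meagre_bigcup => k; rewrite /A'; case: (choice.unpickle k) => [i|]; [exact: h|exact: meagre0].
Qed.

Lemma meagreU A B : meagre A -> meagre B -> meagre (A `|` B).
Proof.
move=> hA hB; apply: (@meagre_sub _ (\bigcup_(b in [set: bool]) if b then A else B)).
  by move=> x [Ax|Bx]; [exists true|exists false].
by apply: meagre_countable_bigcup => -[].
Qed.

(* Banach category theorem: a maximal disjoint family of meagre open sets
   can be made meagre levelwise, and it is dense in the union. *)
Theorem meagre_open_bigcup : meagre (\bigcup_(U in [set U : set T | open U /\ meagre U]) U).
Proof.
set D := [set U : set T | _].
have [E [ED tE maxE]] := ex_maximal_disjoint_subcollection (@id (set T)) D.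
have /choice[N hN] : forall U, exists N : nat -> set T, E U ->
    (forall m, nowhere_dense (N m)) /\ U = \bigcup_m N m.
  move=> U; have [/ED[_ [N h1 h2]]|nE] := pselect (E U); first by exists N.
  by exists (fun _ => set0).
have NU U n : E U -> N U n `<=` U.
  by move=> /hN[_ UN] x Nx; rewrite UN; exists n.
pose Z := \bigcup_(U in D) U `\` \bigcup_(U in E) U.
apply: (@meagre_sub _ ((\bigcup_n \bigcup_(U in E) N U n) `|` Z)).
  move=> x Dx; have [[U EU Ux]|] := pselect ((\bigcup_(U in E) U) x); last by right.
  by left; have [_ UN] := hN U EU; move: Ux; rewrite UN => -[n _ Nx]; exists n => //; exists U.
have oE : open (\bigcup_(U in E) U) by apply: bigcup_open => U /ED[].
apply: meagreU.
  (* At a fixed level [n], an open [V] meeting some [U] in [E] is shrunk into that [U]; by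
     disjointness only the single set [N U n] has to be avoided there. *)
  apply: meagre_bigcup => n; apply: meagre_nd; apply/nowhere_denseP => V oV [x Vx].
  have [[y [Vy [U EU Uy]]]|VE] := pselect ((V `&` \bigcup_(U in E) U) !=set0).
    have [oU _] := ED _ EU; have [/(_ n)/nowhere_denseP h _] := hN U EU.
    have [|W [oW W0 WV WN]] := h (V `&` U) (openI oV oU); first by exists y.
    exists W; split => //; first by move=> z /WV[].
    rewrite -subset0 => z [Wz [U' EU' Nz]].
    have UU' : U' = U.
      by apply: tE => //; exists z; split; [exact: (NU _ n)|have [] := WV z Wz].
    suff : (W `&` N U n) z by rewrite WN.
    by split => //; rewrite -UU'.
  exists V; split => //; first by exists x.
  rewrite -subset0 => z [Vz [U EU Nz]]; apply: VE; exists z; split => //.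
  by exists U => //; exact: NU Nz.
apply: meagre_nd; apply/nowhere_denseP => V oV [x Vx].
have [[y [Vy Ey]]|VE] := pselect ((V `&` \bigcup_(U in E) U) !=set0).
  exists (V `&` \bigcup_(U in E) U); split; [exact: openI|by exists y|by move=> ? []|].
  by rewrite -subset0 => z [[_ Ez] [_ /(_ Ez)]].
have [[y [Vy [[U [oU mU] Uy] nEy]]]|VZ] := pselect ((V `&` Z) !=set0); last first.
  exists V; split => //; first by exists x.
  by rewrite -subset0 => z Vz; apply: VZ; exists z.
(* Here [V] misses the union of [E] but meets a meagre open [U], so their intersection would enlarge
   the maximal family. *)
exfalso; apply: (maxE (E `|` [set V `&` U])).
- split; first by move=> z Ez; left.
  move=> /(_ (V `&` U)) h; apply: VE; exists y; split => //.
  by exists (V `&` U) => //; apply: h; right.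
- move=> _ [/ED//|->]; split; first exact: openI.
  by apply: meagre_sub mU => z [].
- have VUE B z : E B -> (V `&` U) z -> B z -> False.
    by move=> EB [Vz _] Bz; apply: VE; exists z; split => //; exists B.
  move=> B C [EB|->] [EC|->] // [z [Bz Cz]].
  + by apply: tE => //; exists z.
  + by have := VUE _ _ EB Cz Bz.
  + by have := VUE _ _ EC Bz Cz.
Qed.

End Meagre.

Lemma within_comp_cvg (X Y Z : topologicalType) (A : set Y) (f : Y -> Z) (g : X -> Y) (x : X) :
  {within A, continuous f} -> A (g x) -> {for x, continuous g} ->
  (\forall x' \near x, A (g x')) -> {for x, continuous (f \o g)}.
Proof.
move=> /subspace_continuousP cf Agx cg nA W /= nW.
have := cf _ Agx W nW; rewrite /nbhs /= /within /= => h.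
have h' := cg _ h; near=> x'.
have : A (g x') -> W (f (g x')) by near: x'; exact: h'.
by apply; near: x'.
Unshelve. all: by end_near. Qed.

(** * Etale groupoids: open slices, bicompact sets, transport of meagre sets *)

Section Etale.
Variable G : etaleGroupoid.
Implicit Types (x y z : G) (A B K L O U V W : set G).

Lemma gsrc_continuous : continuous (@gsrc G).
Proof.
move=> x; apply: (@within_comp_cvg G (G * G)%type G (composable G)
  (fun p => gmul p.1 p.2) (fun x => (ginv x, x))).
- exact: gmul_continuous.
- by rewrite /composable /= gsrcV.
- by apply: cvg_pair; [exact: ginv_continuous|exact: cvg_id].
- by near=> y; rewrite /composable /= gsrcV.
Unshelve. all: by end_near. Qed.

Lemma grngE : @grng G = @gsrc G \o @ginv G.
Proof. by apply/funext => x /=; rewrite gsrcV. Qed.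

Lemma grng_continuous : continuous (@grng G).
Proof.
move=> x; rewrite grngE; apply: continuous_comp; first exact: ginv_continuous.
exact: gsrc_continuous.
Qed.

Lemma gmul_nbhs x y W : gsrc x = grng y -> nbhs (gmul x y) W ->
  exists U V, [/\ nbhs x U, nbhs y V &
    forall x' y', U x' -> V y' -> gsrc x' = grng y' -> W (gmul x' y')].
Proof.
move=> xy nW; have /subspace_continuousP/(_ (x, y) xy W nW) := @gmul_continuous G.
rewrite /nbhs /= /within /= => -[[U V] [/= nU nV] h].
by exists U, V; split => // x' y' Ux' Vy' xy'; apply: (h (x', y')).
Qed.

Lemma open_gsrc_image U : open U -> open (@gsrc G @` U).
Proof. exact: gsrc_open. Qed.

Lemma image_ginv A : @ginv G @` A = @ginv G @^-1` A.
Proof.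
apply/seteqP; split=> [_ [x Ax <-]|x Ax] /=; first by rewrite (ginvK x).
by exists (ginv x) => //; exact: ginvK.
Qed.

Lemma open_ginv U : open U -> open (@ginv G @` U).
Proof. by move=> oU; rewrite image_ginv; move/continuousP: (@ginv_continuous G); apply. Qed.

Lemma open_units : open (units G).
Proof. exact/open_gsrc_image/openT. Qed.

Definition ginv_set A : set G := @ginv G @` A.

Lemma gsrc_ginv_set A : @gsrc G @` ginv_set A = @grng G @` A.
Proof. by rewrite /ginv_set image_comp -grngE. Qed.

Lemma grng_ginv_set A : @grng G @` ginv_set A = @gsrc G @` A.
Proof.
rewrite /ginv_set image_comp; apply: eq_imagel => x _ /=; exact: grngV.
Qed.

Lemma ginv_setE A x : ginv_set A x <-> A (ginv x).
Proof. by rewrite /ginv_set image_ginv. Qed.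

Lemma ginv_slice A : slice A -> slice (ginv_set A).
Proof.
move=> [h1 h2]; split=> x y; rewrite !inE => /ginv_setE Ax /ginv_setE Ay.
  rewrite -!grngV => e; rewrite -(ginvK x) -(ginvK y); congr ginv.
  by apply: h2; rewrite ?inE.
rewrite -!gsrcV => e; rewrite -(ginvK x) -(ginvK y); congr ginv.
by apply: h1; rewrite ?inE.
Qed.

Lemma slice_src O x y : slice O -> O x -> O y -> gsrc x = gsrc y -> x = y.
Proof. by move=> [h _] Ox Oy; apply: h; rewrite inE. Qed.

Lemma slice_rng O x y : slice O -> O x -> O y -> grng x = grng y -> x = y.
Proof. by move=> [_ h] Ox Oy; apply: h; rewrite inE. Qed.

(** On an open slice the source map is injective and open, so closeness to [x] can be tested on
    sources. *)
Lemma slice_src_nbhs O x W : open O -> slice O -> O x -> nbhs x W ->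
  exists2 V, nbhs (gsrc x) V & forall x', O x' -> V (gsrc x') -> W x'.
Proof.
move=> oO sO Ox; rewrite nbhsE => -[U [oU Ux] UW].
exists (@gsrc G @` (U `&` O)).
  apply: open_nbhs_nbhs; split; first exact: open_gsrc_image (openI oU oO).
  by exists x.
move=> x' Ox' [z [Uz Oz] zx']; apply: UW.
by rewrite (slice_src sO Ox' Oz).
Qed.

Definition gprod A B : set G :=
  [set z | exists x y, [/\ A x, B y, gsrc x = grng y & z = gmul x y]].

Lemma ginv_gprod A B : ginv_set (gprod A B) = gprod (ginv_set B) (ginv_set A).
Proof.
apply/seteqP; split=> [_ [_ [x [y [Ax By xy ->]]] <-]|_ [_ [_ [[y By <-] [x Ax <-] xy ->]]]].
  exists (ginv y), (ginv x); split; [by exists y|by exists x| |exact: ginvM].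
  by rewrite gsrcV grngV.
rewrite gsrcV grngV in xy; exists (gmul x y); last exact: ginvM.
by exists x, y.
Qed.

(** For [z] near $xy$, openness of the source map provides [y'] near [y] with the source of [z];
    then $zy'^{-1}$ is near [x], hence in [A]. *)
Lemma gprod_open A B : open A -> open B -> open (gprod A B).
Proof.
move=> oA oB; rewrite openE => _ [x [y [Ax By xy ->]]].
have e1 : gsrc (gmul x y) = grng (ginv y) by rewrite gsrcM// grngV.
have nA : nbhs (gmul (gmul x y) (ginv y)) A.
  by rewrite -/(gdiv _ _) gmulK//; exact: open_nbhs_nbhs.
have [U [V [nU nV h]]] := gmul_nbhs e1 nA.
have nV' : nbhs y (@ginv G @^-1` V `&` B).
  by apply: filterI; [exact: ginv_continuous|exact: open_nbhs_nbhs].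
move: nV'; rewrite nbhsE => -[B' [oB' B'y] B'V].
have nU' : nbhs (gmul x y) (U `&` @gsrc G @^-1` (@gsrc G @` B')).
  apply: filterI => //; apply: gsrc_continuous; apply: open_nbhs_nbhs; split.
    exact: open_gsrc_image.
  by exists y => //; rewrite gsrcM.
apply: filterS nU' => z [Uz [y' B'y' y'z]]; have [Vy' By'] := B'V _ B'y'.
exists (gdiv z y'), y'; split => //; last by rewrite gdivK.
  by apply: h => //; rewrite grngV.
by rewrite gsrc_div.
Qed.

Lemma gprod_slice A B : slice A -> slice B -> slice (gprod A B).
Proof.
move=> sA sB; split=> z z'; rewrite !inE;
  move=> [x [y [Ax By xy ->]]] [x' [y' [Ax' By' xy' ->]]].
  rewrite !gsrcM// => e; have yy := slice_src sB By By' e.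
  by rewrite -yy in xy' *; rewrite (slice_src sA Ax Ax')// xy xy'.
rewrite !grngM// => e; have xx := slice_rng sA Ax Ax' e.
by rewrite -xx in xy' *; rewrite (slice_rng sB By By')// -xy -xy'.
Qed.

Lemma closed_in_unitsP A : closed_in_units A <-> A `<=` units G /\ open (units G `\` A).
Proof.
split=> [[C cC ->]|[AU oA]].
  split; first by move=> x [].
  have -> : units G `\` (C `&` units G) = units G `&` ~` C.
    apply/seteqP; split=> x [Ux h]; split => // ; first by move=> Cx; apply: h.
    by move=> [].
  by apply: openI; [exact: open_units|exact: closed_openC].
exists (~` (units G `\` A)); first exact: open_closedC.
apply/seteqP; split=> x; first by move=> Ax; split; [move=> []|exact: AU].
by move=> [h Ux]; apply: contrapT => nA; apply: h.
Qed.

Section BicompactProduct.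
Variables K L : set G.
Hypotheses (hK : bicompact K) (hL : bicompact L).

Let L1 := L `&` @grng G @^-1` (@gsrc G @` K).

Let gsrc_gprod : @gsrc G @` gprod K L = @gsrc G @` L1.
Proof.
apply/seteqP; split=> [_ [_ [x [y [Kx Ly xy ->]]] <-]|_ [y [Ly [x Kx xy]] <-]].
  by exists y; [split => //; exists x|rewrite gsrcM].
by exists (gmul x y); [exists x, y|rewrite gsrcM].
Qed.

(** The delicate points outside are the sources of some [y] in [L] with range off $\mathsf s[K]$.
    Nearby units are sources of points of the open slice [P] with range still off $\mathsf s[K]$,
    and [L] has no other arrow over them. *)
Lemma closed_in_units_gprod : closed_in_units (@gsrc G @` gprod K L).
Proof.
rewrite gsrc_gprod; have [[/closed_in_unitsP[_ oK] _] _ _] := hK.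
have [[/closed_in_unitsP[_ oL] _] _ [P [oP sP LP]]] := hL.
apply/closed_in_unitsP; split; first by move=> _ [y _ <-]; exact: units_src.
rewrite openE => x [Ux nx].
have [[y Ly yx]|nL] := pselect ((@gsrc G @` L) x); last first.
  apply: filterS (open_nbhs_nbhs (conj oL (conj Ux nL))) => z [Uz nz].
  by split => // -[y [Ly _] yz]; apply: nz; exists y.
have nKy : (units G `\` @gsrc G @` K) (grng y).
  by split; [exact: units_rng|move=> Ky; apply: nx; exists y].
have nV : nbhs y (P `&` @grng G @^-1` (units G `\` @gsrc G @` K)).
  apply: filterI; first by apply: open_nbhs_nbhs; split => //; exact: LP.
  by apply: grng_continuous; exact: open_nbhs_nbhs.
move: nV; rewrite nbhsE => -[V [oV Vy] VP].
have nW : nbhs x (@gsrc G @` V).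
  by apply: open_nbhs_nbhs; split; [exact: open_gsrc_image|exists y].
apply: filterS nW => _ [z Vz <-]; split; first exact: units_src.
move=> [w [Lw Kw] wz]; have [Pz [_ nKz]] := VP z Vz.
by apply: nKz; rewrite (slice_src sP Pz (LP _ Lw)).
Qed.

(** The set of composable pairs need not be closed, so the product is parametrized by [L1] instead:
    each [y] there has exactly one left partner in [K], and it varies continuously with [y]. *)
Lemma compact_gprod : compact (gprod K L).
Proof.
have [[[C cC eC] _] _ [ O [oO sO KO]]] := hK.
have [_ cL [P [oP sP LP]]] := hL.
have cL1 : compact L1.
  have -> : L1 = L `&` @grng G @^-1` C.
    rewrite /L1 eC; apply/seteqP; split=> y [Ly]; first by move=> [Cy _].
    by move=> Cy; do 2!split => //; exact: units_rng.
  apply: compact_closedI => //; apply: closed_comp => //.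
  by move=> ? _; exact: grng_continuous.
(* On [L1] a partner exists, so the default value [y] of [xget] is never taken there. *)
pose phi y := gmul (xget y [set x | K x /\ gsrc x = grng y]) y.
have phiP x y : K x -> gsrc x = grng y -> phi y = gmul x y.
  move=> Kx xy; rewrite /phi; case: xgetP => [x' -> [Kx' xy']|/(_ x)[]//].
  by rewrite (slice_src sO (KO _ Kx) (KO _ Kx'))// xy xy'.
have -> : gprod K L = phi @` L1.
  apply/seteqP; split=> [_ [x [y [Kx Ly xy ->]]]|_ [y [Ly [x Kx xy]] <-]].
    by exists y; [split => //; exists x|exact: phiP].
  by exists x, y; split=> //; exact: phiP.
apply: continuous_compact cL1; apply/subspace_continuousP => y [Ly [x Kx xy]].
rewrite /from_subspace (phiP x y Kx xy) => W nW.
have [U [V [nU nV h]]] := gmul_nbhs xy nW.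
have [N nN hN] := slice_src_nbhs oO sO (KO _ Kx) nU.
rewrite xy in nN; have nN' := grng_continuous nN.
rewrite /nbhs /= /within /=; apply: filterS2 nV nN' => y' Vy' Ny' [Ly' [x' Kx' xy']].
rewrite (phiP x' y' Kx' xy'); apply: h => //; apply: hN; first exact: KO.
by rewrite xy'.
Qed.

End BicompactProduct.

Lemma bicompact_ginv K : bicompact K -> bicompact (ginv_set K).
Proof.
move=> [[h1 h2] cK [ O [oO sO KO]]]; split.
- by split; rewrite ?gsrc_ginv_set ?grng_ginv_set.
- apply: continuous_compact cK; apply: continuous_subspaceT; exact: ginv_continuous.
- exists (ginv_set O); split; [exact: open_ginv|exact: ginv_slice|exact: image_subset].
Qed.

Lemma bicompact_gprod K L : bicompact K -> bicompact L -> bicompact (gprod K L).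
Proof.
move=> hK hL; split; last 2 first.
- exact: compact_gprod.
- have [_ _ [ O [oO sO KO]]] := hK; have [_ _ [P [oP sP LP]]] := hL.
  exists (gprod O P); split; [exact: gprod_open|exact: gprod_slice|].
  by move=> _ [x [y [Kx Ly xy ->]]]; exists x, y; split; [exact: KO|exact: LP| |].
split; first exact: closed_in_units_gprod.
rewrite -gsrc_ginv_set ginv_gprod.
by apply: closed_in_units_gprod; exact: bicompact_ginv.
Qed.

Lemma bicompact0 : bicompact (@set0 G).
Proof.
split; first by split; rewrite image_set0; exists set0; rewrite ?set0I//; exact: closed0.
  exact: compact0.
by exists set0; split => //; [exact: open0|split=> x y; rewrite inE].
Qed.

Section Generated.
Variable e : nat -> set G.
Hypothesis he : forall n, bicompact (e n).

Definition letter (i : bool * nat) : set G :=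
  if i.1 then ginv_set (e i.2) else e i.2.

(** The empty word denotes the empty set and not the units, which need not be bicompact; this is why
    one-letter words form a separate case. *)
Fixpoint word (w : seq (bool * nat)) : set G :=
  if w is i :: w' then (if w' is [::] then letter i else gprod (letter i) (word w'))
  else set0.

Lemma bicompact_letter i : bicompact (letter i).
Proof. by rewrite /letter; case: i.1; [exact: bicompact_ginv|]. Qed.

Lemma bicompact_word w : bicompact (word w).
Proof.
elim: w => [|i [|j w] IH]; [exact: bicompact0|exact: bicompact_letter|].
exact: bicompact_gprod (bicompact_letter i) IH.
Qed.

Lemma word_cat u v x y : word u x -> word v y -> gsrc x = grng y ->
  word (u ++ v) (gmul x y).
Proof.
move=> + wv; elim: u x => [//|i [|j u] IH] x /=.
  move=> ix xy; case: v wv {IH} => [//|k v] wv.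
  by exists x, y.
move=> [x1 [x2 [ix1 wx2 xx ->]]]; rewrite gsrcM// => x2y.
have := IH x2 wx2 x2y => w2.
exists x1, (gmul x2 y); split => //; first by rewrite grngM.
by rewrite gmulA.
Qed.

Lemma word_inv w x : word w x -> exists w', word w' (ginv x).
Proof.
elim: w x => [//|i [|j w] IH] x.
  move=> ix; exists [:: (~~ i.1, i.2)]; rewrite /= /letter /=; move: ix; rewrite /= /letter.
  by case: i.1 => /= [/ginv_setE|] // ex; exists x.
move=> [x1 [x2 [ix1 /IH[w' wx2] xx ->]]].
exists (w' ++ [:: (~~ i.1, i.2)]); rewrite ginvM//; apply: word_cat => //; last first.
  by rewrite gsrcV grngV.
rewrite /= /letter /=; move: ix1; rewrite /letter.
by case: i.1 => /= [/ginv_setE|] // ex; exists x1.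
Qed.

Lemma sigma_bicompact_subgroupoid : exists K,
  [/\ sigma_bicompact K, subgroupoid K & forall n, e n `<=` K].
Proof.
exists (\bigcup_w word w); split.
- exists (fun n => if (choice.unpickle n : option (seq (bool * nat))) is Some w then word w else set0).
    by move=> n; case: (choice.unpickle n) => [w|]; [exact: bicompact_word|exact: bicompact0].
  apply/seteqP; split=> [x [w _ wx]|x [n _]].
    by exists (choice.pickle w) => //; rewrite choice.pickleK.
  by case: (choice.unpickle n) => [w|//] wx; exists w.
- split=> [x [w _ /word_inv[w' wx]]|x y [u _ ux] [v _ vy] xy]; first by exists w'.
  by exists (u ++ v) => //; exact: word_cat.
- by move=> n x enx; exists [:: (false, n)].
Qed.

End Generated.

Lemma nowhere_dense_gsrc_preimage A : nowhere_dense A -> nowhere_dense (@gsrc G @^-1` A).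
Proof.
move=> /nowhere_denseP h; apply/nowhere_denseP => V oV [x Vx].
have [|W [oW [w Ww] WV WA]] := h _ (open_gsrc_image oV); first by exists (gsrc x), x.
have [y Vy yw] := WV _ Ww.
exists (V `&` @gsrc G @^-1` W); split.
- by apply: openI => //; move/continuousP: gsrc_continuous; apply.
- by exists y; split => //=; rewrite yw.
- by move=> z [].
- by rewrite -subset0 => z [[_ Wz] Az]; have : (W `&` A) (gsrc z) by []; rewrite WA.
Qed.

Lemma meagre_gsrc_preimage A : meagre A -> meagre (@gsrc G @^-1` A).
Proof.
move=> [N hN ->]; exists (fun n => @gsrc G @^-1` N n); last by rewrite preimage_bigcup.
by move=> n; exact: nowhere_dense_gsrc_preimage.
Qed.

Lemma nowhere_dense_ginv A : nowhere_dense A -> nowhere_dense (ginv_set A).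
Proof.
move=> /nowhere_denseP h; apply/nowhere_denseP => V oV [x Vx].
have [|W [oW [w Ww] WV WA]] := h _ (open_ginv oV); first by exists (ginv x), x.
exists (ginv_set W); split.
- exact: open_ginv.
- by exists (ginv w), w.
- by move=> _ [z Wz <-]; have := WV z Wz => /ginv_setE.
- rewrite -subset0 => _ [[z Wz <-] /ginv_setE]; rewrite (ginvK z) => Az.
  by have : (W `&` A) z by []; rewrite WA.
Qed.

Lemma meagre_ginv A : meagre A -> meagre (ginv_set A).
Proof.
move=> [N hN ->]; exists (fun n => ginv_set (N n)); last by rewrite /ginv_set image_bigcup.
by move=> n; exact: nowhere_dense_ginv.
Qed.

(** Openness of the source map carries an open set avoiding [A] to an open set of units; injectivity
    on the slice keeps the image disjoint from that of [A]. *)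
Lemma nowhere_dense_slice_image O A : open O -> slice O -> nowhere_dense A ->
  nowhere_dense (@gsrc G @` (O `&` A)).
Proof.
move=> oO sO /nowhere_denseP h; apply/nowhere_denseP => V oV V0.
have [[x [Ox Vx]]|nVO] := pselect ((O `&` @gsrc G @^-1` V) !=set0); last first.
  exists V; split => //; rewrite -subset0 => t [Vx [x [Ox _] xx]].
  by apply: nVO; exists x; split => //=; rewrite xx.
have oOV : open (O `&` @gsrc G @^-1` V).
  by apply: openI => //; move/continuousP: gsrc_continuous; apply.
have [|W [oW [w Ww] WV WA]] := h _ oOV; first by exists x.
exists (@gsrc G @` W); split; [exact: open_gsrc_image|by exists (gsrc w), w| |].
  by move=> _ [z Wz <-]; have [] := WV z Wz.
rewrite -subset0 => _ [[z Wz <-] [y [Oy Ay] yz]].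
have zy : z = y by apply: (slice_src sO) => //; have [] := WV z Wz.
suff : (W `&` A) z by rewrite WA.
by split => //; rewrite zy.
Qed.

Lemma meagre_gsrc_image K A : sigma_bicompact K -> meagre A -> meagre (@gsrc G @` (K `&` A)).
Proof.
move=> [k hk ->] [N hN ->].
apply: (@meagre_sub _ _ (\bigcup_n \bigcup_m (@gsrc G @` (k n `&` N m)))).
  by move=> _ [x [[n _ kx] [m _ Nx]] <-]; exists n => //; exists m => //; exists x.
apply: meagre_bigcup => n; apply: meagre_bigcup => m; apply: meagre_nd.
have [_ _ [ O [oO sO kO]]] := hk n.
apply: nowhere_dense_sub (nowhere_dense_slice_image oO sO (hN m)).
by apply: image_subset => x [kx Nx]; split => //; exact: kO.
Qed.

Lemma sigma_bicompact_ginv K : sigma_bicompact K -> sigma_bicompact (ginv_set K).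
Proof.
move=> [k hk ->]; exists (fun n => ginv_set (k n)); first by move=> n; exact: bicompact_ginv.
by rewrite /ginv_set image_bigcup.
Qed.

Lemma meagre_grng_image K A : sigma_bicompact K -> meagre A -> meagre (@grng G @` (K `&` A)).
Proof.
move=> hK mA; rewrite -gsrc_ginv_set.
apply: meagre_sub (meagre_gsrc_image (sigma_bicompact_ginv hK) (meagre_ginv mA)).
by apply: image_subset => _ [x [Kx Ax] <-]; split; exists x.
Qed.

End Etale.

(** * Continuity of sections *)

Section BundleTopology.
Variables (R : realType) (G : etaleGroupoid) (rho : fellBundle R G).
Implicit Types (x y z : G) (a b c d s : section rho) (t : R).

Local Notation cont_at c x := {for x, continuous (smap c)}.

Lemma bnorm_ge0 (b : tot rho) : 0 <= bnorm b.
Proof. exact: vabs_ge0. Qed.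

(** The filter generated by the tubes [B p] satisfies the hypotheses of [bnorm_cvg0], hence
    converges to $0_x$ and contains [U]. *)
Lemma zero_tube x (U : set (tot rho)) : nbhs (inj (0 : fib rho x)) U ->
  exists N t, [/\ nbhs x N, 0 < t &
    forall y (u : fib rho y), N y -> vabs u < t -> U (inj u)].
Proof.
move=> nU; pose D : set (set G * R) := [set p | nbhs x p.1 /\ 0 < p.2].
pose B (p : set G * R) : set (tot rho) := [set b | p.1 (proj b) /\ bnorm b < p.2].
have FF : ProperFilter (filter_from D B).
  apply: filter_from_proper.
    apply: filter_from_filter; first by exists (setT, 1); split => //; exact: filterT.
    move=> p q [p1 p2] [q1 q2]; exists (p.1 `&` q.1, Num.min p.2 q.2).
      by split; [exact: filterI|rewrite /= lt_min p2].
    by move=> b [[/= h1 h2]]; rewrite lt_min => /andP[].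
  move=> p [p1 p2]; exists (inj (0 : fib rho x)); split.
    by rewrite proj_inj; exact: nbhs_singleton.
  by rewrite bnorm_inj vabs0.
have : filter_from D B --> inj (0 : fib rho x).
  apply: bnorm_cvg0.
    by move=> N nN; exists (N, 1) => // b [].
  apply/cvgrPdist_lt => e e0; exists (setT, e); first by split => //; exact: filterT.
  by move=> b [_ be]; rewrite sub0r normrN ger0_norm ?bnorm_ge0.
move/(_ U nU) => [[N t] [/= nN t0] h]; exists N, t; split => // y u Ny ut.
by apply: h; split; rewrite /= ?proj_inj ?bnorm_inj.
Qed.

Definition szero : section rho := fun=> 0.

Lemma szero_continuous x : cont_at szero x.
Proof.
move=> U /zero_tube[N [t [nN t0 h]]]; apply: filterS nN => y Ny.
by apply: h => //; rewrite vabs0.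
Qed.

Lemma near_cont_at c d x : (\forall y \near x, c y = d y) -> cont_at d x -> cont_at c x.
Proof.
move=> h hd U; rewrite /smap (nbhs_singleton h) => /hd hU.
by apply: filterS2 h hU => y; rewrite /smap /= => ->.
Qed.

Lemma badd_nbhs (b1 b2 : tot rho) W : proj b1 = proj b2 -> nbhs (badd b1 b2) W ->
  exists U V, [/\ nbhs b1 U, nbhs b2 V &
    forall b1' b2' : tot rho, U b1' -> V b2' -> proj b1' = proj b2' -> W (badd b1' b2')].
Proof.
move=> xy nW; have /subspace_continuousP/(_ (b1, b2) xy W nW) := @badd_continuous _ _ rho.
rewrite /nbhs /= /within /= => -[[U V] [/= nU nV] h].
by exists U, V; split => // x' y' Ux' Vy' xy'; apply: (h (x', y')).
Qed.

Lemma bmul_nbhs (b1 b2 : tot rho) W : bcomposable rho (b1, b2) -> nbhs (bmul b1 b2) W ->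
  exists U V, [/\ nbhs b1 U, nbhs b2 V &
    forall b1' b2' : tot rho, U b1' -> V b2' -> bcomposable rho (b1', b2') -> W (bmul b1' b2')].
Proof.
move=> xy nW; have /subspace_continuousP/(_ (b1, b2) xy W nW) := @bmul_continuous _ _ rho.
rewrite /nbhs /= /within /= => -[[U V] [/= nU nV] h].
by exists U, V; split => // x' y' Ux' Vy' xy'; apply: (h (x', y')).
Qed.

Lemma sadd_continuous c d x : cont_at c x -> cont_at d x -> cont_at (sadd c d) x.
Proof.
move=> hc hd W; rewrite /smap inj_add => nW.
have [|U [V [/hc nU /hd nV h]]] := badd_nbhs _ nW; first by rewrite !proj_inj.
apply: (@filterS2 _ (nbhs x) _ _ _ _ _ nU nV) => y; rewrite /= /smap inj_add => Uy Vy.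
by apply: h => //; rewrite !proj_inj.
Qed.

Lemma sscale_continuous k c x : cont_at c x -> cont_at (sscale k c) x.
Proof.
move=> hc W; rewrite /smap inj_scale => nW.
have := hc _ (@bscale_continuous _ _ rho k _ _ nW).
by apply: (@filterS _ (nbhs x)) => y; rewrite /= /smap inj_scale.
Qed.

Lemma vabs_usc c x t : cont_at c x -> vabs (c x) < t -> \forall y \near x, vabs (c y) < t.
Proof.
move=> hc ct; have : nbhs (smap c x) [set b : tot rho | bnorm b < t].
  by apply: open_nbhs_nbhs; split; [exact: bnorm_usc|rewrite /= bnorm_inj].
by move=> /hc; apply: (@filterS _ (nbhs x)) => y /=; rewrite bnorm_inj.
Qed.

(* Near [x], the section [a] is the sum of a small section and of points of
   the bundle close to [a x], which exist because [proj] is open. *)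
Lemma uniform_limit_continuous a x :
  (forall t, 0 < t -> exists2 c, cont_at c x & forall y, vabs (a y - c y) <= t) ->
  cont_at a x.
Proof.
move=> h W nW.
have [||U [V [nU nV hUV]]] := @badd_nbhs (inj (0 : fib rho x)) (inj (a x)) W.
- by rewrite !proj_inj.
- by rewrite -inj_add add0r.
have [N [t [nN t0 hN]]] := zero_tube nU.
have [|c cc hc] := h (t / 3); first by lra.
(* [k] is the distance vector from [w] to [c], of norm at most [t / 3] at [a x]. By upper
   semicontinuity it stays below two thirds of [t] nearby; the last third pays for [a y - c y]. *)
pose k w : tot rho := badd (smap c (proj w)) (bscale (-1) w).
have kE y (v : fib rho y) : k (inj v) = inj (c y - v).
  by rewrite /k proj_inj -(scaleN1r v) inj_add inj_scale.
have ck : {for inj (a x), continuous k}.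
  apply: (@within_comp_cvg _ _ _ _ (fun p => badd p.1 p.2)
    (fun w => (smap c (proj w), bscale (-1) w))).
  - exact: badd_continuous.
  - by rewrite /= /smap !proj_inj.
  - apply: cvg_pair; last exact: bscale_continuous.
    apply: (@continuous_comp _ _ _ (@proj _ _ rho) (smap c)); first exact: proj_continuous.
    by rewrite proj_inj.
  - by near=> w; rewrite /= /smap !proj_inj.
have nD : nbhs (inj (a x)) (V `&` [set w | bnorm (k w) < t * (2 / 3)]).
  apply: filterI => //; apply: (ck [set b : tot rho | bnorm b < t * (2 / 3)]).
  apply: open_nbhs_nbhs; split; first exact: bnorm_usc.
  by rewrite /= kE bnorm_inj vabsB; apply: le_lt_trans (hc x) _; lra.
move: nD; rewrite nbhsE => -[B [oB Bx] BV].
have nB : nbhs x (@proj _ _ rho @` B).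
  apply: open_nbhs_nbhs; split; first exact: proj_open.
  by exists (inj (a x)) => //; rewrite proj_inj.
apply: filterS2 nN nB => y Ny [w Bw wy].
have [Vw kw] := BV w Bw; have wE := coordK wy.
move: (coord y w) wE => v wE; rewrite -wE in Vw kw *.
rewrite /= kE bnorm_inj in kw.
rewrite /= /smap -(subrK v (a y)) inj_add; apply: hUV => //; last by rewrite !proj_inj.
apply: hN => //.
rewrite -(subrKA (c y)); apply: le_lt_trans (ler_vabsD _ _) _.
by have := hc y; lra.
Unshelve. all: by end_near. Qed.

Lemma uniform_limit_normfun a x :
  (forall t, 0 < t -> exists2 c, {for x, continuous (normfun c)} &
    forall y, vabs (a y - c y) <= t) ->
  {for x, continuous (normfun a)}.
Proof.
move=> h; apply/cvgrPdist_lt => e e0.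
have [|c cc hc] := h (e / 4); first by lra.
have tri y : `|normfun a y - normfun c y| <= e / 4.
  rewrite ler_norml /normfun -/(vabs _) -/(vabs (c y)).
  have := ler_vabsD (a y - c y) (c y); have := ler_vabsD (c y - a y) (a y).
  by rewrite !subrK vabsB; have := hc y; rewrite /vabs /fnorm; lra.
have /cvgrPdist_lt/(_ (e / 4)) := cc; have e4 : 0 < e / 4 by lra.
move=> /(_ e4); apply: filterS => y hy.
have := tri x; have := tri y; move: hy.
by rewrite !ltr_norml !ler_norml; lra.
Qed.

(** Off [N] only lower semicontinuity can fail. If [x] is on no frontier of the sets [V q], take a
    rational [q] just below the norm at [x]: then [x] is outside the closure of [V q], and so are
    all nearby [y]. As [N] is closed, [c] is continuous at these [y], where a norm below [q] would
    put [y] in [V q]. *)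
Lemma normfun_continuous c (N : set G) : closed N -> nowhere_dense N ->
  (forall x, ~ N x -> cont_at c x) -> meagre (~` cont_points (normfun c)).
Proof.
move=> cN nN hc; pose V (q : rat) : set G := [set y | vabs (c y) < ratr q]°.
apply: (@meagre_sub _ _ (N `|` \bigcup_q (closure (V q) `\` V q))); last first.
  apply: meagreU; first exact: meagre_nd.
  apply: meagre_countable_bigcup => q; apply/meagre_nd/nowhere_dense_frontier.
  exact: open_interior.
move=> x; apply: contra_notP => /not_orP[Nx nV].
apply/cvgrPdist_lt => e e0.
have lt1 : vabs (c x) - e < vabs (c x) by lra.
have lt2 : vabs (c x) < vabs (c x) + e by lra.
have [q] := rat_in_itvoo lt1; rewrite in_itv /= => /andP[q1 q2].
have nVq : ~ closure (V q) x.
  move=> Vx; apply: nV; exists q => //; split => // /interior_subset /=; lra.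
have n1 : \forall y \near x, ~ closure (V q) y.
  by apply: open_nbhs_nbhs; split => //; apply: closed_openC; exact: closed_closure.
have n2 : \forall y \near x, ~ N y.
  by apply: open_nbhs_nbhs; split => //; apply: closed_openC.
have n3 := vabs_usc (hc x Nx) lt2.
near=> y; rewrite /normfun ltr_distl -/(vabs _) -/(vabs (c y)).
have h1 : vabs (c y) < vabs (c x) + e by near: y.
have h2 : ~ N y by near: y.
have h3 : ~ closure (V q) y by near: y.
have h4 : ratr q <= vabs (c y).
  rewrite leNgt; apply/negP => yq; apply: h3; apply: subset_closure.
  exact: vabs_usc (hc y h2) yq.
by rewrite /fnorm -/(vabs (c x)) -/(vabs (c y)); lra.
Unshelve. all: by end_near. Qed.

End BundleTopology.

(** * Compactly supported sections *)

Section SliceSections.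
Variables (R : realType) (G : etaleGroupoid) (rho : fellBundle R G).
Implicit Types (x y z : G) (F : seq G) (a b c d s t : section rho) (K L : set G).

Local Notation cont_at c x := {for x, continuous (smap c)}.

Lemma section_eq a b : (forall x, a x = b x) -> a = b.
Proof. exact: functional_extensionality_dep. Qed.

Lemma contsecZ K k s : contsec K s -> contsec K (sscale k s).
Proof.
move=> [sK Ks]; split => x; last by move=> /Ks; exact: sscale_continuous.
by rewrite /supp /= /sscale => h; apply: sK; apply: contraNN h => /eqP ->; rewrite scaler0.
Qed.

Lemma Cc_ind (P : section rho -> Prop) :
  P (szero rho) ->
  (forall K s, bicompact K -> contsec K s -> P s) ->
  (forall a b, P a -> P b -> P (sadd a b)) -> forall a, Cc a -> P a.
Proof.
move=> P0 Ps PD a [n [k [s [hs ha]]]].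
have -> : a = (fun x => \sum_(i < n) k i *: s i x) by apply: section_eq.
elim: n k s hs {ha} => [|n IH] k s hs.
  have -> : (fun x => \sum_(i < 0) k i *: s i x) = szero rho; last exact: P0.
  by apply: section_eq => x; rewrite big_ord0.
have -> : (fun x => \sum_(i < n.+1) k i *: s i x) =
  sadd (fun x => \sum_(i < n) k (widen_ord (leqnSn n) i) *: s (widen_ord (leqnSn n) i) x)
    (sscale (k ord_max) (s ord_max)).
  by apply: section_eq => x; rewrite big_ord_recr.
apply: PD; first exact: (IH (fun i => k (widen_ord (leqnSn n) i)) (fun i => s (widen_ord (leqnSn n) i))).
by have [K bK /contsecZ h] := hs ord_max; exact: Ps bK (h _).
Qed.

Lemma Cc_slice K s : bicompact K -> contsec K s -> Cc s.
Proof.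
move=> bK hs; exists 1%N, (fun=> 1), (fun=> s); split; first by move=> _; exists K.
by move=> x; rewrite big_ord1 scale1r.
Qed.

Lemma Cc0 : Cc (szero rho).
Proof. by exists 0%N, (fun=> 1), (fun=> szero rho); split; [case|move=> x; rewrite big_ord0]. Qed.

Lemma CcD a b : Cc a -> Cc b -> Cc (sadd a b).
Proof.
move=> [n [k [s [hs ha]]]] [m [l [t [ht hb]]]].
exists (n + m)%N, (fun i => match fintype.split i with inl j => k j | inr j => l j end),
  (fun i => match fintype.split i with inl j => s j | inr j => t j end); split.
  by move=> i; case: (fintype.split i).
move=> x; rewrite big_split_ord /= /sadd ha hb; congr (_ + _); apply: eq_bigr => i _.
  by rewrite (unsplitK (inl i)).
by rewrite (unsplitK (inr i)).
Qed.

Lemma supp_at a K x : supp a `<=` K -> ~ K x -> a x = 0.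
Proof. by move=> aK nK; apply/eqP/negPn/negP => /aK. Qed.

Lemma colfin0 : colfin (szero rho).
Proof. by move=> x; exists [::] => // b _; rewrite /szero eqxx. Qed.

Lemma colfinD a b : colfin a -> colfin b -> colfin (sadd a b).
Proof.
move=> ha hb x; have [F uF hF] := ha x; have [F' uF' hF'] := hb x.
exists (undup (F ++ F')); first exact: undup_uniq.
move=> z zx; rewrite mem_undup mem_cat /sadd.
have [a0|/(hF z zx) ->//] := eqVneq (a z) 0.
by rewrite a0 add0r => /(hF' z zx) ->; rewrite orbT.
Qed.

Lemma colfin_slice K s : slice K -> supp s `<=` K -> colfin s.
Proof.
move=> sK hs x; have [[b Kb bx]|nK] := pselect ((@gsrc G @` K) x).
  exists [:: b] => // z zx /hs Kz; rewrite inE; apply/eqP.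
  by apply: (slice_src sK) => //; rewrite zx bx.
by exists [::] => // z zx /hs Kz; exfalso; apply: nK; exists z.
Qed.

Lemma sstar0 : sstar (szero rho) = szero rho.
Proof. by apply: section_eq => x; rewrite -(ginvK x) sstarE sg0. Qed.

Lemma sstarD a b : sstar (sadd a b) = sadd (sstar a) (sstar b).
Proof. by apply: section_eq => x; rewrite /sadd -(ginvK x) !sstarE sgD. Qed.

Lemma slice_sub K L : K `<=` L -> slice L -> slice K.
Proof.
move=> KL [h1 h2]; split=> x y; rewrite !inE => /KL Lx /KL Ly.
  by apply: h1; rewrite inE.
by apply: h2; rewrite inE.
Qed.

Lemma bicompact_slice K : bicompact K -> slice K.
Proof. by move=> [_ _ [ O [_ sO KO]]]; exact: slice_sub KO sO. Qed.

Lemma contsec_sstar K s : contsec K s -> contsec (ginv_set K) (sstar s).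
Proof.
move=> [sK Ks]; split=> x.
  move=> h; apply/ginv_setE/sK; apply: contraNN h => /eqP h.
  by rewrite -[sstar s x]/(sg x (s (ginv x))) h sg0// ginvK.
move=> /ginv_setE/Ks hs.
have -> : smap (sstar s) = @bstar _ _ rho \o smap s \o @ginv G.
  apply/funext => y /=; rewrite /smap /sstar coordK//.
  by rewrite proj_bstar proj_inj ginvK.
apply: continuous_comp; first exact: ginv_continuous.
by apply: continuous_comp => //; exact: bstar_continuous.
Qed.

Lemma Cc_sstar a : Cc a -> Cc (sstar a).
Proof.
move: a; apply: Cc_ind.
- by rewrite sstar0; exact: Cc0.
- move=> K s /bicompact_ginv bK /contsec_sstar; exact: Cc_slice.
- by move=> a b ha hb; rewrite sstarD; exact: CcD.
Qed.

Lemma Cc_colfin a : Cc a -> colfin a.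
Proof.
move: a; apply: Cc_ind; [exact: colfin0| |exact: colfinD].
by move=> K s /bicompact_slice sK [hs _]; exact: colfin_slice hs.
Qed.

Lemma Cc_rowcolfin a : Cc a -> rowcolfin a.
Proof. by move=> ha; split; [exact: Cc_colfin|exact/Cc_colfin/Cc_sstar]. Qed.

Lemma conv_supp c d : colfin d -> supp (conv c d) `<=` gprod (supp c) (supp d).
Proof.
move=> hd y; have [F uF hF] := hd (gsrc y).
rewrite /supp /= (@conv_op _ _ _ _ _ _ F)//; last by move=> b bx _; exact: hF.
apply: contraNP => ny; apply/eqP; rewrite /op big1// => b /asboolP bx.
have f := fac_div (esym bx).
have [->|cb] := eqVneq (c (gdiv y b)) 0; first exact: mu0l.
have [->|db] := eqVneq (d b) 0; first exact: mu0r.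
by exfalso; apply: ny; exists (gdiv y b), b; split => //; [exact: gsrc_div|rewrite gdivK].
Qed.

Lemma convDl a b c : colfin c -> conv (sadd a b) c = sadd (conv a c) (conv b c).
Proof.
move=> hc; apply: section_eq => y; have [F uF hF] := hc (gsrc y).
rewrite /sadd !(@conv_op _ _ _ _ _ _ F)//; try by move=> b' bx _; exact: hF.
exact: opDl.
Qed.

Lemma convDr a b c : colfin b -> colfin c -> conv a (sadd b c) = sadd (conv a b) (conv a c).
Proof.
move=> hb hc; apply: section_eq => y; have [F uF hF] := hb (gsrc y).
have [F' uF' hF'] := hc (gsrc y).
have uu := undup_uniq (F ++ F').
rewrite /sadd !(@conv_op _ _ _ _ _ _ (undup (F ++ F')))//.
- exact: opDr.
- by move=> z zx _ /(hF' z zx); rewrite mem_undup mem_cat orbC => ->.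
- by move=> z zx _ /(hF z zx); rewrite mem_undup mem_cat => ->.
- move=> z zx _; rewrite mem_undup mem_cat.
  have [b0|/(hF z zx) ->//] := eqVneq (b z) 0.
  by rewrite b0 add0r => /(hF' z zx) ->; rewrite orbT.
Qed.

Lemma conv0l c : conv (szero rho) c = szero rho.
Proof.
apply: section_eq => y; rewrite (@conv_op _ _ _ _ _ _ [::])//; last by move=> b _; rewrite eqxx.
by rewrite /op big_nil.
Qed.

Lemma conv0r c : conv c (szero rho) = szero rho.
Proof.
apply: section_eq => y; rewrite (@conv_op _ _ _ _ _ _ [::])//; last by move=> b _ _; rewrite eqxx.
by rewrite /op big_nil.
Qed.

(** Only one term of the convolution survives. Formula [val] asks that the right factor lie in the
    open slice [P], not in [L], so it holds on a whole neighbourhood of each point of the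
    product. *)
Lemma contsec_conv K L s t : bicompact K -> bicompact L -> contsec K s -> contsec L t ->
  contsec (gprod K L) (conv s t).
Proof.
move=> bK bL [sK Ks] [tL Lt].
have [_ _ [ O [oO sO KO]]] := bK; have [_ _ [P [oP sP LP]]] := bL.
have val x y : P y -> gsrc x = grng y -> conv s t (gmul x y) = mu (gmul x y) (s x) (t y).
  move=> Py xy; rewrite (@conv_op _ _ _ _ _ _ [:: y])//.
    by rewrite /op big_mkcond big_seq1 asboolT ?gsrcM// gmulK.
  move=> b; rewrite gsrcM// => bz _ /tL/LP Pb; rewrite inE; apply/eqP.
  exact: slice_src sP Pb Py bz.
split.
  apply: (subset_trans (conv_supp _)); first exact: colfin_slice (bicompact_slice bL) tL.
  by move=> _ [x [y [sx ty xy ->]]]; exists x, y; split; [exact: sK|exact: tL| |].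
move=> _ [x [y [Kx Ly xy ->]]] W.
have f : fac x y (gmul x y) by split.
rewrite /smap (val x y (LP _ Ly) xy) inj_mu// => nW.
have [|U [V [nU nV h]]] := bmul_nbhs _ nW; first exact: bcomposable_inj.
have : nbhs x (smap s @^-1` U) := Ks x Kx _ nU.
rewrite nbhsE => -[U' [oU' U'x] U'U].
have : nbhs y (smap t @^-1` V) := Lt y Ly _ nV.
rewrite nbhsE => -[V' [oV' V'y] V'V].
have nz : nbhs (gmul x y) (gprod (U' `&` O) (V' `&` P)).
  apply: open_nbhs_nbhs; split; first by apply: gprod_open; exact: openI.
  by exists x, y; split => //; split => //; [exact: KO|exact: LP].
apply: (@filterS _ (nbhs (gmul x y)) _ _ _ _ nz) => _ [x' [y' [[U'x' Ox'] [V'y' Py'] xy' ->]]].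
rewrite /= (val x' y' Py' xy') inj_mu; last by split.
by apply: h; [exact: U'U|exact: V'V|exact: bcomposable_inj].
Qed.

Lemma Cc_conv a b : Cc a -> Cc b -> Cc (conv a b).
Proof.
move=> ha hb; move: a ha; apply: Cc_ind.
- by rewrite conv0l; exact: Cc0.
- move=> K s bK hs; suff : Cc b /\ Cc (conv s b) by case.
  move: b hb; apply: Cc_ind.
  + by rewrite conv0r; split; exact: Cc0.
  + move=> L t bL ht; split; first exact: Cc_slice bL ht.
    exact: Cc_slice (bicompact_gprod bK bL) (contsec_conv bK bL hs ht).
  + move=> b c [hb hsb] [hc hsc]; split; first exact: CcD.
    by rewrite convDr; [exact: CcD|exact: Cc_colfin|exact: Cc_colfin].
- by move=> a c hab hcb; rewrite convDl; [exact: CcD|exact: Cc_colfin].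
Qed.

(** A section carried by [K] inside an open slice [O] can be discontinuous only on the frontier of
    [O]: within [O] but off [K] it vanishes nearby because $\mathsf s[K]$ is closed in the units.
    Closedness of [N] is needed for [normfun_continuous]. *)
Lemma Cc_discontinuity a : Cc a -> exists N, [/\ closed N, nowhere_dense N &
  forall x, ~ N x -> cont_at a x].
Proof.
move: a; apply: Cc_ind.
- exists set0; split; [exact: closed0|exact: nowhere_dense0|].
  by move=> x _; exact: szero_continuous.
- move=> K s [[/closed_in_unitsP[_ oK] _] _ [ O [oO sO KO]]] [sK Ks].
  exists (closure O `\` O); split.
  + by apply: closedI; [exact: closed_closure|exact: open_closedC].
  + exact: nowhere_dense_frontier.
  + move=> x nx; have [Ox|nOx] := pselect (O x); last first.
      have nc : ~ closure O x by move=> cx; exact: nx.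
      apply: (near_cont_at _ (@szero_continuous _ _ rho x)).
      have : nbhs x (~` closure O).
        by apply: open_nbhs_nbhs; split => //; apply: closed_openC; exact: closed_closure.
      apply: filterS => y ny; apply: (supp_at sK) => /KO Oy; apply: ny.
      exact: subset_closure.
    have [Kx|nKx] := pselect (K x); first exact: Ks.
    apply: (near_cont_at _ (@szero_continuous _ _ rho x)).
    have : nbhs x (@gsrc G @^-1` (units G `\` @gsrc G @` K)).
      apply: gsrc_continuous; apply: open_nbhs_nbhs; split => //; split; first exact: units_src.
      by move=> [z Kz zx]; apply: nKx; rewrite -(slice_src sO (KO _ Kz) Ox zx).
    by apply: filterS => y [_ ny]; apply: (supp_at sK) => Ky; apply: ny; exists y.
- move=> a b [N [cN nN hN]] [M [cM nM hM]]; exists (N `|` M); split.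
  + exact: closedU.
  + exact: nowhere_denseU.
  + by move=> x /not_orP[/hN ha /hM hb]; exact: sadd_continuous.
Qed.

Lemma Cc_supp a : Cc a -> exists2 e : nat -> set G,
  (forall n, bicompact (e n)) & supp a `<=` \bigcup_n e n.
Proof.
move: a; apply: Cc_ind.
- by exists (fun=> set0) => [n|x]; [exact: bicompact0|rewrite /supp /= eqxx].
- by move=> K s bK [sK _]; exists (fun=> K) => // x /sK Kx; exists 0%N.
- move=> a b [e he ae] [e' he' be].
  exists (fun n => if odd n then e n./2 else e' n./2); first by move=> n; case: odd.
  move=> x; rewrite /supp /= /sadd => h; have [a0|/ae[n _ ex]] := eqVneq (a x) 0.
    rewrite a0 add0r in h; have [n _ ex] := be x h.
    by exists n.*2 => //=; rewrite odd_double doubleK.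
  by exists n.*2.+1 => //=; rewrite odd_double /= uphalf_double.
Qed.

End SliceSections.

Lemma big_only1_seq (I : eqType) (V : nmodType) (r : seq I) (P : pred I) (F : I -> V) i0 :
  uniq r -> i0 \in r -> P i0 ->
  (forall i, i \in r -> P i -> i != i0 -> F i = 0) -> \sum_(i <- r | P i) F i = F i0.
Proof.
move=> ur r0 P0 h; rewrite (big_rem i0 r0) /= P0 big1_seq ?addr0// => i /andP[Pi].
by rewrite mem_rem_uniq// inE => /andP[ii ir]; exact: h.
Qed.

(** * Boundedness of the operators in C_c *)

Section SliceBound.
Variables (R : realType) (G : etaleGroupoid) (rho : fellBundle R G).
Implicit Types (x y z b : G) (F : seq G) (a c d s t : section rho) (K L : set G) (M : R).

(** Upper semicontinuity is enough: if unbounded, the sets [B n] generate a filter on [K], and the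
    norm is bounded near a cluster point. *)
Lemma contsec_bounded K s : compact K -> contsec K s ->
  exists2 M, 0 <= M & forall y, vabs (s y) <= M.
Proof.
move=> cK [sK Ks].
suff [n hn] : exists n : nat, forall y, K y -> vabs (s y) <= n%:R.
  exists n%:R => // y; have [/hn//|nK] := pselect (K y).
  by rewrite (supp_at sK nK) vabs0.
apply: contrapT => nex.
pose B n : set G := [set y | K y /\ n%:R < vabs (s y)].
have Bn n : B n !=set0.
  apply: contrapT => nB; apply: nex; exists n => y Ky; rewrite leNgt; apply/negP => h.
  by apply: nB; exists y.
have FF : ProperFilter (filter_from [set: nat] B).
  apply: filter_from_proper => //; apply: filter_from_filter; first by exists 0%N.
  move=> i j _ _; exists (maxn i j) => // y [Ky h].
  by split; split => //; apply: le_lt_trans h; rewrite ler_nat ?leq_maxl ?leq_maxr.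
have [|y [Ky cy]] := cK _ FF; first by exists 0%N => // y [].
have [n hn] : exists n : nat, vabs (s y) < n%:R.
  by exists (Num.bound (vabs (s y))); apply: archi_boundP; exact: vabs_ge0.
have nb : filter_from [set: nat] B (B n) by exists n.
have [z [[_ nz] zn]] := cy _ _ nb (vabs_usc (Ks y Ky) hn).
by have := lt_trans nz zn; rewrite ltxx.
Qed.

Lemma fpos_slice_term s (b : G) y x M (u : fib rho b) : gsrc b = x -> gsrc y = x ->
  vabs (s (gdiv y b)) <= M ->
  let h := mu y (s (gdiv y b)) u in
  fpos ((M ^+ 2)%:C *: mu x (sg (ginv b) u) u - mu x (sg (ginv y) h) h).
Proof.
move=> bx yx sM; have yb : gsrc y = gsrc b by rewrite yx.
have M0 : 0 <= M := le_trans (vabs_ge0 _) sM.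
move: (s _) (fac_div yb) (gsrc_div yb) (grng_div yb) sM => v f1 sd rd sM /=.
set p := mu (grng b) (sg (ginv (gdiv y b)) v) v.
have pp : fpos p by apply: fpos_sgmu.
have pM : vabs p <= M ^+ 2.
  by rewrite vabs_sgmu// ler_sqr ?nnegrE ?vabs_ge0.
have := fpos_conj_le (erefl (grng b)) bx (gsrc_rng b) u pp pM.
congr (fpos (_ - _)).
have ub : gsrc (ginv b) = grng (ginv (gdiv y b)) by rewrite gsrcV grngV sd.
have f2 : fac (ginv b) (ginv (gdiv y b)) (ginv y) by split => //; rewrite -ginvM// gdivK.
have f3 : fac (ginv (gdiv y b)) (gdiv y b) (grng b) by split; [rewrite gsrcV|].
have f4 : fac (ginv (gdiv y b)) y b.
  by rewrite ginv_div//; apply: fac_div; rewrite yb.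
rewrite (sgM _ _ f1 erefl erefl erefl).
rewrite (muA _ _ _ f2 f4 (fac_Vl yx) (fac_Vl bx)); congr mu.
by rewrite /p (muA _ _ _ f3 f1 (fac_rng erefl) f4).
Qed.

(** By injectivity of range and source on [K], the matrix of [s] has at most one nonzero entry per
    row and per column. Hence the inner product of the image has no cross terms and is compared with
    that of [f] term by term. *)
Lemma opbound_slice K s M : slice K -> supp s `<=` K -> (forall y, vabs (s y) <= M) ->
  opbound s M.
Proof.
move=> sK hs sM x F F' f hx uF uF'.
have M0 : 0 <= M := le_trans (vabs_ge0 _) (sM x).
set h := op F s f.
pose g y b := mu y (s (gdiv y b)) (f b).
pose T y b := mu x (sg (ginv y) (g y b)) (g y b).
have g0 y b : gsrc b = x -> gsrc y = x -> ~ K (gdiv y b) -> g y b = 0.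
  by move=> bx yx /(supp_at hs); rewrite /g => ->; apply: mu0l; apply: fac_div; rewrite yx.
have T0 y b : gsrc b = x -> gsrc y = x -> ~ K (gdiv y b) -> T y b = 0.
  by move=> bx yx nK; rewrite /T (g0 _ _ bx yx nK); exact/mu0r/fac_Vl.
have uniq_b y b b' : gsrc y = x -> gsrc b = x -> gsrc b' = x ->
    K (gdiv y b) -> K (gdiv y b') -> b = b'.
  move=> yx bx b'x k k'; have e : gdiv y b = gdiv y b'.
    by apply: (slice_rng sK) => //; rewrite !grng_div// yx.
  rewrite -(gdivK (_ : gsrc b = gsrc y)) ?yx ?bx// -(gdivK (_ : gsrc b' = gsrc y)) ?yx ?b'x//.
  by rewrite -(ginv_div (_ : gsrc y = gsrc b)) ?yx ?bx// -(ginv_div (_ : gsrc y = gsrc b')) ?yx ?b'x// e.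
have uniq_y y y' b : gsrc y = x -> gsrc y' = x -> gsrc b = x ->
    K (gdiv y b) -> K (gdiv y' b) -> y = y'.
  move=> yx y'x bx k k'; have e : gdiv y b = gdiv y' b.
    by apply: (slice_src sK) => //; rewrite !gsrc_div// ?yx ?y'x.
  by rewrite -(gdivK (_ : gsrc y = gsrc b)) ?yx ?bx// e gdivK// y'x bx.
have eT : ip F' x h h = \sum_(b <- F | `[< gsrc b = x >])
    \sum_(y <- F' | `[< gsrc y = x >]) T y b.
  rewrite exchange_big; apply: eq_bigr => y /asboolP yx.
  have [[b [bF bx Kb]]|nb] := pselect (exists b, [/\ b \in F, gsrc b = x & K (gdiv y b)]).
    have -> : h y = g y b.
      rewrite /h /op (@big_only1_seq _ _ _ _ _ b)//; first by apply/asboolP; rewrite bx.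
      move=> b' b'F /asboolP; rewrite yx => b'x bb; apply: g0 => // k'.
      by move: bb; rewrite (uniq_b y b' b) ?eqxx.
    rewrite (@big_only1_seq _ _ _ _ _ b)//; first by apply/asboolP.
    move=> b' b'F /asboolP b'x bb; apply: T0 => // k'.
    by move: bb; rewrite (uniq_b y b' b) ?eqxx.
  have -> : h y = 0.
    rewrite /h /op big_seq_cond big1// => b /andP[bF /asboolP]; rewrite yx => bx.
    by apply: g0 => // k; apply: nb; exists b.
  rewrite mu0r; last exact: fac_Vl.
  rewrite big_seq_cond big1// => b /andP[bF /asboolP bx].
  by apply: T0 => // k; apply: nb; exists b.
have key : fpos ((M ^+ 2)%:C *: ip F x f f - ip F' x h h).
  rewrite eT /ip scaler_sumr -sumrB big_seq_cond; apply: fpos_sum => // b /andP[bF /asboolP bx].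
  have [[y [yF yx Ky]]|ny] := pselect (exists y, [/\ y \in F', gsrc y = x & K (gdiv y b)]).
    rewrite (@big_only1_seq _ _ _ _ _ y)//; first exact: fpos_slice_term.
      exact/asboolP.
    move=> y' y'F /asboolP y'x yy; apply: T0 => // k'.
    by move: yy; rewrite (uniq_y y' y b) ?eqxx.
  rewrite [X in _ - X]big_seq_cond big1 ?subr0.
    by apply: fposZ; [exact: sqr_ge0|exact: fpos_sgmu].
  move=> y /andP[yF /asboolP yx]; apply: T0 => // k; apply: ny; by exists y.
have := fpos_le (fpos_ip F' h hx) key; rewrite [in leRHS]addrC subrK vabsZ.
rewrite cabsR ger0_norm ?sqr_ge0// -!nrm_sqr -exprMn ler_sqr// nnegrE ?mulr_ge0//; exact: nrm_ge0.
Qed.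

Lemma Cc_opbound a : Cc a -> exists2 M, 0 <= M & opbound a M.
Proof.
move: a; apply: Cc_ind.
- exists 0 => // x F F' f hx _ _; rewrite mul0r (@eq_nrm _ _ _ _ _ _ (szero rho)).
    rewrite /nrm /ip big1 ?vabs0 ?sqrtr0// => b /asboolP bx; exact/mu0r/fac_Vl.
  by move=> y _ _; rewrite /op big1// => b /asboolP bx; exact/mu0l/fac_div.
- move=> K s bK hs; have [_ cK _] := bK.
  have [M M0 hM] := contsec_bounded cK hs; exists M => //.
  by apply: (opbound_slice (bicompact_slice bK)) hM; have [] := hs.
- move=> a b [M M0 hM] [N N0 hN]; exists (M + N); first by rewrite addr_ge0.
  exact: opboundD.
Qed.

End SliceBound.

(** * The essential norm *)

Lemma bernoulli_le (R : realDomainType) (h : R) m : 0 <= h -> 1 + m%:R * h <= (1 + h) ^+ m.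
Proof.
move=> h0; elim: m => [|m IH]; first by rewrite mul0r addr0 expr0.
rewrite exprS -natr1; have : 0 <= m%:R * h * h by rewrite !mulr_ge0.
have : (1 + h) * (1 + m%:R * h) <= (1 + h) * (1 + h) ^+ m by rewrite ler_wpM2l//; lra.
lra.
Qed.

(* The tensor power trick: the constant [C] is washed out by taking
   [2^n]-th roots. *)
Lemma power_trick (R : realType) (r : nat -> R) (A C L : R) :
  0 <= A -> 0 <= L -> (forall n, 0 <= r n) ->
  (forall n, r n ^+ 2 <= A * r n.+1) -> (forall n, r n <= C * L ^+ (2 ^ n)) ->
  r 0%N <= A * L.
Proof.
move=> A0 L0 r0 hr hC.
have [A00|A00] := eqVneq A 0.
  by have := hr 0%N; rewrite A00 !mul0r; have := r0 0%N; nra.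
have [L00|L00] := eqVneq L 0.
  by have := hC 0%N; rewrite L00 expn0 expr1 !mulr0.
have {A00}A0 : 0 < A by rewrite lt_def A00.
have {L00}L0 : 0 < L by rewrite lt_def L00.
(* The extra factor [A] on the left avoids the exponent $2^n-1$ on the right. *)
have ind n : A * r 0%N ^+ (2 ^ n) <= A ^+ (2 ^ n) * r n.
  elim: n => [|n IH]; first by rewrite expn0 !expr1.
  rewrite -(ler_pM2r A0).
  have -> : A * r 0%N ^+ (2 ^ n.+1) * A = (A * r 0%N ^+ (2 ^ n)) ^+ 2.
    by rewrite exprMn -exprM expnSr; ring.
  apply: (@le_trans _ _ ((A ^+ (2 ^ n) * r n) ^+ 2)).
    by rewrite ler_sqr ?nnegrE ?mulr_ge0 ?exprn_ge0// ltW.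
  rewrite exprMn -exprM -expnSr -mulrA ler_wpM2l ?exprn_ge0 ?(ltW A0)//.
  by rewrite mulrC hr.
rewrite leNgt; apply/negP => lt.
have AL0 : 0 < A * L by rewrite mulr_gt0.
(* If the claim fails, [h] is positive and the powers of [1 + h] stay below [C / A], against
   Bernoulli. *)
pose h := r 0%N / (A * L) - 1.
have h0 : 0 < h by rewrite /h subr_gt0 ltr_pdivlMr// mul1r.
have bound n : (1 + h) ^+ (2 ^ n) <= C / A.
  rewrite /h addrC subrK expr_div_n ler_pdivrMr ?exprn_gt0//.
  rewrite [leRHS]mulrAC ler_pdivlMr// mulrC; apply: le_trans (ind n) _.
  rewrite exprMn mulrCA; apply: le_trans (_ : _ <= A ^+ (2 ^ n) * (C * L ^+ (2 ^ n))) _ => //.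
  by rewrite ler_wpM2l// exprn_ge0// ltW.
have [n hn] : exists n : nat, C / A < 1 + n%:R * h.
  exists (Num.bound ((C / A) / h)).
  have [CA|CA] := leP 0 (C / A); last first.
    by have := mulr_ge0 (ler0n R (Num.bound (C / A / h))) (ltW h0); lra.
  have := archi_boundP (divr_ge0 CA (ltW h0)); rewrite ltr_pdivrMr//; lra.
have := bound n; have := bernoulli_le (2 ^ n) (ltW h0).
have : n%:R * h <= (2 ^ n)%:R * h by rewrite ler_wpM2r ?(ltW h0)// ler_nat ltnW// ltn_expl.
lra.
Qed.

Section Estimates.
Variables (R : realType) (G : etaleGroupoid) (rho : fellBundle R G).
Implicit Types (x y z b w : G) (F : seq G) (a c d f g : section rho) (K T : set G) (M L : R).

(** A column-finite matrix reaches only finitely many rows from the columns in [F]; with these as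
    middle list, composing the finite matrices gives the full convolution. *)
Lemma column_cover d F x : colfin d -> exists2 F', uniq F' &
  forall b z, b \in F -> gsrc b = x -> gsrc z = x -> d (gdiv z b) != 0 -> z \in F'.
Proof.
move=> hd; elim: F => [|b F [F' uF' hF']]; first by exists [::].
have [Fb uFb hb] := hd (grng b).
exists (undup ([seq gmul w b | w <- Fb] ++ F')); first exact: undup_uniq.
move=> b' z; rewrite inE mem_undup mem_cat => /predU1P[->|b'F] bx zx dz; last first.
  by rewrite (hF' b' z) ?orbT.
apply/orP; left; apply/mapP; exists (gdiv z b); last by rewrite gdivK// zx.
by apply: hb => //; rewrite gsrc_div// zx.
Qed.

Lemma gdiv_gdiv y z b : gsrc y = gsrc b -> gsrc z = gsrc b ->
  gdiv (gdiv y b) (gdiv z b) = gdiv y z.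
Proof.
move=> yb zb; rewrite {1}/gdiv ginv_div// gdiv_div//; by rewrite ?yb ?zb.
Qed.

Lemma op_conv c d F F' f x y : uniq F' -> gsrc y = x ->
  (forall b z, b \in F -> gsrc b = x -> gsrc z = x -> d (gdiv z b) != 0 -> z \in F') ->
  op F' c (op F d f) y = op F (conv c d) f y.
Proof.
move=> uF' yx hF'; apply: op_comp => b bF; rewrite yx => bx.
have yb : gsrc y = gsrc b by rewrite yx.
pose F2 := [seq gdiv z b | z <- F' & `[< gsrc z = x >]].
rewrite (@conv_op _ _ _ _ _ _ F2).
- rewrite /op /F2 big_map big_filter_cond; apply: eq_big => [z|z /andP[/asboolP zx _]].
    case: asboolP => //= zx; apply/asboolP; by rewrite !gsrc_div// zx.
  by rewrite gdiv_gdiv ?zx ?bx.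
- rewrite map_inj_in_uniq ?filter_uniq// => z z'; rewrite !mem_filter.
  move=> /andP[/asboolP zx _] /andP[/asboolP z'x _] e.
  by rewrite -(gdivK (_ : gsrc z = gsrc b)) ?zx// e gdivK// z'x.
- move=> w; rewrite gsrc_div// => wb _ dw; apply/mapP.
  exists (gmul w b); last by rewrite gmulK.
  rewrite mem_filter; apply/andP; split; first by apply/asboolP; rewrite gsrcM.
  by apply: (hF' b) => //; rewrite ?gsrcM// gmulK.
Qed.

Definition gsq d : section rho := conv (sstar d) d.

Lemma nrm_op_sqr d F F' f x : gsrc x = x -> uniq F -> uniq F' -> colfin d ->
  nrm F' x (op F d f) ^+ 2 <= nrm F x f * nrm F x (op F (gsq d) f).
Proof.
move=> hx uF uF' hd; have [F1 uF1 hF1] := column_cover F x hd.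
pose F2 := undup (F' ++ F1); have uF2 : uniq F2 := undup_uniq _.
apply: (@le_trans _ _ (nrm F2 x (op F d f) ^+ 2)).
  rewrite ler_sqr ?nnegrE ?nrm_ge0//; apply: nrm_subset => // b bF.
  by rewrite mem_undup mem_cat bF.
rewrite nrm_sqr ip_adj; apply: le_trans (cauchy_schwarz _ _ _ hx) _.
rewrite ler_wpM2l ?nrm_ge0// le_eqVlt; apply/orP; left; apply/eqP.
apply: eq_nrm => y _ yx; apply: op_conv yx _ => // b z bF bx zx dz.
by rewrite mem_undup mem_cat (hF1 b z) ?orbT.
Qed.

Lemma nrm1 b x f : gsrc b = x -> nrm [:: b] x f = vabs (f b).
Proof.
move=> bx; rewrite /nrm /ip big_mkcond big_seq1 asboolT// vabs_sgmu//.
by rewrite sqrtr_sqr ger0_norm ?vabs_ge0.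
Qed.

(** The diagonal entry of the matrix of [gsq d] at [b] is its value at $bb^{-1}$. This is how
    operator norms are reduced to values at units. *)
Lemma nrm_op1 d b F' f x : gsrc x = x -> gsrc b = x -> uniq F' -> colfin d ->
  nrm F' x (op [:: b] d f) ^+ 2 <= vabs (f b) ^+ 2 * vabs (gsq d (grng b)).
Proof.
move=> hx bx uF' hd; apply: le_trans (nrm_op_sqr f hx (_ : uniq [:: b]) uF' hd) _ => //.
rewrite !nrm1// expr2 -mulrA ler_wpM2l ?vabs_ge0//.
rewrite /op big_mkcond big_seq1 asboolT// mulrC; apply: vabs_mu; exact: fac_div.
Qed.

Lemma nrm_op_sum d F F' f x : gsrc x = x ->
  nrm F' x (op F d f) <= \sum_(b <- F | `[< gsrc b = x >]) nrm F' x (op [:: b] d f).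
Proof.
move=> hx; elim: F => [|b F IH].
  rewrite big_nil (@eq_nrm _ _ _ _ _ _ (szero rho)).
    rewrite /nrm /ip big1 ?vabs0 ?sqrtr0// => b /asboolP bx; exact/mu0r/fac_Vl.
  by move=> y _ _; rewrite /op big_nil.
rewrite big_cons; case: asboolP => bx; last first.
  rewrite (@eq_nrm _ _ _ _ _ _ (op F d f))// => y _ yx; rewrite /op big_cons.
  by rewrite yx asboolF.
apply: (@le_trans _ _ (nrm F' x (op [:: b] d f) + nrm F' x (op F d f))); last by rewrite lerD2l.
rewrite (@eq_nrm _ _ _ _ _ _ (sadd (op [:: b] d f) (op F d f))); first exact: nrm_triangle.
by move=> y _ yx; rewrite /sadd /op !big_cons big_nil; case: asboolP => _; rewrite ?addr0 ?add0r.
Qed.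

Lemma main_estimate c F F' f x L : gsrc x = x -> uniq F -> uniq F' -> 0 <= L ->
  (forall n, colfin (iter n gsq c)) ->
  (forall n b, b \in F -> gsrc b = x -> f b != 0 ->
     vabs (iter n.+1 gsq c (grng b)) <= L ^+ (2 ^ n.+1)) ->
  nrm F' x (op F c f) <= nrm F x f * L.
Proof.
move=> hx uF uF' L0 hc hL.
(* The rows change after the first step because [nrm_op_sqr] returns a norm over [F]. *)
pose r n := nrm (if n is 0%N then F' else F) x (op F (iter n gsq c) f).
pose C := \sum_(b <- F | `[< gsrc b = x >]) vabs (f b).
apply: (@power_trick _ r _ C) => //; first exact: nrm_ge0.
- by move=> n; exact: nrm_ge0.
- by move=> n; apply: nrm_op_sqr => //; case: n.
- move=> n; apply: le_trans (nrm_op_sum _ _ _ _ hx) _.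
  rewrite /C mulr_suml big_seq_cond [leRHS]big_seq_cond; apply: ler_sum => b /andP[bF /asboolP bx].
  have [fb|fb] := eqVneq (f b) 0.
    have : nrm (if n is 0%N then F' else F) x (op [:: b] (iter n gsq c) f) ^+ 2 <= 0.
      apply: le_trans (nrm_op1 f hx bx _ (hc n)) _; first by case: n.
      by rewrite fb vabs0 expr0n mul0r.
    by rewrite fb vabs0 mul0r; have := nrm_ge0 (if n is 0%N then F' else F) x (op [:: b] (iter n gsq c) f); nra.
  rewrite -ler_sqr ?nnegrE ?mulr_ge0 ?nrm_ge0 ?vabs_ge0 ?exprn_ge0//.
  apply: le_trans (nrm_op1 f hx bx _ (hc n)) _; first by case: n.
  rewrite exprMn -exprM -expnSr ler_wpM2l ?sqr_ge0//.
  exact: (hL n b bF bx fb).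
Qed.

(** [opbound] on the vectors supported on arrows with range in [T]; sections supported in [K]
    preserve these vectors when [T] is [K]-invariant. *)
Definition tbound T d M := forall x F F' f, gsrc x = x -> uniq F -> uniq F' ->
  (forall b, f b != 0 -> T (grng b)) -> nrm F' x (op F d f) <= M * nrm F x f.

Definition invariant K T := forall k, K k -> T (gsrc k) -> T (grng k).

Lemma op_supp_range K T d F f y : invariant K T -> supp d `<=` K ->
  (forall b, f b != 0 -> T (grng b)) -> op F d f y != 0 -> T (grng y).
Proof.
move=> KT dK fT; apply: contraNP => nT; apply/eqP; rewrite /op big1// => b /asboolP bx.
have f1 := fac_div (esym bx).
have [->|fb] := eqVneq (f b) 0; first exact: mu0r.
have [->|db] := eqVneq (d (gdiv y b)) 0; first exact: mu0l.
exfalso; apply: nT; rewrite -(grng_div (esym bx)).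
by apply: KT; [exact: dK|rewrite gsrc_div//; exact: fT].
Qed.

Lemma sstar_neq0 d y : sstar d y != 0 -> d (ginv y) != 0.
Proof.
apply: contraNN => /eqP h.
by rewrite -[sstar d y]/(sg y (d (ginv y))) h sg0// ginvK.
Qed.

(** For $k=d^*df$ one has $\|k\|^2\le\|df\|\,\|dk\|\le M\|df\|\,\|k\|$, so a bound for [d] alone
    suffices. Invariance makes [k] again a vector to which [tbound] applies. *)
Lemma tbound_gsq K T d M : subgroupoid K -> invariant K T -> supp d `<=` K ->
  colfin d -> 0 <= M -> tbound T d M -> tbound T (gsq d) (M ^+ 2).
Proof.
move=> [Kinv _] KT dK hd M0 h x F F' f hx uF uF' fT.
have [F1 uF1 hF1] := column_cover F x hd.
pose g := op F d f; pose k := op F1 (sstar d) g.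
have -> : nrm F' x (op F (gsq d) f) = nrm F' x k.
  by apply: eq_nrm => y _ yx; rewrite /k /g (op_conv _ _ uF1 yx hF1).
have gT b : g b != 0 -> T (grng b) by exact: (op_supp_range KT dK fT).
have sdK : supp (sstar d) `<=` K.
  by move=> y /sstar_neq0/dK/Kinv; rewrite ginvK.
have kT b : k b != 0 -> T (grng b) by exact: (op_supp_range KT sdK gT).
have h1 : nrm F1 x g <= M * nrm F x f by exact: h.
have h2 : nrm F1 x (op F' d k) <= M * nrm F' x k by exact: h.
have h3 : nrm F' x k ^+ 2 <= nrm F1 x g * nrm F1 x (op F' d k).
  by rewrite nrm_sqr {1}/k ip_adj sstarK; exact: cauchy_schwarz.
have k0 := nrm_ge0 F' x k; have g0 := nrm_ge0 F1 x g; have f0 := nrm_ge0 F x f.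
have h4 : nrm F' x k ^+ 2 <= M * nrm F1 x g * nrm F' x k.
  by apply: le_trans h3 _; rewrite [leRHS]mulrAC [leRHS]mulrC ler_wpM2l//.
have h5 : nrm F' x k <= M * nrm F1 x g.
  have /predU1P[y0|y0] : (0 == nrm F' x k) || (0 < nrm F' x k) by rewrite -le_eqVlt.
    by rewrite -y0 mulr_ge0.
  by rewrite -(ler_pM2r y0) -expr2.
by apply: le_trans h5 _; rewrite expr2 -mulrA ler_wpM2l.
Qed.

Lemma supp_gsq K d : subgroupoid K -> supp d `<=` K -> colfin d -> supp (gsq d) `<=` K.
Proof.
move=> [Kinv KM] dK hd; apply: (subset_trans (conv_supp hd)) => _ [x [y [sx dy xy ->]]].
apply: KM => //; last exact: dK.
by have := Kinv _ (dK _ (sstar_neq0 sx)); rewrite ginvK.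
Qed.

(** The test vector is the adjoint of [d y] placed at [y], on which [d] has value of norm
    $\|d(y)\|^2$. *)
Lemma tbound_vabs T d M y : 0 <= M -> gsrc y = y -> T y -> tbound T d M -> vabs (d y) <= M.
Proof.
move=> M0 hy Ty h; pose u := sg y (d y); have iy : y = ginv y by rewrite ginv_unit.
have := h y [:: y] [:: y] (single u) hy isT isT.
rewrite nrm_single// nrm1// op_single_unit// => h1.
have {h1} : vabs (mu y (d y) u) <= M * vabs u.
  apply: h1 => b; have [->|by_] := eqVneq b y; first by rewrite grng_unit.
  by rewrite single_out ?eqxx.
have -> : mu y (d y) u = mu y (sg y u) u by rewrite /u sgK.
rewrite vabs_sgmu// /u vabs_sg//.
have /predU1P[y0|y0] : (0 == vabs (d y)) || (0 < vabs (d y)) by rewrite -le_eqVlt vabs_ge0.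
  by rewrite -y0.
by rewrite expr2 ler_pM2r.
Qed.

End Estimates.

(** * Reduction to an invariant set of units *)

Section Reduction.
Variables (R : realType) (G : etaleGroupoid) (rho : fellBundle R G).
Implicit Types (x y z : G) (a c d : section rho) (K S : set G) (L : R).

Lemma normb_ge0 a : (0 <= normb a)%E.
Proof.
apply: ereal_sup_ubound; exists (szero rho).
  by rewrite /fin_supp /supp; apply: (@sub_finite_set _ _ set0) => // x; rewrite /= eqxx.
have n0 : norm2 (szero rho) = 0%E.
  apply/le_anti; rewrite norm2_ge0 andbT; apply/norm2_le => // x F hx uF.
  rewrite -(nrm_nil x (szero rho)) le_eqVlt; apply/orP; left; apply/eqP.
  rewrite /nrm /ip big_nil big1// => b /asboolP bx; exact/mu0r/fac_Vl.
by rewrite conv0r n0 mul0e.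
Qed.

Definition reduction K S : set G := [set y | K y /\ ~ S (gsrc y)].

Lemma opbound_restr_in K S c L : 0 <= L -> supp c `<=` K -> opbound c L ->
  opbound (restr0 (reduction K S) c) L.
Proof.
move=> L0 cK hc; apply: (opbound_restr (Y := ~` S) L0 hc) => y nS.
  rewrite /restr0; case: asboolP => // h; rewrite (supp_at cK)// => Ky.
  by apply: h.
by rewrite /restr0 asboolF// => -[_]; exact: nS.
Qed.

Lemma opbound_restr_out K S c L : 0 <= L -> supp c `<=` K -> opbound c L ->
  opbound (restr0 (~` reduction K S) c) L.
Proof.
move=> L0 cK hc; apply: (opbound_restr (Y := S) L0 hc) => y Sy.
  by rewrite /restr0 asboolT// => -[].
rewrite /restr0; case: asboolP => // h; rewrite (supp_at cK)// => Ky.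
by apply: h.
Qed.

Lemma rowcolfin_restr D c : rowcolfin c -> rowcolfin (restr0 D c).
Proof.
move=> [h1 h2]; split=> x.
  have [F uF hF] := h1 x; exists F => // b bx h; apply: hF => //.
  by apply: contraNN h => /eqP h; rewrite /restr0 h; case: asbool.
have [F uF hF] := h2 x; exists F => // b bx h; apply: hF => //.
have := sstar_neq0 h; rewrite /restr0; case: asbool; rewrite ?eqxx// => cb.
apply: contraNN cb => /eqP h'; apply/eqP.
have := @vabs_sg _ _ rho _ b (c (ginv b)) (esym (ginvK b)).
by rewrite [sg b _]h' vabs0 => /esym/vabs_eq0.
Qed.

Lemma ssub_restr D a c : ssub (restr0 D a) (restr0 D c) = restr0 D (ssub a c).
Proof.
by apply: section_eq => y; rewrite /ssub /restr0; case: asbool; rewrite ?subr0.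
Qed.

Lemma opbound_ssub_sym a c L : opbound (ssub a c) L -> opbound (ssub c a) L.
Proof.
move=> /(opboundZ (-1)); rewrite /cabs normrN1 mul1r; congr opbound.
by apply: section_eq => y; rewrite /sscale /ssub scaleN1r opprB.
Qed.

Lemma opbound_ssubD a c d L M : opbound (ssub a c) L -> opbound (ssub c d) M ->
  opbound (ssub a d) (L + M).
Proof.
move=> h1 h2; have := opboundD h1 h2; congr opbound.
by apply: section_eq => y; rewrite /sadd /ssub subrKA.
Qed.

(* Only arrows of [K] matter for the reduction, and [S] collects the units
   that are linked by [K] to the source of a bad arrow. *)
Definition saturation K (N : set G) : set G :=
  @grng G @` (K `&` @gsrc G @^-1` (@gsrc G @` (K `&` N))).

Lemma meagre_saturation K N : sigma_bicompact K -> meagre N -> meagre (saturation K N).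
Proof.
move=> hK mN; apply: meagre_grng_image => //.
by apply: meagre_gsrc_preimage; exact: meagre_gsrc_image.
Qed.

Lemma saturation_invariant K N y : subgroupoid K -> K y ->
  saturation K N (grng y) -> saturation K N (gsrc y).
Proof.
move=> [Ki KM] Ky [k [Kk Nk] ky].
have e : gsrc (ginv y) = grng k by rewrite gsrcV.
exists (gmul (ginv y) k); last by rewrite grngM// grngV.
split; first by apply: KM => //; exact: Ki.
by rewrite /= gsrcM.
Qed.

Lemma subgroupoid_reduction K N : subgroupoid K ->
  subgroupoid (reduction K (saturation K N)).
Proof.
move=> sK; have [Ki KM] := sK; split=> [x [Kx nx]|x y [Kx nx] [Ky ny] xy].
  split; first exact: Ki.
  by rewrite gsrcV => h; apply: nx; exact: saturation_invariant.
by split; [exact: KM|rewrite gsrcM].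
Qed.

(** The subgroupoid [K] contains the source of [y], so a bad [y] would link its own source to
    itself. *)
Lemma reduction_good K N y : subgroupoid K -> reduction K (saturation K N) y -> ~ N y.
Proof.
move=> [Ki KM] [Ky ny] Ny; apply: ny; exists (gsrc y); last exact: grng_src.
split; first by apply: KM => //; [exact: Ki|rewrite /composable /= gsrcV].
by exists y => //=; rewrite gsrc_src.
Qed.

Lemma meagre_unreduced K N : sigma_bicompact K -> meagre N ->
  meagre (K `\` reduction K (saturation K N)).
Proof.
move=> hK mN; apply: meagre_sub (meagre_gsrc_preimage (meagre_saturation hK mN)).
by move=> y [Ky h]; apply: contrapT => ny; apply: h.
Qed.

(* The units from which [K] reaches the source of a point of the meagre
   support of [d]; off them [d] vanishes on the whole [K]-orbit. *)
Lemma meagre_orbit_supp K d : sigma_bicompact K -> Bm d ->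
  meagre ([set y | exists2 z, supp d z & gsrc z = y] `|`
    @gsrc G @` (K `&` @grng G @^-1` [set y | exists2 z, supp d z & gsrc z = y])).
Proof.
move=> hK [[_ [K' hK' dK']] md].
have mY : meagre [set y | exists2 z, supp d z & gsrc z = y].
  apply: meagre_sub (meagre_gsrc_image hK' md) => _ [z dz <-].
  by exists z => //; split => //; exact: dK'.
apply: meagreU => //; apply: meagre_gsrc_image => //.
apply: meagre_sub (meagre_ginv (meagre_gsrc_preimage mY)) => y hy.
by apply/ginv_setE => /=; rewrite gsrcV.
Qed.

Lemma Cc_iter_gsq c n : Cc c -> Cc (iter n (@gsq _ _ rho) c).
Proof.
by move=> hc; elim: n => //= n IH; apply: Cc_conv => //; exact: Cc_sstar.
Qed.

(* At a generic unit near [z], the section [d] vanishes on the [K]-orbit, so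
   that the powers of [c] are bounded there by those of [c - d]; norm
   continuity carries the bound to [z]. *)
Lemma iter_gsq_bound K c d L z n : subgroupoid K -> sigma_bicompact K -> Cc c ->
  supp c `<=` K -> Bm d -> 0 <= L -> opbound (ssub c d) L -> gsrc z = z ->
  {for z, continuous (normfun (iter n (@gsq _ _ rho) c))} ->
  (forall U, open U -> U z -> ~ meagre U) ->
  vabs (iter n (@gsq _ _ rho) c z) <= L ^+ (2 ^ n).
Proof.
move=> sK hK hc cK hd L0 hL uz cz nmz; set q := iter n _ c.
apply/ler_addgt0Pr => e e0.
have /cvgrPdist_lt/(_ e e0) : {for z, continuous (normfun q)} := cz.
rewrite /= nbhsE => -[V [oV Vz] Vq].
set Bad := [set y | exists2 z, supp d z & gsrc z = y] `|`
    @gsrc G @` (K `&` @grng G @^-1` [set y | exists2 z, supp d z & gsrc z = y]).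
have [y [[Vy Uy] nBy]] : exists y, (V `&` units G) y /\ ~ Bad y.
  apply: contrapT => h; apply: (nmz (V `&` units G)).
  - by apply: openI => //; exact: open_units.
  - by split => //; exact/unitsP.
  - apply: meagre_sub (meagre_orbit_supp hK hd) => y yV.
    by apply: contrapT => ny; apply: h; exists y.
have uy : gsrc y = y by exact/unitsP.
(* The [K]-orbit of [y], with [y] added because it need not belong to [K]. *)
pose T : set G := [set w | w = y \/ exists k, [/\ K k, gsrc k = y & grng k = w]].
have [Ki KM] := sK.
have KT : invariant K T.
  move=> k Kk [ky|[k' [Kk' k'y k'k]]]; right; first by exists k.
  exists (gmul k k'); split; [by apply: KM; rewrite /composable /=| |].
    by rewrite gsrcM.
  by rewrite grngM.
have dT w : T (gsrc w) -> d w = 0.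
  move=> Tw; apply/eqP/negPn/negP => dw; apply: nBy.
  case: Tw => [wy|[k [Kk ky kw]]]; first by left; exists w.
  by right; exists k => //; split => //=; exists w => //; rewrite kw.
have bT m : tbound T (iter m (@gsq _ _ rho) c) (L ^+ (2 ^ m)) /\
    supp (iter m (@gsq _ _ rho) c) `<=` K.
  elim: m => [|m [IH1 IH2]].
    (* On vectors with range in [T], [c] and [ssub c d] act alike, because every entry involved has
       its source in [T], where [d] vanishes. *)
    split => // x F F' f hx uF uF' fT; rewrite expr1.
    rewrite (@eq_nrm _ _ _ _ _ _ (op F (ssub c d) f)); first exact: hL.
    move=> w _ wx; rewrite /op; apply: eq_bigr => b /asboolP bw.
    have f1 := fac_div (esym bw).
    have [->|fb] := eqVneq (f b) 0; first by rewrite !mu0r.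
    by rewrite /ssub (dT (gdiv w b)) ?subr0// gsrc_div//; exact: fT.
  have cf : colfin (iter m (@gsq _ _ rho) c) by apply/Cc_colfin/Cc_iter_gsq.
  split; last exact: supp_gsq.
  rewrite expnSr exprM; apply: (tbound_gsq sK KT IH2 cf _ IH1); exact: exprn_ge0.
have Lm : 0 <= L ^+ (2 ^ n) by exact: exprn_ge0.
have h1 : vabs (q y) <= L ^+ (2 ^ n).
  by apply: (tbound_vabs Lm uy _ (bT n).1); left.
have := Vq y Vy; rewrite /normfun /= ltr_norml -/(vabs (q z)) -/(vabs (q y)).
by rewrite /fnorm -/(vabs (q z)) -/(vabs (q y)); lra.
Qed.

End Reduction.

Section Final.
Variables (R : realType) (G : etaleGroupoid) (rho : fellBundle R G).
Implicit Types (x y z : G) (a c d : section rho) (K S : set G) (L : R).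

Lemma Cr_approx a t : Cr a -> 0 < t -> exists2 c, Cc c & opbound (ssub a c) t.
Proof.
move=> ha t0; have [c cc /ltW hc] := ha t t0; exists c => //.
by apply/normb_le => //; exact: ltW.
Qed.

(** On [f] the reduced section acts as [c] does on [f1], the part of [f] with range off [S]; only
    units off [S] then enter [main_estimate]. *)
Lemma opbound_reduction K S c L : subgroupoid K -> supp c `<=` K -> Cc c -> 0 <= L ->
  (forall z n, gsrc z = z -> K z -> ~ S z -> vabs (iter n.+1 (@gsq _ _ rho) c z) <= L ^+ (2 ^ n.+1)) ->
  opbound (restr0 (reduction K S) c) L.
Proof.
move=> sK cK hc L0 hL x F F' f hx uF uF'.
pose f1 : section rho := restr0 (@grng G @^-1` (~` S)) f.
have sn n : supp (iter n (@gsq _ _ rho) c) `<=` K.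
  elim: n => //= n IH; apply: supp_gsq => //; exact/Cc_colfin/Cc_iter_gsq.
rewrite (@eq_nrm _ _ _ _ _ _ (op F c f1)); last first.
  move=> y _ yx; apply: eq_bigr => b /asboolP by_.
  have f3 := fac_div (esym by_).
  rewrite /f1 /restr0; case: (asboolP ((_ @^-1` _) b)) => Sb; last first.
    rewrite asboolF; first by rewrite mu0l ?mu0r.
    by move=> [_]; rewrite gsrc_div.
  case: asboolP => // h; rewrite (supp_at cK) ?mu0l// => Kb; apply: h; split => //.
  by rewrite gsrc_div.
rewrite mulrC; apply: (@le_trans _ _ (nrm F x f1 * L)).
  apply: main_estimate => //; first by move=> n; exact/Cc_colfin/Cc_iter_gsq.
  move=> n b bF bx; rewrite /f1 /restr0; case: asboolP => [nS _|]; last by rewrite eqxx.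
  (* The range of an arbitrary [b] may lie outside [K], where all iterates vanish. *)
  have [Kb|nK] := pselect (K (grng b)); first by apply: hL => //; exact: gsrc_rng.
  by rewrite (supp_at (sn n.+1) nK) vabs0 exprn_ge0.
by rewrite ler_wpM2r// nrm_restr0.
Qed.

End Final.

Theorem theorem3p20 (R : realType) (Gamma : etaleGroupoid)
    (rho : fellBundle R Gamma) (a : section rho) (ha : Cr a) :
  exists K G : set Gamma,
    [/\ sigma_bicompact K,
        G `<=` K /\ subgroupoid G,
        G `<=` cont_points (smap a) `&` cont_points (normfun a),
        meagre (supp a `\` G) &
        norme a = normb (restr0 G a)].
Proof.
have /choice[c hc] : forall j : nat, exists c, Cc c /\ opbound (ssub a c) (j.+1%:R^-1).
  by move=> j; have [|c cc h] := @Cr_approx _ _ _ a (j.+1%:R^-1) ha; [rewrite invr_gt0|exists c].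
have cc j : Cc (c j) by have [] := hc j.
have ac j : opbound (ssub a (c j)) (j.+1%:R^-1) by have [] := hc j.
have j0 j : 0 < j.+1%:R^-1 :> R by rewrite invr_gt0.
have small t : 0 < t -> exists j, j.+1%:R^-1 <= t :> R.
  move=> t0; exists (Num.bound t^-1); rewrite -[leRHS]invrK lef_pV2 ?posrE ?invr_gt0//.
  have := archi_boundP (ltW (_ : 0 < t^-1)); rewrite invr_gt0 => /(_ t0) /ltW h.
  by apply: le_trans h _; rewrite ler_nat.
have acv j y : vabs (a y - c j y) <= j.+1%:R^-1.
  by apply: (opbound_vabs (c := ssub a (c j))) => //; exact: ltW.
have /choice[e he] : forall j, exists e : nat -> set Gamma,
    (forall n, bicompact (e n)) /\ supp (c j) `<=` \bigcup_n e n.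
  by move=> j; have [e h1 h2] := Cc_supp (cc j); exists e.
pose e' k := if (choice.unpickle k : option (nat * nat)) is Some p then e p.1 p.2 else set0.
have [|K [hK sK eK]] := @sigma_bicompact_subgroupoid _ e'.
  move=> k; rewrite /e'; case: (choice.unpickle k) => [p|]; last exact: bicompact0.
  by have [] := he p.1.
have cK j : supp (c j) `<=` K.
  move=> y /(he j).2[n _ ey]; apply: (eK (choice.pickle (j, n))).
  by rewrite /e' choice.pickleK.
have aK : supp a `<=` K.
  move=> y ay; apply: contrapT => nK; move: ay; rewrite /supp /=.
  suff -> : a y = 0 by rewrite eqxx.
  apply: vabs_eq0; apply: le_anti; rewrite vabs_ge0 andbT.
  apply/ler_addgt0Pr => t /small[j hj]; rewrite add0r; apply: le_trans hj.
  by have := acv j y; rewrite (supp_at (cK j) nK) subr0.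
pose W := \bigcup_(U in [set U : set Gamma | open U /\ meagre U]) U.
pose N := W `|` \bigcup_j (~` cont_points (smap (c j)) `|`
  \bigcup_n ~` cont_points (normfun (iter n (@gsq _ _ rho) (c j)))).
have mN : meagre N.
  apply: meagreU; first exact: meagre_open_bigcup.
  apply: meagre_bigcup => j; apply: meagreU.
    have [M [_ ndM hM]] := Cc_discontinuity (cc j).
    apply: meagre_sub (meagre_nd ndM) => y; apply: contra_notP => /hM; exact.
  apply: meagre_bigcup => n.
  have [M [cM ndM hM]] := Cc_discontinuity (Cc_iter_gsq n (cc j)).
  exact: normfun_continuous cM ndM hM.
pose S := saturation K N.
exists K, (reduction K S); split => //.
- by split; [move=> y []|exact: subgroupoid_reduction].
- move=> y hy; have nN := reduction_good sK hy.
  have cs j : {for y, continuous (smap (c j))}.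
    by apply: contrapT => h; apply: nN; right; exists j => //; left.
  (* The index [n = 0] in [N] is [c j] itself. *)
  have cn j : {for y, continuous (normfun (c j))}.
    by apply: contrapT => h; apply: nN; right; exists j => //; right; exists 0%N.
  split.
    apply: uniform_limit_continuous => t /small[j hj]; exists (c j) => // z.
    exact: le_trans (acv j z) hj.
  apply: uniform_limit_normfun => t /small[j hj]; exists (c j) => // z.
  exact: le_trans (acv j z) hj.
- apply: meagre_sub (meagre_unreduced hK mN) => y [ay ny]; split => //; exact: aK.
have [La La0 hLa] : exists2 L, 0 <= L & opbound a L.
  have [M M0 hM] := Cc_opbound (cc 0%N); exists (1%:R^-1 + M).
    by rewrite addr_ge0// ltW.
  have := opboundD (ac 0%N) hM; congr opbound.
  by apply: section_eq => y; rewrite /sadd /ssub subrK.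
set H := reduction K S.
have sub_supp j : supp (ssub a (c j)) `<=` K.
  move=> y; apply: contraPP => nK; rewrite /supp /= /ssub.
  by rewrite (supp_at aK nK) (supp_at (cK j) nK) subr0 eqxx.
apply/eqP; rewrite eq_le; apply/andP; split.
  have eb : ssub a (restr0 (~` H) a) = restr0 H a.
    apply: section_eq => y; rewrite /ssub /restr0; case: (asboolP (H y)) => h.
      by rewrite asboolF ?subr0//; apply: contrapT.
    by rewrite asboolT ?subrr.
  rewrite -eb; apply: ereal_inf_lbound; exists (restr0 (~` H) a) => //; split; [split|].
  + apply: (bigB_approx La0); first exact: opbound_restr_out.
    move=> t /small[j hj]; exists (restr0 (~` H) (c j)).
      exact/rowcolfin_restr/Cc_rowcolfin.
    rewrite ssub_restr; apply: opbound_restr_out => //; last exact: opboundW (ac j) hj.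
    exact: le_trans (ltW (j0 j)) hj.
  + exists K => // y; apply: contraPP => nK; rewrite /supp /= /restr0.
    by rewrite (supp_at aK nK); case: asbool; rewrite eqxx.
  + apply: meagre_sub (meagre_unreduced hK mN) => y; rewrite /supp /= /restr0.
    case: asboolP => [nH ay|_]; last by rewrite eqxx.
    by split => //; exact: aK.
apply: le_ereal_inf_tmp => _ [b hb <-].
have := normb_ge0 (ssub a b); case E : (normb (ssub a b)) => [r| |] // r0; last first.
  by rewrite leey.
have hr : opbound (ssub a b) r by apply/normb_le; rewrite ?E.
apply/lee_addgt0Pr => t t0; rewrite -EFinD.
(* One half of [t] pays for replacing [a] by [c j] in [ssub a b], the other for returning from the
   reduction of [c j] to that of [a]. *)
have [|j hj] := small (t / 2); first by lra.
apply/normb_le; first by rewrite addr_ge0// ltW.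
have hcb : opbound (ssub (c j) b) (t / 2 + r).
  by apply: opbound_ssubD hr; apply: opbound_ssub_sym; exact: opboundW (ac j) hj.
have h1 : opbound (restr0 H (c j)) (t / 2 + r).
  have L0 : 0 <= t / 2 + r by rewrite addr_ge0//; lra.
  apply: opbound_reduction => // z n uz Kz nS.
  have nN : ~ N z by apply: (reduction_good sK (N := N)); split; rewrite ?uz.
  apply: (iter_gsq_bound sK hK (cc j) (cK j) hb L0 hcb uz).
    by apply: contrapT => h; apply: nN; right; exists j => //; right; exists n.+1.
  by move=> U oU Uz mU; apply: nN; left; exists U.
have h2 : opbound (restr0 H (ssub a (c j))) (t / 2).
  apply: opbound_restr_in => //; last exact: opboundW (ac j) hj.
  by lra.
have := opboundD h1 h2; have -> : t / 2 + r + t / 2 = r + t by lra.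
congr opbound; apply: section_eq => y; rewrite /sadd /restr0 /ssub.
by case: asbool; rewrite ?addr0// addrC subrK.
Qed.
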